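(* Let $\eta^{ij}$ ($N\times N$) and $\mu^{mn}$ ($L\times L$) be constant nondegenerate symmetric matrices. If functions $\psi_n(u)$, $1\le n\le L$, are a solution of the nonlinear system $$\mu^{\alpha\beta}\left(\frac{\partial^2\psi_\alpha}{\partial u^i\partial u^k}\frac{\partial^2\psi_\beta}{\partial u^j\partial u^l}-\frac{\partial^2\psi_\alpha}{\partial u^i\partial u^l}\frac{\partial^2\psi_\beta}{\partial u^j\partial u^k}\right)=0,\qquad \eta^{ij}\left(\frac{\partial^2\psi_\alpha}{\partial u^i\partial u^k}\frac{\partial^2\psi_\beta}{\partial u^j\partial u^l}-\frac{\partial^2\psi_\alpha}{\partial u^i\partial u^l}\frac{\partial^2\psi_\beta}{\partial u^j\partial u^k}\right)=0$$ (for all values of the free indices), then the systems of hydrodynamic type $$u^i_{t_n}=\eta^{is}\frac{\partial^2\psi_n}{\partial u^s\partial u^j}u^j_x,\qquad 1\le n\le L,$$ are commuting integrable bi-Hamiltonian systems of hydrodynamic type. Moreover, in this case the nonlocal operator $$M_1^{ij}=\sum_{m=1}^L\sum_{n=1}^L\mu^{mn}\eta^{ip}\eta^{jr}\frac{\partial^2\psi_m}{\partial u^p\partial u^k}u^k_x\left(\frac{d}{dx}\right)^{-1}\circ\frac{\partial^2\psi_n}{\partial u^r\partial u^s}u^s_x$$ is also a Hamiltonian operator, and this nonlocal Hamiltonian operator is compatible with the constant Hamiltonian operator $M_2^{ij}=\eta^{ij}\frac{d}{dx}$.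
   Context: Here $u=(u^1,\dots,u^N)$, $u^i(x)$ are fields of one variable $x$; all functions are smooth; repeated upper and lower indices are summed. An operator $M^{ij}$ is Hamiltonian if $\{I,J\}=\int\frac{\delta I}{\delta u^i(x)}M^{ij}\frac{\delta J}{\delta u^j(x)}\,dx$ is a Poisson bracket (skew-symmetric, Jacobi identity) on functionals of the fields. Two Hamiltonian operators are compatible if any linear combination of them with constant coefficients is Hamiltonian. A system is (integrable) bi-Hamiltonian if it has the form $u^i_t=M^{ij}\,\delta H/\delta u^j(x)$ with respect to each of two compatible Hamiltonian operators (with respective Hamiltonians). Systems $u^i_t=V^i_j(u)u^j_x$ are called systems of hydrodynamic type. *)

(* Defs.v *)
From HB Require Import structures.
From mathcomp Require Import all_boot all_order all_algebra.
From mathcomp Require Import all_classical all_reals all_analysis.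
Set Implicit Arguments.
Unset Strict Implicit.
Unset Printing Implicit Defensive.
Import Order.TTheory GRing.Theory Num.Theory.
Import numFieldNormedType.Exports.
Local Open Scope classical_set_scope.
Local Open Scope ring_scope.

(* Iterated directional derivatives up to order n exist and are continuous
   on A; for A open in a finite-dimensional space this is C^n. *)
Fixpoint Cn {R : realType} {E F : normedModType R} (n : nat) (A : set E)
    (f : E -> F) : Prop :=
  (forall x, A x -> {for x, continuous f}) /\
  match n with
  | 0%N => True
  | n'.+1 => forall v : E, (forall x, A x -> derivable f x v) /\
                           Cn n' A (fun x => 'D_v f x)
  end.

Definition smooth {R : realType} {E F : normedModType R} (A : set E)
    (f : E -> F) : Prop :=
  forall n, Cn n A f.

Definition dot {R : realType} {N : nat} (a b : 'rV[R]_N) : R :=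
  \sum_(i < N) a 0 i * b 0 i.

Definition integral {R : realType} (f : R -> R) : R :=
  \int[lebesgue_measure]_(x in [set: R]) f x.

(* (d/dx)^{-1}, normalised to be skew-symmetric:
   (d^{-1} f)(x) = 1/2 (int_{-oo}^x f - int_x^{+oo} f).
   It is only applied to smooth functions with compact support. *)
Definition dinv {R : realType} (f : R -> R) (x : R) : R :=
  2^-1 * (\int[lebesgue_measure]_(y in `]-oo, x]) f y
        - \int[lebesgue_measure]_(y in `[x, +oo[) f y).

(* Phase space: smooth U-valued fields u(x), x real, equal to the fixed vacuum
   value c for all large |x|.  Hence u_x has compact support, and tangent
   vectors at u are the smooth maps R -> R^N with compact support. *)
Definition field {R : realType} {N : nat} (U : set 'rV[R]_N) (c : 'rV[R]_N)
    (u : R -> 'rV[R]_N) : Prop :=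
  [/\ smooth [set: R] u,
      forall x, U (u x) &
      exists A : R, forall x, A <= `|x| -> u x = c].

(* Smooth finite-parameter families of fields, s ranging over an open set O
   of R^k. *)
Definition field_family {R : realType} {N : nat} (U : set 'rV[R]_N)
    (c : 'rV[R]_N) (k : nat) (O : set 'rV[R]_k)
    (phi : 'rV[R]_k -> R -> 'rV[R]_N) : Prop :=
  [/\ open O,
      smooth (O `*` [set: R]) (fun p : 'rV[R]_k * R => phi p.1 p.2),
      forall s x, O s -> U (phi s x) &
      forall s, O s -> exists A : R, \forall t \near s,
        forall x, A <= `|x| -> phi t x = c].

(* G is the variational derivative of F:
     d/ds F[phi_s] = int (delta F/delta u^i(x)) (d phi_s^i/ds)(x) dx
   along every smooth family of fields.  The variational derivative is again
   smooth along families, and for |x| large it is a constant vector, the same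
   near -oo and near +oo (for F = int (h(u) - h(c)) dx it is grad h(c)). *)
Definition has_variational_derivative {R : realType} {N : nat}
    (U : set 'rV[R]_N) (c : 'rV[R]_N) (F : (R -> 'rV[R]_N) -> R)
    (G : (R -> 'rV[R]_N) -> R -> 'rV[R]_N) : Prop :=
  forall (k : nat) (O : set 'rV[R]_k) (phi : 'rV[R]_k -> R -> 'rV[R]_N),
  field_family U c O phi ->
  [/\ smooth (O `*` [set: R]) (fun p : 'rV[R]_k * R => G (phi p.1) p.2),
      forall s, O s -> exists A : R, \forall t \near s, forall x y,
        A <= `|x| -> A <= `|y| -> G (phi t) x = G (phi t) y &
      forall s v, O s ->
        is_derive s v (fun t => F (phi t))
          (integral (fun x => dot (G (phi s) x) ('D_v (fun t => phi t x) s)))].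

(* Functionals need not be local: nonlocal operators take local functionals to
   nonlocal ones, and the class has to be closed under the bracket. *)
Record functional {R : realType} {N : nat} (U : set 'rV[R]_N)
    (c : 'rV[R]_N) := Functional {
  fval : (R -> 'rV[R]_N) -> R;
  vder : (R -> 'rV[R]_N) -> R -> 'rV[R]_N;
  vderP : has_variational_derivative U c fval vder
}.

(* An operator M^{ij} sends a field u and a covector xi_j(x) to the vector
   (M^{ij} xi_j)(x). *)
Definition operator (R : realType) (N : nat) : Type :=
  (R -> 'rV[R]_N) -> (R -> 'rV[R]_N) -> R -> 'rV[R]_N.

Definition op_comb {R : realType} {N : nat} (a b : R) (M M' : operator R N) :
    operator R N :=
  fun u xi x => a *: M u xi x + b *: M' u xi x.

Definition bracket {R : realType} {N : nat} {U : set 'rV[R]_N}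
    {c : 'rV[R]_N} (M : operator R N) (I J : functional U c)
    (u : R -> 'rV[R]_N) : R :=
  integral (fun x => dot (vder I u x) (M u (vder J u) x)).

Definition represents {R : realType} {N : nat} {U : set 'rV[R]_N}
    {c : 'rV[R]_N} (K : functional U c) (B : (R -> 'rV[R]_N) -> R) : Prop :=
  forall u, field U c u -> fval K u = B u.

(* The bracket is an internal operation on functionals, bilinear (linear in the
   second argument, and skew), and satisfies the Jacobi identity. *)
Definition hamiltonian {R : realType} {N : nat} (U : set 'rV[R]_N)
    (c : 'rV[R]_N) (M : operator R N) : Prop :=
  [/\ forall I J : functional U c, exists K : functional U c,
        represents K (bracket M I J),
      forall (I J K S : functional U c) (a : R),
        represents S (fun u => a * fval J u + fval K u) ->
        forall u, field U c u ->
          bracket M I S u = a * bracket M I J u + bracket M I K u,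
      forall (I J : functional U c) u, field U c u ->
        bracket M I J u = - bracket M J I u &
      forall I J K IJ JK KI : functional U c,
        represents IJ (bracket M I J) ->
        represents JK (bracket M J K) ->
        represents KI (bracket M K I) ->
        forall u, field U c u ->
          bracket M IJ K u + bracket M JK I u + bracket M KI J u = 0].

Definition compatible {R : realType} {N : nat} (U : set 'rV[R]_N)
    (c : 'rV[R]_N) (M M' : operator R N) : Prop :=
  [/\ hamiltonian U c M, hamiltonian U c M' &
      forall a b : R, hamiltonian U c (op_comb a b M M')].

(* An evolutionary system u_t = V[u]. *)
Definition evolution (R : realType) (N : nat) : Type :=
  (R -> 'rV[R]_N) -> R -> 'rV[R]_N.

(* u_t = V[u] has the form u^i_t = M^{ij} delta H/delta u^j(x). *)
Definition hamiltonian_system {R : realType} {N : nat} (U : set 'rV[R]_N)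
    (c : 'rV[R]_N) (M : operator R N) (V : evolution R N) : Prop :=
  exists H : functional U c, forall u, field U c u -> V u = M u (vder H u).

Definition bihamiltonian_system {R : realType} {N : nat} (U : set 'rV[R]_N)
    (c : 'rV[R]_N) (M M' : operator R N) (V : evolution R N) : Prop :=
  [/\ compatible U c M M', hamiltonian_system U c M V &
      hamiltonian_system U c M' V].

(* Equality of the mixed derivatives u_{t t'} and u_{t' t} of the systems
   u_t = V[u], u_{t'} = W[u]: V'[W] = W'[V] at every smooth U-valued u(x). *)
Definition commuting {R : realType} {N : nat} (U : set 'rV[R]_N)
    (V W : evolution R N) : Prop :=
  forall u : R -> 'rV[R]_N, smooth [set: R] u -> (forall x, U (u x)) ->
  forall x : R, exists d : 'rV[R]_N,
    is_derive (0 : R) (1 : R) (fun e => V (fun y => u y + e *: W u y) x) d /\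
    is_derive (0 : R) (1 : R) (fun e => W (fun y => u y + e *: V u y) x) d.

Definition partial {R : realType} {N : nat} (i : 'I_N) (f : 'rV[R]_N -> R)
    (u : 'rV[R]_N) : R :=
  'D_(delta_mx 0 i) f u.

Definition partial2 {R : realType} {N : nat} (i j : 'I_N)
    (f : 'rV[R]_N -> R) : 'rV[R]_N -> R :=
  partial i (partial j f).

(* eta^{is} (d^2 psi / du^s du^j) u^j_x *)
Definition hydro_flow {R : realType} {N : nat} (eta : 'M[R]_N)
    (psi : 'rV[R]_N -> R) : evolution R N :=
  fun u x => \row_(i < N) \sum_(s < N) \sum_(j < N)
    eta i s * partial2 s j psi (u x) * derive1 u x 0 j.

Definition const_op {R : realType} {N : nat} (eta : 'M[R]_N) : operator R N :=
  fun u xi x => \row_(i < N) \sum_(j < N) eta i j * derive1 xi x 0 j.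

Definition nonlocal_op {R : realType} {N L : nat} (eta : 'M[R]_N)
    (mu : 'M[R]_L) (psi : 'I_L -> 'rV[R]_N -> R) : operator R N :=
  fun u xi x => \row_(i < N) \sum_(j < N) \sum_(m < L) \sum_(n < L)
    \sum_(p < N) \sum_(r < N) \sum_(k < N)
      mu m n * eta i p * eta j r
      * partial2 p k (psi m) (u x) * derive1 u x 0 k
      * dinv (fun y => \sum_(s < N)
          partial2 r s (psi n) (u y) * derive1 u y 0 s * xi y 0 j) x.

(* Main.v *)
(** Write [V_m = psi_m'' eta] and [w_m = u_x V_m], so that the nonlocal operator
    is [M_1 xi = sum mu^{mn} w_m d^{-1} <w_n, xi>].  The second half of the system
    says that the matrices [V_m] commute, the first half that
    [sum mu^{mn} (x V_m) (x) (y V_n)] is symmetric in [x] and [y].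

    Commuting flows: since [w_m] is the [x]-derivative of [psi_m' eta], the
    derivative of the [n]-th flow along the [m]-th one is [(u_x V_m V_n)_x].

    Jacobi identity for [M = a M_1 + b M_2]: the derivative of [{I, J}] along
    [X = M delta K] is the sum of two terms containing the Hessians of [I] and [J]
    and of the variation of [M_1].  Hessians of functionals are symmetric, so their
    terms cancel in the cyclic sum.  The cyclic sum of the variations of [M_1] is,
    by the two identities above, the integral of the derivative of an explicit
    function with compact support.  The bracket has an explicit variational
    derivative, so it is again a functional.

    Hamiltonians: [psi_n] is one for [M_2].  For [M_1 + M_2] one looks for [h]
    with gradient [p] and for functions [g_n] such that
    [dp = sum mu^{mn} g_n psi_m'' du] and [dg_n = - <du V_n, p>]; then
    [d^{-1} <w_n, p(u)> = g_n(c) - g_n(u)], the terms in [g_n(u)] cancel, and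
    [(M_1 + M_2) p(u) = sum mu^{mn} g_n(c) w_m].  The connection form [Omega] of this
    linear system satisfies [d Omega = 0] and [Omega /\ Omega = 0] separately, so that
    the Picard iterates [dY_{k+1} = Omega Y_k] are exact at every step, by the Poincare
    lemma on the convex set [U], and [Y = sum Y_k] solves the system. *)

From Pilot Require Import Defs.
From mathcomp Require Import all_boot all_order all_algebra.
From mathcomp Require Import all_classical all_reals all_analysis.
From mathcomp Require Import ring lra.
Import Order.TTheory GRing.Theory Num.Theory.
Import numFieldNormedType.Exports.
Import Pilot.Defs.
Set Implicit Arguments.
Unset Strict Implicit.
Unset Printing Implicit Defensive.
Local Open Scope classical_set_scope.
Local Open Scope ring_scope.

(** * Smooth functions *)

Section calculus.
Context {R : realType}.
Implicit Types E F : normedModType R.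

(** [Cn] speaks of directional derivatives only, so linearity in the direction, the chain rule and
    the symmetry of mixed derivatives all have to be extracted from the continuity of those
    derivatives. A functional is known only through its values along finite-parameter families.
    Statements about variational derivatives are therefore proved as statements about values: the
    pairing of [vder I] with a tangent vector [X] is a derivative of [fval I] along [u + e X], and
    symmetry of Hessians is equality of mixed derivatives along a family with one more parameter. A
    second obstacle is that [d^{-1}] of a compactly supported function takes opposite, in general
    nonzero, values at the two ends. Integration by parts still leaves no boundary terms, because
    antiderivatives occur in products of two or next to a factor with compact support. The pair of
    operators for the flows is [M_2] and [M_1 + M_2]: the local part of the second one is what
    absorbs the [u]-dependence of [g_n], and the constants [g_n(c)] left over are free, so that a
    nondegenerate [mu] singles out any one flow. *)

Lemma is_derive_epsP E F (f : E -> F) x v d :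
  is_derive x v f d <->
  forall e : R, 0 < e -> exists2 r : R, 0 < r &
    forall h : R, `|h| < r -> `|f (x + h *: v) - f x - h *: d| <= e * `|h|.
Proof.
split=> [[df dE] e e0|H].
  move/cvgrPdist_le : (df); rewrite -/(derive _ _ _) dE => /(_ _ e0).
  rewrite near_withinE => -[/= r r0 rP]; exists r => // h hr.
  have [->|h0] := eqVneq h 0.
    by rewrite !scale0r addr0 subrr subr0 !normr0 mulr0.
  have := rP h; rewrite /ball_ /= sub0r normrN => /(_ hr h0).
  rewrite distrC [h *: v + x]addrC.
  have -> : f (x + h *: v) - f x - h *: d = h *: (h^-1 *: (f (x + h *: v) - f x) - d).
    by rewrite scalerBr scalerA divff// scale1r.
  by move=> ?; rewrite normrZ mulrC ler_wpM2r.
suff : (fun h => h^-1 *: ((f \o shift x) (h *: v) - f x)) @ 0^' --> d.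
  by move=> dl; split; [apply/cvg_ex; exists d|exact/cvg_lim].
apply/cvgrPdist_le => e e0; have [r r0 rP] := H e e0.
rewrite near_withinE; exists r => //= h; rewrite /ball_ /= sub0r normrN => hr h0.
have := rP h hr.
have -> : f (x + h *: v) - f x - h *: d = h *: (h^-1 *: (f (x + h *: v) - f x) - d).
  by rewrite scalerBr scalerA divff// scale1r.
by rewrite normrZ mulrC ler_pM2r ?normr_gt0// distrC [h *: v + x]addrC.
Qed.

Lemma is_derive_line E F (f : E -> F) x v d (t : R) :
  is_derive (x + t *: v) v f d <-> is_derive t 1 (fun t => f (x + t *: v)) d.
Proof.
by split=> /is_derive_epsP H; apply/is_derive_epsP => e /H [r r0 rP];
   exists r => // h /rP; rewrite scalerDl addrA [h *: 1]mulr1.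
Qed.

Lemma derive_unique E F (f : E -> F) x v d d' :
  is_derive x v f d -> is_derive x v f d' -> d = d'.
Proof. by move=> [_ <-] [_ <-]. Qed.

Lemma derivable_continuous (f : R -> R) (t d : R) : is_derive t (1 : R) f d -> {for t, continuous f}.
Proof. by move=> [df _]; apply/differentiable_continuous/derivable1_diffP. Qed.

Lemma MVT_dir E (f df : E -> R) x v (h : R) :
  (forall t : R, `|t| <= `|h| -> is_derive (x + t *: v) v f (df (x + t *: v))) ->
  exists2 t : R, `|t| <= `|h| & f (x + h *: v) - f x = h * df (x + t *: v).
Proof.
move=> H.
pose g t := f (x + t *: v); pose dg t := df (x + t *: v).
have gd (t : R) : `|t| <= `|h| -> is_derive t (1 : R) g (dg t).
  by move=> th; apply: (is_derive_line f x v (dg t) t).1; exact: H.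
have gc (t : R) : `|t| <= `|h| -> {for t, continuous g}.
  by move=> /gd; exact: derivable_continuous.
have [h0|h0] := leP 0 h.
  have [||c + E1] := @MVT_segment R g dg 0 h h0.
  - move=> t; rewrite in_itv/= => /andP[t0 th]; apply: gd.
    by rewrite !ger0_norm// ltW.
  - apply: derivable_within_continuous => t; rewrite in_itv/= => /andP[t0 th].
    by have [] := gd t; rewrite ?ger0_norm.
  - rewrite in_itv/= => /andP[c0 ch]; exists c; first by rewrite !ger0_norm.
    by move: E1; rewrite /g /dg subr0 scale0r addr0 mulrC.
have [||c + E1] := @MVT_segment R g dg h 0 (ltW h0).
- move=> t; rewrite in_itv/= => /andP[t0 th]; apply: gd.
  by rewrite (ltr0_norm th) (ltr0_norm h0) lerN2 ltW.
- apply: derivable_within_continuous => t; rewrite in_itv/= => /andP[t0 th].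
  by have [] := gd t; rewrite // (ler0_norm th) (ltr0_norm h0) lerN2.
- rewrite in_itv/= => /andP[c0 ch]; exists c; first by rewrite (ler0_norm ch) (ltr0_norm h0) lerN2.
  move: E1; rewrite /g /dg sub0r scale0r addr0 mulrN => /eqP.
  by rewrite eq_sym -subr_eq0 => /eqP E1; rewrite mulrC; lra.
Qed.

(** Mean value theorem on the segment from [z] to [z + t b]: the error is governed by the
    oscillation of [df] near [y]. The base point [z] may move, which a derivative at [y] alone does
    not allow; this substitutes for Frechet differentiability. *)
Lemma strict_dir E (f df : E -> R) y b :
  (\forall z \near y, is_derive z b f (df z)) -> {for y, continuous df} ->
  forall e : R, 0 < e -> exists2 r : R, 0 < r & forall z (t : R),
    `|z - y| < r -> `|t| < r -> `|f (z + t *: b) - f z - t * df y| <= e * `|t|.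
Proof.
move=> fd dfc e e0.
have /cvgrPdist_le /(_ e e0) := dfc.
move=> /(filterI fd) /nbhs_ballP[r /= r0 rP].
have B : 0 < 1 + `|b| by rewrite ltr_wpDr.
have Dr : r / 2 / (1 + `|b|) <= r / 2.
  by rewrite ler_pdivrMr// ler_peMr ?lerDl// ltW// divr_gt0.
exists (r / 2 / (1 + `|b|)) => [|z t zr tr]; first by rewrite !divr_gt0.
have aux s : `|s| <= `|t| -> ball y r (z + s *: b).
  move=> st; rewrite -ball_normE /ball_/= distrC addrAC.
  rewrite (le_lt_trans (ler_normD _ _))// (splitr r) ltrD//.
    by rewrite (lt_le_trans zr).
  rewrite normrZ (@le_lt_trans _ _ (`|t| * (1 + `|b|)))//.
    by rewrite ler_pM// ler_wpDl.
  by rewrite -ltr_pdivlMr.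
have [s st ->] := @MVT_dir E f df z b t (fun s st => (rP _ (aux s st)).1).
rewrite -mulrBr normrM mulrC ler_wpM2r// distrC.
exact: (rP _ (aux s st)).2.
Qed.

Lemma is_derive_small E (f : E -> R) x v (d : R) : is_derive x v f d ->
  forall e : R, 0 < e -> exists2 r : R, 0 < r & forall h : R, `|h| < r -> `|f (x + h *: v) - f x| < e.
Proof.
move=> /is_derive_epsP /(_ 1 ltr01) [r r0 rP] e e0.
have D : 0 < 1 + `|d| by rewrite ltr_wpDr.
exists (Num.min r (e / (1 + `|d|))); first by rewrite lt_min r0 divr_gt0.
move=> h; rewrite lt_min => /andP[/rP H1].
rewrite ltr_pdivlMr// => H2.
have : `|f (x + h *: v) - f x| <= `|h| * (1 + `|d|).
  rewrite -[f _ - f x](subrK (h *: d)).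
  by rewrite (le_trans (ler_normD _ _))// mulrDr mulr1 lerD// ?(le_trans H1) ?mul1r// normrM.
by move=> /le_lt_trans; exact.
Qed.

(** The increments of [G] are combinations of finitely many fixed vectors [b i], so the way from
    [G x] to [G (x + h v)] can be followed one direction at a time. Each leg starts from a shifted
    point, which [strict_dir] tolerates; only the derivatives of [f] along the [b i] are used. *)
Lemma derive_affine_comp E F n (f : F -> R) (df : 'I_n -> F -> R) (b : 'I_n -> F)
    (g : 'I_n -> E -> R) (G : E -> F) (x v : E) (dg : 'I_n -> R) :
  (forall z z', G z' = G z + \sum_i (g i z' - g i z) *: b i) ->
  (forall i, is_derive x v (g i) (dg i)) ->
  (forall i, \forall z \near G x, is_derive z (b i) f (df i z)) ->
  (forall i, {for G x, continuous (df i)}) ->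
  is_derive x v (f \o G) (\sum_i dg i * df i (G x)).
Proof.
move=> GE gd fd dfc.
pose k i h := g i (x + h *: v) - g i x.
(* Induction over a list of directions. The first bound keeps the starting point of the next leg
   near [G x]; the second is the derivative estimate for the legs done so far. *)
suff main (s : seq 'I_n) : forall e : R, 0 < e -> exists2 r : R, 0 < r &
    forall h : R, `|h| < r ->
      `|\sum_(i <- s) k i h *: b i| <= e /\
      `|f (G x + \sum_(i <- s) k i h *: b i) - f (G x) - h * \sum_(i <- s) dg i * df i (G x)|
       <= e * `|h|.
  apply/is_derive_epsP => e e0; have [r r0 rP] := main (index_enum 'I_n) e e0.
  by exists r => // h /rP[_]; rewrite /= -/(\sum_i _) -(GE x (x + h *: v)).
elim: s => [|i s IH] e e0.
  exists 1 => // h _; rewrite !big_nil addr0 mulr0 subr0 subrr !normr0.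
  by split; [exact: ltW|rewrite mulr_ge0// ltW].
set c := df i (G x).
(* [K] bounds both the slope of [k i h] in [h], once its error is below 1, and the factor [c]. Each
   of the two new error terms is then at most [e / 4] times the size of [h]. *)
pose K := 1 + `|dg i| + `|c|.
have K0 : 0 < K by rewrite /K -addrA ltr_wpDr// addr_ge0.
pose e1 := e / 4 / K.
have e10 : 0 < e1 by rewrite !divr_gt0.
have [r1 r10 r1P] := strict_dir (fd i) (dfc i) e10.
have e20 : 0 < Num.min (e / 4) (r1 / 2) by rewrite lt_min !divr_gt0.
have [r2 r20 r2P] := IH _ e20.
have e30 : 0 < Num.min 1 e1 by rewrite lt_min ltr01.
have /is_derive_epsP /(_ _ e30) [r3 r30 r3P] := gd i.
have B : 0 < 1 + `|b i| by rewrite ltr_wpDr.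
have e40 : 0 < Num.min r1 (e / 4 / (1 + `|b i|)) by rewrite lt_min r10 !divr_gt0.
have [r4 r40 r4P] := is_derive_small (gd i) e40.
exists (Num.min r2 (Num.min r3 r4)); first by rewrite !lt_min r20 r30.
move=> h; rewrite !lt_min => /and3P[/r2P[S1 S2] /r3P H3 /r4P H4].
rewrite !big_cons.
set S := \sum_(j <- s) _ in S1 S2 *; set T := \sum_(j <- s) _ in S2 *.
rewrite -/(k i h) lt_min in H4; case/andP : H4 => H4 H5.
rewrite -/(k i h) /GRing.scale/= in H3.
have kb : `|k i h *: b i| <= e / 4.
  rewrite normrZ (@le_trans _ _ (`|k i h| * (1 + `|b i|)))//.
    by rewrite ler_wpM2l// ler_wpDl.
  by rewrite -ler_pdivlMr// ltW.
have Sle : `|S| <= e / 4 by rewrite (le_trans S1)// ge_min lexx.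
have S2' : `|f (G x + S) - f (G x) - h * T| <= e / 4 * `|h|.
  by rewrite (le_trans S2)// ler_wpM2r// ge_min lexx.
split.
  rewrite (le_trans (ler_normD _ _))//; lra.
have Sr : `|G x + S - G x| < r1.
  rewrite addrC addKr (le_lt_trans S1)// gt_min; apply/orP; right; lra.
have := r1P _ _ Sr H4; rewrite -/c => F1.
have H3a : `|k i h - h * dg i| <= e1 * `|h|.
  by rewrite (le_trans H3)// ler_wpM2r// ge_min lexx orbT.
have H3b : `|k i h| <= K * `|h|.
  rewrite -[k i h](subrK (h * dg i)) (le_trans (ler_normD _ _))//.
  have : `|k i h - h * dg i| <= 1 * `|h|.
    by rewrite (le_trans H3)// ler_wpM2r// ge_min lexx.
  rewrite normrM /K => ?; have : 0 <= `|c| * `|h| by rewrite mulr_ge0.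
  lra.
rewrite [k i h *: b i + S]addrC addrA.
set A := f _ in F1 *; set A' := f (G x + S) in F1 S2' *.
have -> : A - f (G x) - h * (dg i * c + T) =
  (A - A' - k i h * c) + ((A' - f (G x) - h * T) + (k i h - h * dg i) * c) by ring.
rewrite (le_trans (ler_normD _ _))//.
have Fa : `|A - A' - k i h * c| <= e / 4 * `|h|.
  rewrite (le_trans F1)//.
  have -> : e / 4 * `|h| = e1 * (K * `|h|) by rewrite mulrA divfK// gt_eqF.
  by rewrite ler_wpM2l// ltW.
have Fb : `|(k i h - h * dg i) * c| <= e / 4 * `|h|.
  rewrite normrM.
  have -> : e / 4 * `|h| = e1 * `|h| * K by rewrite [RHS]mulrAC divfK// gt_eqF.
  by rewrite ler_pM// /K -addrA ler_wpDl// ler_wpDl.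
have := ler_normD (A' - f (G x) - h * T) ((k i h - h * dg i) * c).
have : 0 <= e * `|h| by rewrite mulr_ge0// ltW.
by move: Fa Fb S2'; set a1 := `|A - _ - _|; set a2 := `|_ * c|; set a3 := `|_ - _ - _|; lra.
Qed.

(** Linearity of the derivative in its direction is not part of [Cn]. It is the chain rule along the
    line [y + t \sum_i c i b i], whose increments have the scalar coefficients [t * c i]. *)
Lemma is_derive_lincomb E n (f : E -> R) (df : 'I_n -> E -> R) (b : 'I_n -> E) y
    (c : 'I_n -> R) :
  (forall i, \forall z \near y, is_derive z (b i) f (df i z)) ->
  (forall i, {for y, continuous (df i)}) ->
  is_derive y (\sum_i c i *: b i) f (\sum_i c i * df i y).
Proof.
move=> fd dfc.
suff : is_derive (y + (0 : R) *: (\sum_i c i *: b i)) (\sum_i c i *: b i) f (\sum_i c i * df i y).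
  by rewrite scale0r addr0.
apply/is_derive_line.
pose G (t : R) := y + t *: \sum_i c i *: b i.
have G0 : G 0 = y by rewrite /G scale0r addr0.
have -> : \sum_i c i * df i y = \sum_i c i * df i (G 0) by rewrite G0.
apply: (@derive_affine_comp R^o E n f df b (fun i (t : R) => t * c i) G 0 1 c); rewrite ?G0//.
  move=> z z'; rewrite /G.
  rewrite -addrA; congr (_ + _); rewrite !scaler_sumr -big_split/=; apply: eq_bigr => i _.
  by rewrite !scalerA -scalerDl addrC subrK.
move=> i; apply/is_derive_epsP => e e0; exists 1 => // h _.
by rewrite add0r mul0r subr0 [h *: 1]mulr1 subrr normr0 mulr_ge0// ltW.
Qed.

Lemma near_eq_continuous_at (T U : topologicalType) (f g : T -> U) x :
  (\forall z \near x, f z = g z) -> {for x, continuous f} -> {for x, continuous g}.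
Proof.
move=> fg fc; rewrite /prop_for /continuous_at -(nbhs_singleton fg).
by apply: cvg_trans fc; exact: near_eq_cvg.
Qed.

Lemma Cn_continuous E F n (A : set E) (f : E -> F) x :
  Cn n A f -> A x -> {for x, continuous f}.
Proof. by case: n => [|n] [+ _] Ax; exact. Qed.

Lemma CnS E F n (A : set E) (f : E -> F) : Cn n.+1 A f -> Cn n A f.
Proof.
elim: n f => [f [fc _]|n IH f [fc fd]]; first by split.
by split=> // v; split; [exact: (fd v).1|exact/IH/(fd v).2].
Qed.

Lemma Cn_eq E F n (A : set E) (f g : E -> F) : open A ->
  (forall x, A x -> f x = g x) -> Cn n A f -> Cn n A g.
Proof.
move=> oA; elim: n f g => [|n IH] f g fg [fc fd].
  split=> // x Ax; apply: near_eq_continuous_at (fc _ Ax).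
  by near=> z; apply: fg; near: z; exact: open_nbhs_nbhs.
have nfg x : A x -> \forall z \near x, f z = g z.
  by move=> Ax; near=> z; apply: fg; near: z; exact: open_nbhs_nbhs.
split=> [x Ax|v]; first exact: near_eq_continuous_at (nfg _ Ax) (fc _ Ax).
split=> [x Ax|]; first exact: near_eq_derivable (nfg _ Ax) ((fd v).1 _ Ax).
by apply: IH (fd v).2 => x Ax; exact/near_eq_derive/nfg.
Unshelve. all: by end_near. Qed.

Lemma Cn_subset E F n (A B : set E) (f : E -> F) : A `<=` B -> Cn n B f -> Cn n A f.
Proof.
move=> AB; elim: n f => [|n IH] f [fc fd]; first by split=> // x /AB; exact: fc.
split=> [x /AB|v]; first exact: fc.
by split=> [x /AB|]; [exact: (fd v).1|exact/IH/(fd v).2].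
Qed.

Lemma Cn_cst E F n (A : set E) (k : F) : Cn n A (fun=> k).
Proof.
elim: n k => [|n IH] k; first by split=> // x _; exact: cst_continuous.
split=> [x _|v]; first exact: cst_continuous.
split=> [x _|]; first exact: derivable_cst.
rewrite [X in Cn _ _ X](_ : _ = fun=> 0)//.
by apply/funext => x; exact: derive_cst.
Qed.

Lemma Cn_add E n (A : set E) (f g : E -> R) : open A ->
  Cn n A f -> Cn n A g -> Cn n A (fun x => f x + g x).
Proof.
move=> oA; elim: n f g => [|n IH] f g [fc fd] [gc gd].
  by split=> // x Ax; apply: cvgD; [exact: fc|exact: gc].
split=> [x Ax|v]; first by apply: cvgD; [exact: fc|exact: gc].
split=> [x Ax|]; first by apply: derivableD; [exact: (fd v).1|exact: (gd v).1].
apply: Cn_eq (IH _ _ (fd v).2 (gd v).2) => // x Ax.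
by rewrite -deriveD//; [exact: (fd v).1|exact: (gd v).1].
Qed.

Lemma Cn_mul E n (A : set E) (f g : E -> R) : open A ->
  Cn n A f -> Cn n A g -> Cn n A (fun x => f x * g x).
Proof.
move=> oA; elim: n f g => [|n IH] f g [fc fd] [gc gd].
  by split=> // x Ax; apply: cvgM; [exact: fc|exact: gc].
split=> [x Ax|v]; first by apply: cvgM; [exact: fc|exact: gc].
split=> [x Ax|]; first by apply: derivableM; [exact: (fd v).1|exact: (gd v).1].
have fC : Cn n A f by apply: CnS; split.
have gC : Cn n A g by apply: CnS; split.
apply: Cn_eq (Cn_add oA (IH _ _ fC (gd v).2) (IH _ _ gC (fd v).2)) => // x Ax.
by rewrite deriveM//; [exact: (fd v).1|exact: (gd v).1].
Qed.

Lemma Cn_sum E n (A : set E) (I : Type) (r : seq I) (P : pred I) (f : I -> E -> R) : open A ->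
  (forall i, Cn n A (f i)) -> Cn n A (fun x => \sum_(i <- r | P i) f i x).
Proof.
move=> oA fC; elim: r => [|i r IH].
  by apply: Cn_eq (Cn_cst n A (0 : R)) => // x _; rewrite big_nil.
apply: (@Cn_eq _ _ _ _ (fun x => (if P i then f i x else 0) + \sum_(i <- r | P i) f i x)) => //.
  by move=> x Ax; rewrite big_cons; case: ifP => //; rewrite add0r.
by apply: Cn_add => //; case: (P i) => //; exact: Cn_cst.
Qed.

(** A derivative of the composite is a sum of products of a derivative of [g i] with a derivative of
    [f] composed with the same [G]. Hence the induction on [n] runs over all [f] while [G] stays
    fixed. *)
Lemma Cn_comp E F m n (A : set E) (B : set F) (f : F -> R) (b : 'I_m -> F)
    (g : 'I_m -> E -> R) (G : E -> F) :
  open A -> open B ->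
  (forall z z', G z' = G z + \sum_i (g i z' - g i z) *: b i) ->
  (forall x, A x -> B (G x)) ->
  Cn n B f -> (forall i, Cn n A (g i)) -> Cn n A (fun x => f (G x)).
Proof.
move=> oA oB GE AB fC gC.
have Gc x : A x -> {for x, continuous G}.
  move=> Ax; rewrite /prop_for /continuous_at.
  rewrite (_ : G = fun z' => G x + \sum_i (g i z' - g i x) *: b i); last first.
    by apply/funext => z; exact: GE.
  apply: cvgD; first exact: cvg_cst.
  apply: cvg_big => [|i _]; first exact: add_continuous.
  apply: cvgZ; last exact: cvg_cst.
  by apply: cvgB; [exact: (Cn_continuous (gC i) Ax)|exact: cvg_cst].
elim: n f fC gC => [|n IH] f fC gC.
  by split=> // x Ax; apply: continuous_comp; [exact: Gc|exact: (Cn_continuous fC (AB _ Ax))].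
split=> [x Ax|v].
  by apply: continuous_comp; [exact: Gc|exact: (Cn_continuous fC (AB _ Ax))].
have D x : A x -> is_derive x v (f \o G) (\sum_i 'D_v (g i) x * 'D_(b i) f (G x)).
  move=> Ax.
  apply: (@derive_affine_comp E F m f (fun i z => 'D_(b i) f z) b g G x v (fun i => 'D_v (g i) x)) => // i.
  - by apply: derivableP; exact: ((gC i).2 v).1.
  - near=> z; apply: derivableP; apply: (fC.2 (b i)).1; near: z.
    by apply: open_nbhs_nbhs; split=> //; exact: AB.
  - by apply: Cn_continuous (fC.2 (b i)).2 _; exact: AB.
split=> [x Ax|]; first by have [] := D x Ax.
have gCn i : Cn n A (g i) by exact: CnS.
apply: (@Cn_eq _ _ _ _ (fun x => \sum_i 'D_v (g i) x * 'D_(b i) f (G x))) => //.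
  by move=> x Ax; have [_ ->] := D x Ax.
apply: Cn_sum => // i; apply: Cn_mul => //; first exact: ((gC i).2 v).2.
exact: IH (fC.2 (b i)).2 gCn.
Unshelve. all: by end_near. Qed.

End calculus.

(** * Symmetry of second derivatives, vector-valued maps, algebra of smooth functions *)

Section smooth_calculus.
Context {R : realType}.
Implicit Types E F : normedModType R.

Lemma is_derive_shiftr E F (f : E -> F) z v a d :
  is_derive z v (fun y => f (y + a)) d <-> is_derive (z + a) v f d.
Proof.
by split=> /is_derive_epsP H; apply/is_derive_epsP => e /H[r r0 rP];
   exists r => // h /rP; rewrite (addrAC z).
Qed.

(** The mean value theorem twice: in [v] for the function [f (z + h w) - f z] of [z], then in [w]
    for [fv]. *)
Lemma second_difference E (f fv fvw : E -> R) x v w (h : R) :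
  (forall s t : R, `|s| <= `|h| -> `|t| <= `|h| ->
    is_derive (x + s *: v + t *: w) v f (fv (x + s *: v + t *: w)) /\
    is_derive (x + s *: v + t *: w) w fv (fvw (x + s *: v + t *: w))) ->
  exists s t : R, [/\ `|s| <= `|h|, `|t| <= `|h| &
    f (x + h *: v + h *: w) - f (x + h *: v) - f (x + h *: w) + f x
    = h * (h * fvw (x + s *: v + t *: w))].
Proof.
move=> H.
pose p z := f (z + h *: w) - f z.
have n0 : `|0 : R| <= `|h| by rewrite normr0.
have pd (s : R) : `|s| <= `|h| ->
    is_derive (x + s *: v) v p (fv (x + s *: v + h *: w) - fv (x + s *: v)).
  move=> sh; apply: is_deriveB.
    by apply/is_derive_shiftr; exact: (H s h sh _).1.
  by have := (H s 0 sh n0).1; rewrite scale0r addr0.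
have [s sh E1] := @MVT_dir R E p (fun z => fv (z + h *: w) - fv z) x v h pd.
have [t th E2] := @MVT_dir R E fv fvw (x + s *: v) w h (fun t th => (H s t sh th).2).
by exists s, t; split=> //; rewrite -E2 -E1 /p opprB addrA addrAC [X in X + _]addrAC.
Qed.

(** The second difference is computed in the two orders. The derivatives are given as explicit
    functions rather than through [Cn], because the lemma is also applied to the values of a
    functional, whose first derivatives are known as integrals. *)
Lemma derive_commute_near E (A : set E) (f fv fw fvw fwv : E -> R) x v w :
  nbhs x A ->
  (forall z, A z -> is_derive z v f (fv z)) -> (forall z, A z -> is_derive z w f (fw z)) ->
  (forall z, A z -> is_derive z w fv (fvw z)) -> (forall z, A z -> is_derive z v fw (fwv z)) ->
  {for x, continuous fvw} -> {for x, continuous fwv} ->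
  fvw x = fwv x.
Proof.
move=> An fvP fwP fvwP fwvP cvw cwv.
suff H (e : R) : 0 < e -> `|fvw x - fwv x| <= e.
  apply/eqP; rewrite -subr_eq0 -normr_le0; apply/ler_addgt0Pr => e e0.
  by rewrite add0r; exact: H.
move=> e0; have e20 : 0 < e / 2 by rewrite divr_gt0.
have /cvgrPdist_le /(_ _ e20) c1 := cvw.
have /cvgrPdist_le /(_ _ e20) c2 := cwv.
have : nbhs x (A `&` ([set t | `|fvw x - fvw t| <= e / 2] `&`
    [set t | `|fwv x - fwv t| <= e / 2])).
  by apply: filterI; [exact: An|apply: filterI; [exact: c1|exact: c2]].
move=> /nbhs_ballP[r /= r0 rP].
have K0 : 0 < 1 + `|v| + `|w| by rewrite -addrA ltr_wpDr// addr_ge0.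
(* Small enough that all points [x + s v + t w] with [s] and [t] of size at most [h] stay in the
   ball of radius [r]. *)
pose h := r / 2 / (1 + `|v| + `|w|).
have h0 : 0 < h by rewrite !divr_gt0.
have B (s t : R) (a b : E) : `|s| <= `|h| -> `|t| <= `|h| -> `|a| + `|b| <= `|v| + `|w| ->
    ball x r (x + s *: a + t *: b).
  move=> sh th ab; rewrite -ball_normE /ball_/= -addrA opprD addrA subrr sub0r normrN.
  rewrite (le_lt_trans (ler_normD _ _))// !normrZ.
  apply: (@le_lt_trans _ _ (h * (`|a| + `|b|))).
    by rewrite mulrDr lerD// ler_wpM2r// -[h]gtr0_norm.
  apply: (@le_lt_trans _ _ (r / 2)).
    rewrite /h mulrAC ler_pdivrMr// ler_wpM2l//; first by rewrite divr_ge0// ltW.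
    by rewrite (le_trans ab)// -addrA lerDr.
  by rewrite ltr_pdivrMr// ltr_pMr// ltr1n.
have [s1 [t1 [s1h t1h E1]]] : exists s t : R, [/\ `|s| <= `|h|, `|t| <= `|h| &
    f (x + h *: v + h *: w) - f (x + h *: v) - f (x + h *: w) + f x
    = h * (h * fvw (x + s *: v + t *: w))].
  apply: (@second_difference E f fv) => s t sh th.
  have [As _] := rP _ (B s t v w sh th (lexx _)).
  by split; [exact: fvP|exact: fvwP].
have [s2 [t2 [s2h t2h E2]]] : exists s t : R, [/\ `|s| <= `|h|, `|t| <= `|h| &
    f (x + h *: w + h *: v) - f (x + h *: w) - f (x + h *: v) + f x
    = h * (h * fwv (x + s *: w + t *: v))].
  apply: (@second_difference E f fw) => s t sh th.
  have ba : `|w| + `|v| <= `|v| + `|w| by rewrite addrC.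
  have [As _] := rP _ (B s t w v sh th ba).
  by split; [exact: fwP|exact: fwvP].
have E3 : fvw (x + s1 *: v + t1 *: w) = fwv (x + s2 *: w + t2 *: v).
  have hN : h != 0 by rewrite gt_eqF.
  apply: (mulfI hN); apply: (mulfI hN); rewrite -E1 -E2.
  by rewrite [x + h *: v + h *: w]addrAC; ring.
have [_ [/= H1 _]] := rP _ (B s1 t1 v w s1h t1h (lexx _)).
have ba : `|w| + `|v| <= `|v| + `|w| by rewrite addrC.
have [_ [_ /= H2]] := rP _ (B s2 t2 w v s2h t2h ba).
rewrite E3 in H1.
set c := fwv (x + s2 *: w + t2 *: v) in H1 H2.
by rewrite -(subrKA c) (le_trans (ler_normD _ _))// (splitr e) lerD// distrC.
Qed.

Lemma derive_commute E (A : set E) (f : E -> R) x v w : open A -> A x -> Cn 2 A f ->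
  'D_w ('D_v f) x = 'D_v ('D_w f) x.
Proof.
move=> oA Ax fC.
have fd u z : A z -> is_derive z u f ('D_u f z).
  by move=> Az; apply: derivableP; exact: (fC.2 u).1.
have fdd u u' z : A z -> is_derive z u' ('D_u f) ('D_u' ('D_u f) z).
  by move=> Az; apply: derivableP; have [_ ] := (fC.2 u).2 => /(_ u')[+ _]; exact.
have fc u u' : {for x, continuous ('D_u' ('D_u f))}.
  by have [_ /(_ u')[_ [+ _]]] := (fC.2 u).2; exact.
have An : nbhs x A by exact: open_nbhs_nbhs.
exact (derive_commute_near An (fd v) (fd w) (fdd v w) (fdd w v) (fc v w) (fc w v)).
Qed.

Lemma continuous_rV (T : topologicalType) m (f : T -> 'rV[R]_m) x :
  {for x, continuous f} <-> forall j, {for x, continuous (fun t => f t 0 j)}.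
Proof.
split=> [fc j|fc].
  by apply: (@continuous_comp _ _ _ f (fun M : 'rV[R]_m => M 0 j)) => //; exact: coord_continuous.
apply/cvgrPdist_le => e e0; near=> t.
rewrite /Num.Def.normr/= mx_normrE (bigmax_le _ (ltW e0))//= => -[i j] _.
rewrite !mxE/= ord1; move: j; near: t; apply: filter_forall => /= j.
exact: (cvgrPdist_le _ _).1 (fc j) _ e0.
Unshelve. all: by end_near. Qed.

Lemma is_derive_rV E m (f : E -> 'rV[R]_m) x v d :
  is_derive x v f d <-> forall j, is_derive x v (fun t => f t 0 j) (d 0 j).
Proof.
split=> [[df <-] j|H].
  rewrite derive_mx// mxE; apply: derivableP; exact: (derivable_mxP _ _ _).1.
have df : derivable f x v.
  by apply/derivable_mxP => i j; rewrite ord1; exact: ex_derive.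
split=> //; rewrite derive_mx//; apply/rowP => j; rewrite mxE.
by have [_ ->] := H j.
Qed.

Lemma Cn_rV E m n (A : set E) (f : E -> 'rV[R]_m) : open A ->
  Cn n A f <-> forall j, Cn n A (fun x => f x 0 j).
Proof.
move=> oA; elim: n f => [|n IH] f.
  split=> [[fc _] j|fc]; split=> // x Ax; first by apply: (continuous_rV f x).1; exact: fc.
  by apply: (continuous_rV f x).2 => j; exact: Cn_continuous (fc j) Ax.
split=> [[fc fd] j|fC].
  split=> [x Ax|v]; first by apply: (continuous_rV f x).1; exact: fc.
  split=> [x Ax|]; first by apply: (derivable_mxP _ _ _).1 => //; exact: (fd v).1.
  have := (IH _).1 (fd v).2 j; apply: Cn_eq => // x Ax.
  by rewrite derive_mx ?mxE//; exact: (fd v).1.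
have fd x v : A x -> derivable f x v.
  by move=> Ax; apply/derivable_mxP => i j; rewrite ord1; exact: ((fC j).2 v).1.
split=> [x Ax|v]; first by apply: (continuous_rV f x).2 => j; exact: Cn_continuous (fC j) Ax.
split=> [x Ax|]; first exact: fd.
apply/IH => j; have := ((fC j).2 v).2; apply: Cn_eq => // x Ax.
by rewrite derive_mx ?mxE//; exact: fd.
Qed.

Lemma smooth_rV E m (A : set E) (f : E -> 'rV[R]_m) : open A ->
  smooth A f <-> forall j, smooth A (fun x => f x 0 j).
Proof.
move=> oA; split=> [fC j n|fC n]; first exact: (Cn_rV n _ oA).1.
by apply/Cn_rV => // j; exact: fC.
Qed.

Lemma smooth_eq E F (A : set E) (f g : E -> F) : open A ->
  (forall x, A x -> f x = g x) -> smooth A f -> smooth A g.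
Proof. by move=> oA fg fC n; exact: Cn_eq (fC n). Qed.

Lemma smooth_subset E F (A B : set E) (f : E -> F) : A `<=` B -> smooth B f -> smooth A f.
Proof. by move=> AB fC n; exact: Cn_subset (fC n). Qed.

Lemma smooth_cst E F (A : set E) (k : F) : smooth A (fun=> k).
Proof. by move=> n; exact: Cn_cst. Qed.

Lemma smoothD E (A : set E) (f g : E -> R) : open A ->
  smooth A f -> smooth A g -> smooth A (fun x => f x + g x).
Proof. by move=> oA fC gC n; exact: Cn_add. Qed.

Lemma smoothM E (A : set E) (f g : E -> R) : open A ->
  smooth A f -> smooth A g -> smooth A (fun x => f x * g x).
Proof. by move=> oA fC gC n; exact: Cn_mul. Qed.

Lemma smoothN E (A : set E) (f : E -> R) : open A -> smooth A f -> smooth A (fun x => - f x).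
Proof.
move=> oA fC; apply: smooth_eq (smoothM oA (smooth_cst A (-1 : R)) fC) => // x _.
by rewrite mulN1r.
Qed.

Lemma smoothB E (A : set E) (f g : E -> R) : open A ->
  smooth A f -> smooth A g -> smooth A (fun x => f x - g x).
Proof. by move=> oA fC gC; apply: smoothD => //; exact: smoothN. Qed.

Lemma smooth_sum E (A : set E) (I : Type) (r : seq I) (P : pred I) (f : I -> E -> R) :
  open A -> (forall i, smooth A (f i)) -> smooth A (fun x => \sum_(i <- r | P i) f i x).
Proof. by move=> oA fC n; apply: Cn_sum => // i; exact: fC. Qed.

Lemma smooth_comp E F m (A : set E) (B : set F) (f : F -> R) (b : 'I_m -> F)
    (g : 'I_m -> E -> R) (G : E -> F) :
  open A -> open B ->
  (forall z z', G z' = G z + \sum_i (g i z' - g i z) *: b i) ->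
  (forall x, A x -> B (G x)) ->
  smooth B f -> (forall i, smooth A (g i)) -> smooth A (fun x => f (G x)).
Proof. by move=> oA oB GE AB fC gC n; apply: (Cn_comp oA oB GE AB) => // i; exact: gC. Qed.

Lemma smooth_derivable E F (A : set E) (f : E -> F) x v :
  smooth A f -> A x -> is_derive x v f ('D_v f x).
Proof. by move=> fC Ax; apply: derivableP; exact: ((fC 1%N).2 v).1. Qed.

Lemma smooth_continuous E F (A : set E) (f : E -> F) x :
  smooth A f -> A x -> {for x, continuous f}.
Proof. by move=> fC; exact: Cn_continuous (fC 0%N). Qed.

Lemma smooth_derive E F (A : set E) (f : E -> F) v : smooth A f -> smooth A ('D_v f).
Proof. by move=> fC n; exact: ((fC n.+1).2 v).2. Qed.

Lemma smooth_derive_comp E F m (A : set E) (B : set F) (f : F -> R) (b : 'I_m -> F)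
    (g : 'I_m -> E -> R) (G : E -> F) x v :
  open B ->
  (forall z z', G z' = G z + \sum_i (g i z' - g i z) *: b i) ->
  B (G x) -> smooth B f -> A x -> (forall i, smooth A (g i)) ->
  is_derive x v (fun x => f (G x)) (\sum_i 'D_v (g i) x * 'D_(b i) f (G x)).
Proof.
move=> oB GE BG fC Ax gC.
apply: (@derive_affine_comp R E F m f (fun i z => 'D_(b i) f z) b g G x v
  (fun i => 'D_v (g i) x)) => // i.
- exact: smooth_derivable (gC i) Ax.
- near=> z; apply: smooth_derivable fC _; near: z.
  by apply: open_nbhs_nbhs; split.
- exact: smooth_continuous (smooth_derive (b i) fC) BG.
Unshelve. all: by end_near. Qed.

Lemma smooth_derive_lincomb E n (A : set E) (f : E -> R) (b : 'I_n -> E) y (c : 'I_n -> R) :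
  open A -> smooth A f -> A y ->
  is_derive y (\sum_i c i *: b i) f (\sum_i c i * 'D_(b i) f y).
Proof.
move=> oA fC Ay; apply: (@is_derive_lincomb _ _ _ f (fun i z => 'D_(b i) f z)) => i.
  near=> z; apply: smooth_derivable fC _; near: z.
  by apply: open_nbhs_nbhs; split.
exact: smooth_continuous (smooth_derive (b i) fC) Ay.
Unshelve. all: by end_near. Qed.

Lemma smooth_derive_commute E (A : set E) (f : E -> R) x v w :
  open A -> smooth A f -> A x -> 'D_w ('D_v f) x = 'D_v ('D_w f) x.
Proof. by move=> oA fC Ax; apply: derive_commute (fC 2) => //; exact: oA. Qed.

Lemma smooth_linear E (A : set E) (f : E -> R) :
  continuous f -> (forall x v (h : R), f (x + h *: v) = f x + h * f v) -> smooth A f.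
Proof.
move=> fc fl [|n]; first by split=> // x _; exact: fc.
have fd x v : is_derive x v f (f v).
  apply/is_derive_epsP => e e0; exists 1 => // h _.
  by rewrite fl [f x + _]addrC addrK [h *: _]/(h * _) subrr normr0 mulr_ge0// ltW.
split=> [x _|v]; first exact: fc.
split=> [x _|]; first by have [] := fd x v.
rewrite [X in Cn _ _ X](_ : _ = fun=> f v); first exact: Cn_cst.
by apply/funext => x; have [] := fd x v.
Qed.

Lemma smooth_coord m (A : set 'rV[R]_m) i : smooth A (fun x : 'rV[R]_m => x 0 i).
Proof.
apply: smooth_linear => [x|x v h]; first exact: coord_continuous.
by rewrite !mxE.
Qed.

End smooth_calculus.

(** * Integrals of compactly supported functions *)

Section compact_integrals.
Context {R : realType}.
Implicit Types f g F G : R -> R.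
Notation mu := (@lebesgue_measure R).

Lemma is_derive_mul (E : normedModType R) (f g : E -> R) x v (df dg : R) :
  is_derive x v f df -> is_derive x v g dg ->
  is_derive x v (fun y => f y * g y) (df * g x + f x * dg).
Proof.
move=> fd gd; have := is_deriveM fd gd.
by rewrite addrC [g x *: df]mulrC.
Qed.

Definition compactly_supported f :=
  continuous f /\ exists A : R, forall x, A <= `|x| -> f x = 0.

Definition primitive f (x : R) := \int[lebesgue_measure]_(y in `]-oo, x]) f y.

Lemma compactly_supported_integrable f (D : set R) : measurable D ->
  compactly_supported f -> mu.-integrable D (EFin \o f).
Proof.
move=> mD [fc [A fA]].
apply: (@integrableS _ _ _ _ setT) => //.
have -> : f = f \_ `[- A, A].
  apply/funext => x; rewrite patchE; case: ifPn => //; rewrite notin_setE/= in_itv/= => H.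
  by apply: fA; rewrite leNgt; apply/negP => xA; apply: H; rewrite -ler_norml ltW.
rewrite -restrict_EFin; apply/integrable_restrict => //=; rewrite setTI.
apply: continuous_compact_integrable; first exact: segment_compact.
exact: continuous_subspaceT.
Qed.

Lemma is_derive_primitive f x : compactly_supported f -> is_derive (x : R) (1 : R) (primitive f) (f x).
Proof.
move=> cf; have [fc _] := cf.
have x1 : x < x + 1 by rewrite ltrDl.
have I : mu.-integrable [set` Interval -oo%O (BRight (x + 1))] (EFin \o f).
  by apply: compactly_supported_integrable => //; exact: measurable_itv.
have [|df] := continuous_FTC1 x1 I _ (fc x); first by rewrite ltNyr.
by rewrite derive1E => dE; split.
Qed.

Lemma primitive_left f (A x : R) : (forall x, A <= `|x| -> f x = 0) -> x <= - A ->
  primitive f x = 0.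
Proof.
move=> fA xA; rewrite /primitive (@eq_Rintegral _ _ _ _ _ (fun=> 0)).
  by rewrite Rintegral_cst ?mul0r.
move=> y; rewrite inE/= in_itv/= => yx; apply: fA.
by rewrite -normrN (le_trans _ (ler_norm _))// lerNr (le_trans yx).
Qed.

Lemma primitive_complement f x : compactly_supported f ->
  \int[lebesgue_measure]_(y in `[x, +oo[) f y = integral f - primitive f x.
Proof.
move=> cf; rewrite -Rintegral_itv_obnd_cbnd; last exact: compactly_supported_integrable.
rewrite -(@Rintegral_itvB _ f -oo%O +oo%O x)//; first by rewrite set_itvNyy.
exact: compactly_supported_integrable.
Qed.

Lemma primitive_right f (A x : R) : compactly_supported f ->
  (forall x, A <= `|x| -> f x = 0) -> A <= x -> primitive f x = integral f.
Proof.
move=> cf fA xA; apply/eqP; rewrite eq_sym -subr_eq0 -primitive_complement//; apply/eqP.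
rewrite (@eq_Rintegral _ _ _ _ _ (fun=> 0)); first by rewrite Rintegral_cst ?mul0r.
move=> y; rewrite inE/= in_itv/= andbT => yx; apply: fA.
by rewrite (le_trans xA)// (le_trans yx)// ler_norm.
Qed.

Lemma dinvE f x : compactly_supported f -> dinv f x = primitive f x - integral f / 2.
Proof.
move=> cf; rewrite /dinv -/(primitive f x) primitive_complement//; lra.
Qed.

Lemma eq_derive_cst F (x y : R) : (forall x, is_derive (x : R) (1 : R) F (0 : R)) -> F x = F y.
Proof.
move=> dF.
have [t _] := @MVT_dir R R F (fun=> 0) x 1 (y - x) (fun t _ => dF _).
rewrite mulr0 [(y - x) *: 1]mulr1 [x + _]addrC subrK => /eqP.
by rewrite subr_eq0 => /eqP.
Qed.

Lemma primitive_unique f F (A a x : R) : compactly_supported f ->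
  (forall x, A <= `|x| -> f x = 0) -> (forall x, is_derive (x : R) (1 : R) F (f x)) ->
  (forall x, x <= - A -> F x = a) -> primitive f x = F x - a.
Proof.
move=> cf fA dF Fa.
have H y : is_derive (y : R) (1 : R) (fun z => primitive f z - F z) (0 : R).
  rewrite -(subrr (f y)); apply: is_deriveB; exact: is_derive_primitive.
have := @eq_derive_cst (fun z => primitive f z - F z) x (- A) H.
rewrite (primitive_left fA (lexx _)) (Fa _ (lexx _)) => ?; lra.
Qed.

Lemma integral_FTC f F (A a b : R) : compactly_supported f ->
  (forall x, A <= `|x| -> f x = 0) -> (forall x, is_derive (x : R) (1 : R) F (f x)) ->
  (forall x, x <= - A -> F x = a) -> (forall x, A <= x -> F x = b) -> integral f = b - a.
Proof.
move=> cf fA dF Fa Fb.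
by rewrite -(primitive_right cf fA (lexx A)) (primitive_unique _ cf fA dF Fa) Fb.
Qed.

Lemma near_dist (E : normedModType R) (x : E) (r : R) : 0 < r -> \forall y \near x, `|y - x| < r.
Proof.
by move=> r0; apply/nbhs_ballP; exists r => // y; rewrite -ball_normE /ball_/= distrC.
Qed.

Lemma compactly_supported_derive F (f : R -> R) :
  (forall x, is_derive (x : R) (1 : R) F (f x)) -> continuous f ->
  (exists A : R, forall x y : R, A <= `|x| -> A <= `|y| -> F x = F y) ->
  compactly_supported f.
Proof.
(* The margin 1 leaves a whole neighbourhood of [x] on which [F] is constant. *)
move=> dF fc [A FA]; split=> //; exists (A + 1) => x xA.
have -> : f x = 'D_1 F x by have [_ ->] := dF x.
rewrite -[RHS](derive_cst (F x) x 1); apply: near_eq_derive.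
near=> y; apply: FA; last by rewrite (le_trans _ xA)// lerDl.
have H1 : `|y - x| < 1 by near: y; apply: (@near_dist R x 1).
have := lerB_dist x y; rewrite distrC => H2; lra.
Unshelve. all: by end_near. Qed.

Lemma ler_norm_left (C x : R) : x <= - C -> C <= `|x|.
Proof. by move=> xC; rewrite -normrN (le_trans _ (ler_norm _))// lerNr. Qed.

Lemma ler_norm_right (C x : R) : C <= x -> C <= `|x|.
Proof. by move=> xC; rewrite (le_trans _ (ler_norm _)). Qed.

Lemma support_enlarge f (A : R) : compactly_supported f ->
  exists C : R, [/\ 0 <= C, A <= C & forall x, C <= `|x| -> f x = 0].
Proof.
move=> [_ [B fB]]; exists (Num.max (Num.max A B) 0).
split; rewrite ?le_max ?lexx ?orbT// => x.
by rewrite !ge_max => /andP[/andP[_ /fB]].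
Qed.

Lemma integral_derive0 F (f : R -> R) :
  (forall x, is_derive (x : R) (1 : R) F (f x)) -> continuous f ->
  (exists A : R, forall x y : R, A <= `|x| -> A <= `|y| -> F x = F y) ->
  integral f = 0.
Proof.
move=> dF fc FA0; have cf := compactly_supported_derive dF fc FA0.
have [A FA] := FA0; have [C [C0 AC fC]] := support_enlarge A cf.
have CC : A <= `|C| by rewrite ger0_norm.
rewrite (@integral_FTC f F C (F C) (F C) cf fC dF) ?subrr// => x xC; apply: FA => //.
  exact: le_trans AC (ler_norm_left xC).
exact: le_trans AC (ler_norm_right xC).
Qed.

(** Equal end values make the total integral zero, so the symmetric normalisation of [dinv]
    contributes no constant of its own and the result is the primitive that vanishes near
    infinity. *)
Lemma dinv_derive F (f : R -> R) (A c : R) x :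
  (forall x, is_derive (x : R) (1 : R) F (f x)) -> continuous f ->
  (forall x, A <= `|x| -> F x = c) ->
  dinv f x = F x - c.
Proof.
move=> dF fc Fc.
have FA0 : exists A : R, forall x y : R, A <= `|x| -> A <= `|y| -> F x = F y.
  by exists A => y z yA zA; rewrite !Fc.
have cf := compactly_supported_derive dF fc FA0.
have [C [C0 AC fC]] := support_enlarge A cf.
rewrite dinvE// (integral_derive0 dF)// mul0r subr0.
apply: (primitive_unique _ cf fC dF) => y yC; apply: Fc.
exact: le_trans AC (ler_norm_left yC).
Qed.

Lemma eq_integral f g : (forall x, f x = g x) -> integral f = integral g.
Proof. by move=> fg; congr integral; exact/funext. Qed.

Lemma eq_dinv f g x : (forall x, f x = g x) -> dinv f x = dinv g x.
Proof. by move=> fg; congr (dinv _ x); exact/funext. Qed.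

Lemma compactly_supportedD f g : compactly_supported f -> compactly_supported g ->
  compactly_supported (fun x => f x + g x).
Proof.
move=> [fc [A fA]] [gc [B gB]]; split; first by move=> x; apply: cvgD; [exact: fc|exact: gc].
exists (Num.max A B) => x; rewrite ge_max => /andP[Ax Bx].
by rewrite fA// gB// addr0.
Qed.

Lemma compactly_supportedMl f g : continuous f -> compactly_supported g ->
  compactly_supported (fun x => f x * g x).
Proof.
move=> fc [gc [B gB]]; split; first by move=> x; apply: cvgM; [exact: fc|exact: gc].
by exists B => x Bx; rewrite gB// mulr0.
Qed.

Lemma compactly_supportedMr f g : compactly_supported f -> continuous g ->
  compactly_supported (fun x => f x * g x).
Proof.
move=> fc gc; rewrite (_ : (fun x => _) = fun x => g x * f x).
  exact: compactly_supportedMl.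
by apply/funext => x; rewrite mulrC.
Qed.

Lemma compactly_supported0 : compactly_supported (fun=> 0).
Proof. by split; [exact: cst_continuous|exists 0]. Qed.

Lemma compactly_supportedZ (a : R) f : compactly_supported f ->
  compactly_supported (fun x => a * f x).
Proof. by move=> cf; apply: compactly_supportedMl => //; exact: cst_continuous. Qed.

Lemma compactly_supported_sum (I : Type) (r : seq I) (P : pred I) (h : I -> R -> R) :
  (forall i, compactly_supported (h i)) ->
  compactly_supported (fun x => \sum_(i <- r | P i) h i x).
Proof.
move=> ch; elim: r => [|i r IH].
  rewrite (_ : (fun x => _) = fun=> 0); first exact: compactly_supported0.
  by apply/funext => x; rewrite big_nil.
rewrite (_ : (fun x => _) = fun x => (if P i then 1 else 0) * h i x + \sum_(i <- r | P i) h i x).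
  by apply: compactly_supportedD => //; exact: compactly_supportedZ.
by apply/funext => x; rewrite big_cons; case: ifP; rewrite ?mul1r// mul0r add0r.
Qed.

Lemma integralD f g : compactly_supported f -> compactly_supported g ->
  integral (fun x => f x + g x) = integral f + integral g.
Proof. by move=> cf cg; apply: RintegralD => //; exact: compactly_supported_integrable. Qed.

Lemma integralZ (a : R) f : compactly_supported f ->
  integral (fun x => a * f x) = a * integral f.
Proof. by move=> cf; apply: RintegralZl => //; exact: compactly_supported_integrable. Qed.

Lemma integralN f : compactly_supported f -> integral (fun x => - f x) = - integral f.
Proof.
move=> cf; rewrite -mulN1r -integralZ//; apply: eq_integral => x.
by rewrite mulN1r.
Qed.

Lemma integralB f g : compactly_supported f -> compactly_supported g ->
  integral (fun x => f x - g x) = integral f - integral g.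
Proof. by move=> cf cg; apply: RintegralB => //; exact: compactly_supported_integrable. Qed.

Lemma dinvD f g x : compactly_supported f -> compactly_supported g ->
  dinv (fun x => f x + g x) x = dinv f x + dinv g x.
Proof.
move=> cf cg; rewrite !dinvE//; last exact: compactly_supportedD.
rewrite integralD// /primitive RintegralD//; try exact: compactly_supported_integrable.
lra.
Qed.

Lemma dinvZ (a : R) f x : compactly_supported f -> dinv (fun x => a * f x) x = a * dinv f x.
Proof.
move=> cf; rewrite !dinvE//; last exact: compactly_supportedZ.
rewrite integralZ// /primitive RintegralZl//; last exact: compactly_supported_integrable.
lra.
Qed.

Lemma dinv0 x : dinv (fun=> 0 : R) x = 0.
Proof.
transitivity (dinv (fun y : R => 0 * (fun=> 0) y) x).
  by apply: eq_dinv => y; rewrite mul0r.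
by rewrite dinvZ ?mul0r//; exact: compactly_supported0.
Qed.

Lemma dinv_sum (I : Type) (r : seq I) (P : pred I) (h : I -> R -> R) x :
  (forall i, compactly_supported (h i)) ->
  dinv (fun x => \sum_(i <- r | P i) h i x) x = \sum_(i <- r | P i) dinv (h i) x.
Proof.
move=> ch; elim: r => [|i r IH].
  rewrite big_nil -[RHS](dinv0 x); apply: eq_dinv => y.
  by rewrite big_nil.
rewrite big_cons; case: ifPn => Pi.
  rewrite -IH -dinvD//; last exact: compactly_supported_sum.
  by apply: eq_dinv => y; rewrite big_cons Pi.
by rewrite -IH; apply: eq_dinv => y; rewrite big_cons (negPf Pi).
Qed.

Lemma is_derive_dinv f x : compactly_supported f -> is_derive (x : R) (1 : R) (dinv f) (f x).
Proof.
move=> cf.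
rewrite (_ : dinv f = fun x => primitive f x - integral f / 2); last first.
  by apply/funext => y; rewrite dinvE.
rewrite -[f x]subr0; apply: is_deriveB; first exact: is_derive_primitive.
Qed.

(** To the right of the support the primitive is constant, so the length of the support suffices and
    the bound is uniform in [x]. *)
Lemma primitive_bound f (A M x : R) : 0 <= A -> compactly_supported f ->
  (forall x, A <= `|x| -> f x = 0) -> (forall x, `|f x| <= M) ->
  `|primitive f x| <= M * (2 * A).
Proof.
move=> A0 cf fA fM.
have M0 : 0 <= M by rewrite (le_trans _ (fM 0)).
have key y : `|y| <= A -> `|primitive f y| <= M * (2 * A).
  move=> yA.
  have [t _] := @MVT_dir R R (primitive f) f (- A) 1 (y + A) (fun t _ => is_derive_primitive _ cf).
  rewrite (primitive_left fA (lexx _)) subr0 [(y + A) *: 1]mulr1 addrCA addNr addr0 => ->.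
  rewrite normrM mulrC ler_pM// (le_trans (ler_normD _ _))// (ger0_norm A0); lra.
have [xA|/ltW xA] := leP x (- A).
  by rewrite (primitive_left fA)// normr0 mulr_ge0// mulr_ge0.
have [Ax|/ltW Ax] := leP A x; last by apply: key; rewrite ler_norml xA.
by rewrite (primitive_right _ fA)// -(primitive_right cf fA (lexx A)) key// ger0_norm.
Qed.

End compact_integrals.

(** * Integrals depending on parameters *)

Section parametric_integrals.
Context {R : realType}.
Implicit Types E F : normedModType R.

Lemma nearP E (s : E) (P : E -> Prop) :
  (\forall t \near s, P t) <-> exists2 r : R, 0 < r & forall t, `|t - s| < r -> P t.
Proof.
split=> [/nbhs_ballP[r /= r0 rP]|[r r0 rP]].
  by exists r => // t ts; apply: rP; rewrite -ball_normE /ball_/= distrC.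
by near=> t; apply: rP; near: t; exact: near_dist.
Unshelve. all: by end_near. Qed.

Lemma continuous_slabP E (h : E -> R -> R) s x (e : R) : 0 < e ->
  {for (s, x), continuous (fun p : E * R => h p.1 p.2)} ->
  exists2 r : R, 0 < r & forall t y, `|t - s| < r -> `|y - x| < r -> `|h t y - h s x| <= e.
Proof.
move=> e0 /cvgrPdist_le /(_ _ e0) [[U V] /= [Us Vx] UV].
have /nearP[r1 r10 r1P] := Us; have /nearP[r2 r20 r2P] := Vx.
exists (Num.min r1 r2) => [|t y]; first by rewrite lt_min r10.
rewrite !lt_min => /andP[t1 _] /andP[_ y2]; rewrite distrC.
by apply: (UV (t, y)); split; [exact: r1P|exact: r2P].
Qed.

Lemma slab_continuousP E (h : E -> R -> R) s x :
  (forall e : R, 0 < e -> exists2 r : R, 0 < r &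
    forall t y, `|t - s| < r -> `|y - x| < r -> `|h t y - h s x| <= e) ->
  {for (s, x), continuous (fun p : E * R => h p.1 p.2)}.
Proof.
move=> H; apply/cvgrPdist_le => e /H[r r0 rP].
exists ([set t | `|t - s| < r], [set y | `|y - x| < r]) => /=.
  by split; [exact: near_dist|exact: (@near_dist R R)].
by move=> [t y] /= [ts yx]; rewrite distrC; exact: rP.
Qed.

(** Compactness of [[-A, A]] makes joint continuity uniform in [x]. This is what later justifies
    differentiation under the integral sign. *)
Lemma tube E (h : E -> R -> R) s (A e : R) : 0 < e ->
  (forall x, `|x| <= A -> {for (s, x), continuous (fun p : E * R => h p.1 p.2)}) ->
  exists2 r : R, 0 < r &
    forall t, `|t - s| < r -> forall x, `|x| <= A -> `|h t x - h s x| <= e.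
Proof.
move=> e0 hc; apply/nearP.
have K : compact `[- A, A] by exact: segment_compact.
have /compact_near_coveringP /(_ E (nbhs s) (fun t x => `|h t x - h s x| <= e) _) H := K.
have {}H : \forall t \near s, `[- A, A] `<=` (fun x => `|h t x - h s x| <= e).
  apply: H => x; rewrite /= in_itv/= -ler_norml => xA.
  have e20 : 0 < e / 2 by rewrite divr_gt0.
  have [r r0 rP] := continuous_slabP e20 (hc x xA).
  exists ([set y | `|y - x| < r], [set t | `|t - s| < r]) => /=.
    by split; [exact: (@near_dist R R)|exact: near_dist].
  move=> [y t] /= [yx ts].
  have H1 := rP _ _ ts yx.
  have H2 : `|h s y - h s x| <= e / 2 by apply: rP => //; rewrite subrr normr0.
  rewrite -(subrKA (h s x)) (le_trans (ler_normD _ _))// (splitr e) lerD//.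
  by rewrite distrC.
near=> t => x xA.
have : `[- A, A] `<=` (fun x => `|h t x - h s x| <= e) by near: t.
by apply; rewrite /= in_itv/= -ler_norml.
Unshelve. all: by end_near. Qed.

Definition slab_smooth E F (O : set E) (g : E -> R -> F) :=
  smooth (O `*` [set: R]) (fun p : E * R => g p.1 p.2).

(** One bound serves all parameters near [s]: the integrals of neighbouring members are compared
    over a common interval. *)
Definition locally_supported E F (O : set E) (g : E -> R -> F) :=
  forall s, O s -> exists A : R, \forall t \near s, forall x, A <= `|x| -> g t x = 0.

Lemma open_slab E (O : set E) : open O -> open (O `*` [set: R]).
Proof.
rewrite !openE => oO [s x] [/= Os _]; exists (O, setT) => //=; split.
  exact: oO.
exact: filterT.
Qed.

Lemma is_derive_slab1 E F (g : E -> R -> F) s x v d :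
  is_derive (s, x) (v, 0 : R) (fun p : E * R => g p.1 p.2) d <->
  is_derive s v (fun t => g t x) d.
Proof.
by split=> /is_derive_epsP H; apply/is_derive_epsP => e /H[r r0 rP];
   exists r => // h /rP /=; rewrite scaler0 addr0.
Qed.

Lemma is_derive_slab2 E F (g : E -> R -> F) s x d :
  is_derive (s, x) (0, 1 : R) (fun p : E * R => g p.1 p.2) d <->
  is_derive x (1 : R) (g s) d.
Proof.
by split=> /is_derive_epsP H; apply/is_derive_epsP => e /H[r r0 rP];
   exists r => // h /rP /=; rewrite scaler0 addr0.
Qed.

Section slab.
Variables (E : normedModType R) (O : set E).
Hypothesis oO : open O.
Let oOT := open_slab oO.
Implicit Types g : E -> R -> R.

Lemma slab_derive1 F (g : E -> R -> F) s x v : slab_smooth O g -> O s ->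
  is_derive s v (fun t => g t x) ('D_v (fun t => g t x) s).
Proof.
move=> gC Os; have := @smooth_derivable _ _ _ _ _ (s, x) (v, 0) gC (conj Os I).
by move=> /is_derive_slab1[H _]; exact: derivableP.
Qed.

Lemma slab_derive2 F (g : E -> R -> F) s x : slab_smooth O g -> O s ->
  is_derive x (1 : R) (g s) (derive1 (g s) x).
Proof.
move=> gC Os; have := @smooth_derivable _ _ _ _ _ (s, x) (0, 1) gC (conj Os I).
by move=> /is_derive_slab2[H _]; rewrite derive1E; exact: derivableP.
Qed.

Lemma slab_derive1E F (g : E -> R -> F) s x v : slab_smooth O g -> O s ->
  'D_(v, 0 : R) (fun p : E * R => g p.1 p.2) (s, x) = 'D_v (fun t => g t x) s.
Proof. by move=> gC Os; have [_] := (is_derive_slab1 _ _ _ _ _).2 (slab_derive1 x v gC Os). Qed.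

Lemma slab_derive2E F (g : E -> R -> F) s x : slab_smooth O g -> O s ->
  'D_(0 : E, 1 : R) (fun p : E * R => g p.1 p.2) (s, x) = derive1 (g s) x.
Proof. by move=> gC Os; have [_] := (is_derive_slab2 _ _ _ _).2 (slab_derive2 x gC Os). Qed.

Lemma slab_smooth_eq F (g h : E -> R -> F) : (forall s x, O s -> g s x = h s x) ->
  slab_smooth O g -> slab_smooth O h.
Proof. by move=> gh; apply: smooth_eq => // -[s x] [/= Os _]; exact: gh. Qed.

Lemma slab_smooth_derive1 F (g : E -> R -> F) v : slab_smooth O g ->
  slab_smooth O (fun s x => 'D_v (fun t => g t x) s).
Proof.
move=> gC; apply: smooth_eq (smooth_derive (v, 0) gC) => // -[s x] [/= Os _].
exact: slab_derive1E.
Qed.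

Lemma slab_smooth_derive2 F (g : E -> R -> F) : slab_smooth O g ->
  slab_smooth O (fun s x => derive1 (g s) x).
Proof.
move=> gC; apply: smooth_eq (smooth_derive (0 : E, 1 : R) gC) => // -[s x] [/= Os _].
exact: slab_derive2E.
Qed.

(** Symmetry of second derivatives on the product space, in the directions [(0, 1)] and [(v, 0)]. *)
Lemma slab_derive_commute g s x v : slab_smooth O g -> O s ->
  'D_v (fun t => derive1 (g t) x) s = derive1 (fun y => 'D_v (fun t => g t y) s) x.
Proof.
move=> gC Os.
rewrite -(slab_derive1E x v (slab_smooth_derive2 gC) Os).
rewrite -(slab_derive2E x (slab_smooth_derive1 v gC) Os).
have p1 p : (O `*` setT) p ->
    'D_(0 : E, 1 : R) (fun p : E * R => g p.1 p.2) p = derive1 (g p.1) p.2.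
  by move: p => [t y] [/= Ot _]; exact: slab_derive2E.
have p2 p : (O `*` setT) p ->
    'D_(v, 0 : R) (fun p : E * R => g p.1 p.2) p = 'D_v (fun t => g t p.2) p.1.
  by move: p => [t y] [/= Ot _]; exact: slab_derive1E.
have n : nbhs (s, x) (O `*` setT) by apply: open_nbhs_nbhs.
rewrite -(near_eq_derive _ (filterS p1 n)) -(near_eq_derive _ (filterS p2 n)).
exact (@smooth_derive_commute R (E * R)%type (O `*` setT) (fun p => g p.1 p.2) (s, x)
  (0, 1) (v, 0) oOT gC (conj Os I)).
Qed.

Lemma slab_smooth_x g s : slab_smooth O g -> O s -> smooth setT (g s).
Proof.
move=> gC Os.
apply: (@smooth_comp R R (E * R)%type 1 setT (O `*` setT) (fun p => g p.1 p.2)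
  (fun=> (0, 1)) (fun _ x => x) (fun x => (s, x))) => //.
- exact: openT.
- move=> z z'; rewrite big_ord1; congr (_, _) => /=; first by rewrite scaler0 addr0.
  by rewrite [_ *: _]mulr1 addrC subrK.
- by move=> _; apply: smooth_linear => // x; exact: cvg_id.
Qed.

Lemma slab_continuous g s x : slab_smooth O g -> O s -> {for x, continuous (g s)}.
Proof. by move=> gC Os; exact: smooth_continuous (slab_smooth_x gC Os) I. Qed.

Lemma slab_smoothD g h : slab_smooth O g -> slab_smooth O h ->
  slab_smooth O (fun s x => g s x + h s x).
Proof. exact: smoothD. Qed.

Lemma slab_smoothB g h : slab_smooth O g -> slab_smooth O h ->
  slab_smooth O (fun s x => g s x - h s x).
Proof. exact: smoothB. Qed.

Lemma slab_smoothM g h : slab_smooth O g -> slab_smooth O h ->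
  slab_smooth O (fun s x => g s x * h s x).
Proof. exact: smoothM. Qed.

Lemma slab_smooth_sum (I : Type) (r : seq I) (P : pred I) (g : I -> E -> R -> R) :
  (forall i, slab_smooth O (g i)) -> slab_smooth O (fun s x => \sum_(i <- r | P i) g i s x).
Proof. by move=> gC; apply: smooth_sum. Qed.

Lemma slab_smooth_cst (k : R) : slab_smooth O (fun _ _ => k).
Proof. exact: smooth_cst. Qed.

Lemma locally_supportedMl g h : locally_supported O h ->
  locally_supported O (fun s x => g s x * h s x).
Proof.
move=> hS s /hS[A HA]; exists A; near=> t => x xA; rewrite (near HA t)//; first by rewrite mulr0.
Unshelve. all: by end_near. Qed.

Lemma locally_supportedD g h : locally_supported O g -> locally_supported O h ->
  locally_supported O (fun s x => g s x + h s x).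
Proof.
move=> gS hS s Os; have [A HA] := gS s Os; have [B HB] := hS s Os.
exists (Num.max A B); near=> t => x; rewrite ge_max => /andP[xA xB].
rewrite (near HA t)//; first by rewrite (near HB t)// addr0.
Unshelve. all: by end_near. Qed.

Lemma locally_supported_sum (I : Type) (r : seq I) (P : pred I) (g : I -> E -> R -> R) :
  (forall i, locally_supported O (g i)) ->
  locally_supported O (fun s x => \sum_(i <- r | P i) g i s x).
Proof.
move=> gS; elim: r => [|i r IH] s Os.
  by exists 0; near=> t => x _; rewrite big_nil.
have [A HA] := locally_supportedD (gS i) IH Os; have [B HB] := IH s Os.
exists (Num.max A B); near=> t => x; rewrite ge_max => /andP[xA xB].
rewrite big_cons; case: ifP => _; first by rewrite (near HA t).
by rewrite (near HB t).
Unshelve. all: by end_near. Qed.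

Lemma locally_supported_derive1 F (g : E -> R -> F) v : locally_supported O g ->
  locally_supported O (fun s x => 'D_v (fun t => g t x) s).
Proof.
move=> gS s /gS[A /near_join HA]; exists A; near=> t => x xA.
rewrite -[RHS](derive_cst (0 : F) t v); apply: near_eq_derive.
have : \forall t' \near t, forall x, A <= `|x| -> g t' x = 0 by near: t.
by apply: filterS => t'; exact.
Unshelve. all: by end_near. Qed.

Lemma slab_compactly_supported g s : slab_smooth O g -> locally_supported O g -> O s ->
  compactly_supported (g s).
Proof.
move=> gC gS Os; split; first by move=> x; exact: slab_continuous.
by have [A /nbhs_singleton HA] := gS s Os; exists A.
Qed.

Lemma slab_continuous2 F (g : E -> R -> F) s x : slab_smooth O g -> O s ->
  {for (s, x), continuous (fun p : E * R => g p.1 p.2)}.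
Proof. by move=> gC Os; apply: (smooth_continuous gC). Qed.

Lemma slab_support g s : locally_supported O g -> O s ->
  exists A r : R, [/\ 0 <= A, 0 < r & forall t, `|t - s| < r ->
    O t /\ forall x, A <= `|x| -> g t x = 0].
Proof.
move=> gS Os; have [A /nearP[r1 r10 r1P]] := gS s Os.
have /nearP[r2 r20 r2P] : nbhs s O by exact: open_nbhs_nbhs.
exists (Num.max A 0), (Num.min r1 r2); split; first by rewrite le_max lexx orbT.
  by rewrite lt_min r10.
move=> t; rewrite lt_min => /andP[/r1P t1 /r2P t2]; split=> // x.
by rewrite ge_max => /andP[/t1].
Qed.

Lemma primitive_sub (f h : R -> R) x : compactly_supported f -> compactly_supported h ->
  primitive (fun y => f y - h y) x = primitive f x - primitive h x.
Proof. by move=> cf ch; rewrite /primitive RintegralB//; exact: compactly_supported_integrable. Qed.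

Lemma primitive_scale (a : R) (f : R -> R) x : compactly_supported f ->
  primitive (fun y => a * f y) x = a * primitive f x.
Proof. by move=> cf; rewrite /primitive RintegralZl//; exact: compactly_supported_integrable. Qed.

Lemma compactly_supportedB (f g : R -> R) : compactly_supported f -> compactly_supported g ->
  compactly_supported (fun x => f x - g x).
Proof.
move=> cf cg; rewrite (_ : (fun x => _) = fun x => f x + -1 * g x).
  by apply: compactly_supportedD => //; exact: compactly_supportedZ.
by apply/funext => x; rewrite mulN1r.
Qed.

Lemma slab_primitive_continuous g s x : slab_smooth O g -> locally_supported O g -> O s ->
  {for (s, x), continuous (fun p : E * R => primitive (g p.1) p.2)}.
Proof.
move=> gC gS Os; apply: (@slab_continuousP E (fun t y => primitive (g t) y)) => e e0.
have [A [r [A0 r0 rP]]] := slab_support gS Os.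
(* One half of [e] is for the change of the parameter, the other for the change of the endpoint. The
   summand 1 avoids division by zero when [A = 0]. *)
have K0 : 0 < e / 2 / (1 + 2 * A) by rewrite !divr_gt0// ltr_wpDr// mulr_ge0.
have [r1 r10 r1P] := tube (A := A) K0 (fun x _ => slab_continuous2 gC Os).
have cg := slab_compactly_supported gC gS Os.
have [r2 r20 r2P] : exists2 r : R, 0 < r &
    forall y, `|y - x| < r -> `|primitive (g s) y - primitive (g s) x| < e / 2.
  have e20 : 0 < e / 2 by rewrite divr_gt0.
  have [r2 r20 r2P] := is_derive_small (is_derive_primitive x cg) e20.
  exists r2 => // y /r2P; rewrite [(y - x) *: 1]mulr1 [x + _]addrC subrK; exact.
exists (Num.min r (Num.min r1 r2)) => [|t y]; first by rewrite !lt_min r0 r10.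
rewrite !lt_min => /and3P[tr tr1 _] /and3P[_ _ /r2P yr].
have [Ot tA] := rP t tr.
rewrite -(subrKA (primitive (g s) y)) (le_trans (ler_normD _ _))// (splitr e) lerD//; last exact: ltW.
rewrite -primitive_sub//; last exact: slab_compactly_supported.
apply: (@le_trans _ _ (e / 2 / (1 + 2 * A) * (2 * A))).
  apply: primitive_bound => //.
  - by apply: compactly_supportedB => //; exact: slab_compactly_supported.
  - by move=> z zA; rewrite tA// (rP s _).2 ?subrr ?normr0.
  - move=> z; have [zA|/ltW zA] := leP `|z| A; first exact: r1P.
    by rewrite tA// (rP s _).2 ?subrr ?normr0// ltW.
rewrite mulrAC ler_pdivrMr ?ltr_wpDr// ?mulr_ge0// ler_wpM2l// ?divr_ge0 ?ltW//.
by rewrite ltr_pwDl.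
Qed.

(** By the mean value theorem the remainder at each [z] is [h] times an oscillation of the parameter
    derivative. It is uniformly small by [tube], and [primitive_bound] integrates it over the common
    support. *)
Lemma slab_primitive_derive1 g s x v : slab_smooth O g -> locally_supported O g -> O s ->
  is_derive s v (fun t => primitive (g t) x)
    (primitive (fun y => 'D_v (fun t => g t y) s) x).
Proof.
move=> gC gS Os; apply/is_derive_epsP => e e0.
have dgC := slab_smooth_derive1 v gC; have dgS := locally_supported_derive1 v gS.
set dg := fun s y => 'D_v (fun t => g t y) s in dgC dgS.
rewrite -/(dg s).
have [A [r [A0 r0 rP]]] := slab_support gS Os.
have [A' [r' [A'0 r'0 r'P]]] := slab_support dgS Os.
pose B := Num.max A A'.
have B0 : 0 <= B by rewrite le_max A0.
have K0 : 0 < e / (1 + 2 * B) by rewrite !divr_gt0// ltr_wpDr// mulr_ge0.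
have [r1 r10 r1P] := tube (A := B) K0 (fun x _ => slab_continuous2 dgC Os).
have V0 : 0 < 1 + `|v| by rewrite ltr_wpDr.
exists (Num.min r r1 / (1 + `|v|)) => [|h]; first by rewrite divr_gt0// lt_min r0.
rewrite ltr_pdivlMr// lt_min => /andP[hr hr1].
have hv t : `|t| <= `|h| -> `|(s + t *: v) - s| <= `|h| * (1 + `|v|).
  by move=> th; rewrite addrC addKr normrZ ler_pM// ler_wpDl.
have hvr t : `|t| <= `|h| -> `|(s + t *: v) - s| < r by move=> /hv/le_lt_trans; exact.
have hvr1 t : `|t| <= `|h| -> `|(s + t *: v) - s| < r1 by move=> /hv/le_lt_trans; exact.
have [Oh hA] := rP _ (hvr h (lexx _)).
have s0 : `|s - s| < r by rewrite subrr normr0.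
have s0' : `|s - s| < r' by rewrite subrr normr0.
have cs := slab_compactly_supported gC gS Os.
have ch := slab_compactly_supported gC gS Oh.
have cd := slab_compactly_supported dgC dgS Os.
have -> : primitive (g (s + h *: v)) x - primitive (g s) x - h *: primitive (dg s) x =
    primitive (fun z => (g (s + h *: v) z - g s z) - h * dg s z) x.
  by rewrite !primitive_sub ?primitive_scale//;
    [exact: compactly_supportedB|exact: compactly_supportedZ].
apply: (@le_trans _ _ (e / (1 + 2 * B) * `|h| * (2 * B))).
  apply: primitive_bound => //.
  - by apply: compactly_supportedB; [exact: compactly_supportedB|exact: compactly_supportedZ].
  - move=> z; rewrite ge_max => /andP[zA zA'].
    by rewrite hA// (rP s s0).2// (r'P s s0').2// mulr0 !subr0.
  - move=> z.
    have [t th ->] := @MVT_dir R E (fun t => g t z) (fun t => dg t z) s v h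
      (fun t th => slab_derive1 z v gC (rP _ (hvr t th)).1).
    rewrite -mulrBr normrM mulrC ler_wpM2r//.
    have [zB|/ltW zB] := leP `|z| B; first exact: r1P (hvr1 t th) z zB.
    have {zB} : B <= `|z| by []; rewrite ge_max => /andP[zA zA'].
    have -> : dg (s + t *: v) z = 0.
      rewrite /dg -[RHS](derive_cst (0 : R) (s + t *: v) v); apply: near_eq_derive.
      apply/nearP; exists (r - `|(s + t *: v) - s|); first by rewrite subr_gt0 hvr.
      move=> t' Ht'; apply: (rP _ _).2 => //.
      rewrite -(subrKA (s + t *: v)) (le_lt_trans (ler_normD _ _))//.
      by rewrite -ltrBrDr.
    by rewrite (r'P s s0').2// subrr normr0 ltW.
rewrite mulrAC ler_wpM2r// mulrAC ler_pdivrMr ?ltr_wpDr// ?mulr_ge0// ler_wpM2l// ?ltW//.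
by rewrite ltr_pwDl.
Qed.

(** In the direction [(v, c)] of the pair formed by parameter and endpoint, the derivative is the
    primitive of [D_v g] plus [c * g]. The first term has the same form with another integrand,
    hence the induction over all [g]. *)
Lemma primitive_smooth g : slab_smooth O g -> locally_supported O g ->
  slab_smooth O (fun s x => primitive (g s) x).
Proof.
move=> + + n; elim: n g => [|n IH] g gC gS.
  by split=> // -[s x] [/= Os _]; exact: slab_primitive_continuous.
have D (p w : E * R) : (O `*` setT) p ->
    is_derive p w (fun p => primitive (g p.1) p.2)
      (primitive (fun y => 'D_(w.1) (fun t => g t y) p.1) p.2 + w.2 * g p.1 p.2).
  move: p w => [s x] [v c] [/= Os _].
  pose b (i : 'I_2) : E * R := if i == 0 then (v, 0) else (0, 1).
  pose k (i : 'I_2) : R := if i == 0 then 1 else c.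
  pose dG (i : 'I_2) (p : E * R) : R := if i == 0
    then primitive (fun y => 'D_v (fun t => g t y) p.1) p.2 else g p.1 p.2.
  have -> : (v, c) = \sum_i k i *: b i.
    by rewrite !big_ord_recl big_ord0 /k /b/= addr0; congr (_, _);
      rewrite /= ?scaler0 ?addr0 ?scale1r// add0r [_ *: 1]mulr1.
  have -> : primitive (fun y => 'D_v (fun t => g t y) s) x + c * g s x =
      \sum_i k i * dG i (s, x).
    by rewrite !big_ord_recl big_ord0 /k /dG/= addr0 mul1r.
  have nO : nbhs (s, x) (O `*` setT) by apply: open_nbhs_nbhs.
  apply: is_derive_lincomb => i.
    apply: filterS nO => -[t y] [/= Ot _]; rewrite /b /dG; case: eqP => _.
      apply: (is_derive_slab1 (fun t x => primitive (g t) x) t y v _).2.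
      exact: slab_primitive_derive1.
    apply: (is_derive_slab2 (fun t x => primitive (g t) x) t y _).2.
    by apply: is_derive_primitive; exact: slab_compactly_supported.
  rewrite /dG; case: eqP => _; last exact: slab_continuous2.
  apply: (@slab_primitive_continuous (fun t y => 'D_v (fun t => g t y) t)) => //.
    exact: slab_smooth_derive1.
  exact: locally_supported_derive1.
split=> [[s x] [/= Os _]|w]; first exact: slab_primitive_continuous.
split=> [p Op|]; first by have [] := D p w Op.
apply: (@Cn_eq _ _ _ _ _ (fun p : E * R =>
  primitive (fun y => 'D_(w.1) (fun t => g t y) p.1) p.2 + w.2 * g p.1 p.2)) => //.
  by move=> p Op; have [_ ->] := D p w Op.
apply: Cn_add => //.
  apply: (IH (fun s y => 'D_(w.1) (fun t => g t y) s)).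
    exact: slab_smooth_derive1.
  exact: locally_supported_derive1.
by apply: Cn_mul => //; exact: Cn_cst.
Qed.

(** Near [s] all supports lie in one interval, so the integral is a primitive at a fixed endpoint
    and facts about primitives carry over. *)
Lemma integral_near_primitive g s : slab_smooth O g -> locally_supported O g -> O s ->
  exists A : R, \forall t \near s, primitive (g t) A = integral (g t).
Proof.
move=> gC gS Os; have [A [r [A0 r0 rP]]] := slab_support gS Os.
exists A; apply/nearP; exists r => // t /rP[Ot tA].
by rewrite (primitive_right _ tA)//; exact: slab_compactly_supported.
Qed.

Lemma integral_derive g s v : slab_smooth O g -> locally_supported O g -> O s ->
  is_derive s v (fun t => integral (g t)) (integral (fun x => 'D_v (fun t => g t x) s)).
Proof.
move=> gC gS Os; have [A HA] := integral_near_primitive gC gS Os.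
have dgC := slab_smooth_derive1 v gC; have dgS := locally_supported_derive1 v gS.
have [A' [r' [A'0 r'0 r'P]]] := slab_support dgS Os.
have s0' : `|s - s| < r' by rewrite subrr normr0.
have cd := slab_compactly_supported dgC dgS Os.
have [B [B0 AB fB]] := support_enlarge A cd.
have [C [r [C0 r0 rP]]] := slab_support gS Os.
pose D := Num.max B C.
have -> : integral (fun x => 'D_v (fun t => g t x) s) =
    primitive (fun x => 'D_v (fun t => g t x) s) D.
  by rewrite (primitive_right cd fB)// le_max lexx.
apply: near_eq_is_derive (slab_primitive_derive1 D v gC gS Os).
apply/nearP; exists r => // t /rP[Ot tA].
rewrite (primitive_right _ tA)//; first exact: slab_compactly_supported.
by rewrite le_max lexx orbT.
Qed.

Lemma integral_smooth g : slab_smooth O g -> locally_supported O g ->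
  smooth O (fun s => integral (g s)).
Proof.
move=> + + n; elim: n g => [|n IH] g gC gS.
  split=> // s Os; have [A HA] := integral_near_primitive gC gS Os.
  apply: near_eq_continuous_at HA _.
  apply: (@continuous_comp _ _ _ (fun t => (t, A)) (fun p : E * R => primitive (g p.1) p.2)).
    move=> U [[V W] /= [Vs WA] VW]; apply: filterS Vs => t Vt.
    by apply: (VW (t, A)); split=> //; exact: nbhs_singleton WA.
  exact: slab_primitive_continuous.
have cI := (IH g gC gS); split=> [s Os|v]; first exact: Cn_continuous cI Os.
split=> [s Os|]; first by have [] := integral_derive v gC gS Os.
apply: (@Cn_eq _ _ _ _ _ (fun s => integral (fun x => 'D_v (fun t => g t x) s))) => //.
  by move=> s Os; have [_ ->] := integral_derive v gC gS Os.
apply: (IH (fun s y => 'D_v (fun t => g t y) s)).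
  exact: slab_smooth_derive1.
exact: locally_supported_derive1.
Qed.

Lemma slab_smooth_const_x (f : E -> R) : smooth O f -> slab_smooth O (fun s _ => f s).
Proof.
move=> + n; elim: n f => [|n IH] f fC.
  split=> // -[s x] [/= Os _].
  apply: (@continuous_comp _ _ _ fst f); first exact: cvg_fst.
  exact: smooth_continuous fC Os.
have cI := IH f fC; split=> [p Op|w]; first exact: Cn_continuous cI Op.
have D (p : E * R) : (O `*` setT) p -> is_derive p w (fun p => f p.1) ('D_(w.1) f p.1).
  move=> [Op _]; have /is_derive_epsP H := smooth_derivable w.1 fC Op.
  by apply/is_derive_epsP => e /H.
split=> [p Op|]; first by have [] := D p Op.
apply: (@Cn_eq _ _ _ _ _ (fun p : E * R => 'D_(w.1) f p.1) _ oOT).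
  by move=> p Op; have [_ ->] := D p Op.
exact: IH (smooth_derive _ fC).
Qed.

Lemma dinv_smooth g : slab_smooth O g -> locally_supported O g ->
  slab_smooth O (fun s x => dinv (g s) x).
Proof.
move=> gC gS.
apply: (@slab_smooth_eq _ (fun s x => primitive (g s) x - integral (g s) * 2^-1)).
  by move=> s x Os; rewrite dinvE//; exact: slab_compactly_supported.
apply: slab_smoothB; first exact: primitive_smooth.
apply: slab_smoothM; last exact: slab_smooth_cst.
by apply: slab_smooth_const_x; exact: integral_smooth.
Qed.

Lemma dinv_derive1 g s x v : slab_smooth O g -> locally_supported O g -> O s ->
  is_derive s v (fun t => dinv (g t) x) (dinv (fun y => 'D_v (fun t => g t y) s) x).
Proof.
move=> gC gS Os.
rewrite dinvE; last first.
  exact: (slab_compactly_supported (slab_smooth_derive1 v gC) (locally_supported_derive1 v gS) Os).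
apply: (@near_eq_is_derive _ _ _ (fun t => primitive (g t) x - 2^-1 * integral (g t))).
  apply: filterS (open_nbhs_nbhs (conj oO Os)) => t Ot.
  by rewrite dinvE 1?mulrC//; exact: slab_compactly_supported.
rewrite mulrC; apply: is_deriveB; first exact: slab_primitive_derive1.
have := @is_deriveZ _ _ _ (fun t => integral (g t)) 2^-1 s v _ (integral_derive v gC gS Os).
exact.
Qed.

End slab.
End parametric_integrals.

(** * Families of fields and second variations *)

Section affine_maps.
Context {R : realType}.
Implicit Types E F : normedModType R.

(** This also covers vector-valued [f]: for an affine inner map with linear part [L] the derivative
    of the composite is exactly the derivative of [f] in the direction [L v], without any chain
    rule. *)
Lemma smooth_affine E F F' (A : set E) (B : set F) (f : F -> F') (G L : E -> F) :
  open A -> continuous G -> (forall z v (h : R), G (z + h *: v) = G z + h *: L v) ->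
  (forall x, A x -> B (G x)) -> smooth B f -> smooth A (fun x => f (G x)).
Proof.
move=> oA Gc GL AB + n; elim: n f => [|n IH] f fC.
  split=> // x Ax; apply: continuous_comp; first exact: Gc.
  exact: smooth_continuous fC (AB _ Ax).
have cI := IH f fC; split=> [x Ax|v]; first exact: Cn_continuous cI Ax.
have D x : A x -> is_derive x v (fun x => f (G x)) ('D_(L v) f (G x)).
  move=> Ax; have /is_derive_epsP H := smooth_derivable (L v) fC (AB _ Ax).
  by apply/is_derive_epsP => e /H[r r0 rP]; exists r => // h /rP; rewrite GL.
split=> [x Ax|]; first by have [] := D x Ax.
apply: (@Cn_eq _ _ _ _ _ (fun x => 'D_(L v) f (G x)) _ oA).
  by move=> x Ax; have [_ ->] := D x Ax.
exact: IH (smooth_derive _ fC).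
Qed.

Lemma is_derive_affine E F F' (f : F -> F') (G L : E -> F) x v d :
  (forall z v (h : R), G (z + h *: v) = G z + h *: L v) ->
  is_derive (G x) (L v) f d -> is_derive x v (fun x => f (G x)) d.
Proof.
move=> GL /is_derive_epsP H.
by apply/is_derive_epsP => e /H[r r0 rP]; exists r => // h /rP; rewrite GL.
Qed.

Lemma is_derive_lsubmx k l F (f : 'rV[R]_k -> F) (p z : 'rV[R]_(k + l)) d :
  is_derive (lsubmx p) (lsubmx z) f d -> is_derive p z (fun q => f (lsubmx q)) d.
Proof.
move=> /is_derive_epsP H; apply/is_derive_epsP => e /H[r r0 rP].
exists r => // h /rP.
by have -> : lsubmx (p + h *: z) = lsubmx p + h *: lsubmx z by rewrite linearD linearZ.
Qed.

Lemma is_derive_row_mx0 k l F (f : 'rV[R]_(k + l) -> F) (s v : 'rV[R]_k) d :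
  is_derive (row_mx s 0) (row_mx v 0) f d ->
  is_derive s v (fun t => f (row_mx t 0)) d.
Proof.
move=> /is_derive_epsP H; apply/is_derive_epsP => e /H[r r0 rP].
by exists r => // h /rP; rewrite scale_row_mx add_row_mx scaler0 addr0.
Qed.

Lemma is_derive_line0 E F (f : E -> F) x v d :
  is_derive x v f d <-> is_derive (0 : R) (1 : R) (fun t : R => f (x + t *: v)) d.
Proof. by have := is_derive_line f x v d 0; rewrite scale0r addr0. Qed.

Lemma continuous_pair_slab E F (G : E -> F) : continuous G ->
  continuous (fun p : E * R => (G p.1, p.2)).
Proof.
move=> Gc [s x] U [[V W] /= [Vs Wx] VW]; exists (G @^-1` V, W) => /=.
  by split=> //; exact: Gc.
by move=> [t y] [/= Vt Wy]; exact: (VW (G t, y)).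
Qed.

Lemma continuous_lsubmx k l : continuous (@lsubmx R 1 k l).
Proof.
move=> p; apply: (continuous_rV _ p).2 => j.
apply: (@near_eq_continuous_at _ _ (fun q : 'rV[R]_(k + l) => q 0 (lshift l j))).
  by near=> z; rewrite mxE.
exact: coord_continuous.
Unshelve. all: by end_near. Qed.

Lemma continuous_row_mx0 k l : continuous (fun s : 'rV[R]_k => row_mx s (0 : 'rV[R]_l)).
Proof.
move=> p; apply: (continuous_rV _ p).2 => j; case: (splitP j) => i ji.
  apply: (@near_eq_continuous_at _ _ (fun q : 'rV[R]_k => q 0 i)).
    near=> z; have -> : j = lshift l i by exact/val_inj.
    by rewrite row_mxEl.
  exact: coord_continuous.
apply: (@near_eq_continuous_at _ _ (fun q : 'rV[R]_k => 0 : R)).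
  near=> z; have -> : j = rshift k i by exact/val_inj.
  by rewrite row_mxEr mxE.
exact: cst_continuous.
Unshelve. all: by end_near. Qed.

End affine_maps.

(** * Adding a parameter to a family of fields *)

Section families.
Context {R : realType} {N : nat} (U : set 'rV[R]_N) (c : 'rV[R]_N).
Hypothesis oU : open U.

Definition equal_ends (E : normedModType R) (V : Type) (O : set E) (X : E -> R -> V) :=
  forall s, O s -> exists A : R, \forall t \near s, forall x y : R,
    A <= `|x| -> A <= `|y| -> X t x = X t y.

Lemma slab_smooth_rV (E : normedModType R) m (O : set E) (X : E -> R -> 'rV[R]_m) : open O ->
  slab_smooth O X <-> forall j, slab_smooth O (fun s x => X s x 0 j).
Proof. by move=> oO; apply: smooth_rV; exact: open_slab. Qed.

(* The family with an additional parameter [e], the last entry of [p]: [phi + e X]. *)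
Definition ext_family k m (phi X : 'rV[R]_k -> R -> 'rV[R]_m) (p : 'rV[R]_(k + 1)) (x : R) :=
  phi (lsubmx p) x + p 0 (rshift k ord0) *: X (lsubmx p) x.

Definition ext_domain k (O : set 'rV[R]_k) (phi X : 'rV[R]_k -> R -> 'rV[R]_N)
  : set 'rV[R]_(k + 1) :=
  [set p | O (lsubmx p) /\ forall x, U (ext_family phi X p x)].

Lemma slab_smooth_lsubmx k (O : set 'rV[R]_k) (g : 'rV[R]_k -> R -> R) : open O ->
  slab_smooth O g ->
  slab_smooth [set p : 'rV[R]_(k + 1) | O (lsubmx p)] (fun p => g (lsubmx p)).
Proof.
move=> oO gC.
apply: (@smooth_affine R _ _ _ _ _ (fun p : 'rV[R]_k * R => g p.1 p.2)
  (fun p : 'rV[R]_(k + 1) * R => (lsubmx p.1, p.2)) (fun p => (lsubmx p.1, p.2))) gC.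
- by apply: open_slab; apply: open_comp oO => p _; exact: continuous_lsubmx.
- exact: continuous_pair_slab (@continuous_lsubmx R k 1).
- by move=> [z a] [v b] h; rewrite /= linearD linearZ.
- by move=> [p x] [/= Op _].
Qed.

Lemma open_lsubmx k (O : set 'rV[R]_k) : open O -> open [set p : 'rV[R]_(k + 1) | O (lsubmx p)].
Proof. by move=> oO; apply: open_comp oO => p _; exact: continuous_lsubmx. Qed.

Lemma ext_family_smooth k (O : set 'rV[R]_k) (phi X : 'rV[R]_k -> R -> 'rV[R]_N) : open O ->
  slab_smooth O phi -> slab_smooth O X ->
  slab_smooth [set p : 'rV[R]_(k + 1) | O (lsubmx p)] (ext_family phi X).
Proof.
move=> oO pC XC; have oO1 := open_lsubmx oO; apply/slab_smooth_rV => // j.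
apply: (@slab_smooth_eq _ _ _ oO1 _ (fun p x => phi (lsubmx p) x 0 j +
    p 0 (rshift k ord0) * X (lsubmx p) x 0 j)).
  by move=> p x _; rewrite /ext_family !mxE.
apply: slab_smoothD => //.
  by apply: (slab_smooth_lsubmx (g := fun s x => phi s x 0 j)) => //; exact: (slab_smooth_rV _ oO).1.
apply: slab_smoothM => //.
  by apply: slab_smooth_const_x => //; exact: smooth_coord.
by apply: (slab_smooth_lsubmx (g := fun s x => X s x 0 j)) => //; exact: (slab_smooth_rV _ oO).1.
Qed.

Lemma family_vacuum k (O : set 'rV[R]_k) phi s : field_family U c O phi -> O s -> U c.
Proof.
move=> [_ _ pU pc] Os; have [A /nbhs_singleton HA] := pc s Os.
by rewrite -(HA `|A|) ?ler_norm//; [exact: pU|rewrite normr_id ler_norm].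
Qed.

Lemma ext_support k (O : set 'rV[R]_k) (phi X : 'rV[R]_k -> R -> 'rV[R]_N) s :
  field_family U c O phi -> locally_supported O X -> O s ->
  exists A : R, \forall t \near s, O t /\ forall x, A <= `|x| -> phi t x = c /\ X t x = 0.
Proof.
move=> [oO _ _ pc] XS Os; have [A HA] := pc s Os; have [B HB] := XS s Os.
exists (Num.max A B); near=> t; split.
  by near: t; exact: open_nbhs_nbhs.
move=> x; rewrite ge_max => /andP[xA xB]; split.
  by move: x xA xB; near: t; apply: filterS HA => t H x xA _; exact: H.
by move: x xA xB; near: t; apply: filterS HB => t H x _ xB; exact: H.
Unshelve. all: by end_near. Qed.

(** Openness of the domain is the main point. On a compact interval the perturbed field stays in [U]
    by compactness; outside it equals [c], which lies in [U]. *)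
Lemma ext_family_field k (O : set 'rV[R]_k) (phi X : 'rV[R]_k -> R -> 'rV[R]_N) :
  field_family U c O phi -> slab_smooth O X -> locally_supported O X ->
  field_family U c (ext_domain O phi X) (ext_family phi X).
Proof.
move=> phiF XC XS; have [oO pC pU pc] := phiF.
have oO1 := open_lsubmx oO; have PC := ext_family_smooth oO pC XC.
have supp p : O (lsubmx p) -> exists A : R, \forall q \near p, forall x, A <= `|x| ->
    ext_family phi X q x = c.
  move=> Op; have [A HA] := ext_support phiF XS Op; exists A.
  have : \forall q \near p, O (lsubmx q) /\ forall x, A <= `|x| ->
      phi (lsubmx q) x = c /\ X (lsubmx q) x = 0.
    exact: (continuous_lsubmx HA).
  apply: filterS => q [_ H] x /H[p1 p2].
  by rewrite /ext_family p1 p2 scaler0 addr0.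
have oE : open (ext_domain O phi X).
  rewrite openE => p [Op Up].
  have [A HA] := supp p Op.
  have K : compact `[- A, A] by exact: segment_compact.
  have /compact_near_coveringP
    /(_ _ (nbhs p) (fun q x => U (ext_family phi X q x)) _) H := K.
  have {}H : \forall q \near p, `[- A, A] `<=` (fun x => U (ext_family phi X q x)).
    apply: H => x _.
    have cx : {for (p, x), continuous (fun q : 'rV[R]_(k+1) * R => ext_family phi X q.1 q.2)}.
      exact: (@smooth_continuous R _ _ _ (fun q : 'rV[R]_(k + 1) * R =>
        ext_family phi X q.1 q.2) (p, x) PC (conj Op I)).
    have : nbhs (ext_family phi X p x) U by apply: open_nbhs_nbhs; split.
    move=> /cx [[V W] /= [Vp Wx] VW]; exists (W, V) => //=.
    by move=> [y q] [/= Wy Vq]; exact: (VW (q, y)).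
  have H2 : nbhs p [set p | O (lsubmx p)] by apply: open_nbhs_nbhs.
  rewrite /interior; near=> q; split; first by near: q.
  move=> x; have [xA|/ltW xA] := leP `|x| A.
    have : `[- A, A] `<=` (fun x => U (ext_family phi X q x)) by near: q.
    by apply; rewrite /= in_itv/= -ler_norml.
  rewrite (_ : ext_family phi X q x = c); first exact: family_vacuum phiF Op.
  by move: x xA; near: q.
split=> //.
- apply: smooth_subset PC => -[p x] [[Op _] _]; split=> //.
- by move=> p x [_]; exact.
- by move=> p [Op _]; exact: supp.
Unshelve. all: by end_near. Qed.

End families.

(** * The pairing of vectors and covectors *)

Section dot_product.
Context {R : realType}.
Implicit Types E : normedModType R.

Lemma dotDl m (a b x : 'rV[R]_m) : dot (a + b) x = dot a x + dot b x.
Proof. by rewrite /dot -big_split; apply: eq_bigr => i _; rewrite mxE mulrDl. Qed.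

Lemma dotZl m k (a x : 'rV[R]_m) : dot (k *: a) x = k * dot a x.
Proof. by rewrite /dot mulr_sumr; apply: eq_bigr => i _; rewrite mxE mulrA. Qed.

Lemma dotC m (a b : 'rV[R]_m) : dot a b = dot b a.
Proof. by apply: eq_bigr => i _; rewrite mulrC. Qed.

Lemma dotDr m (a b x : 'rV[R]_m) : dot x (a + b) = dot x a + dot x b.
Proof. by rewrite !(dotC x) dotDl. Qed.

Lemma dotZr m k (a x : 'rV[R]_m) : dot x (k *: a) = k * dot x a.
Proof. by rewrite !(dotC x) dotZl. Qed.

Lemma dot0l m (x : 'rV[R]_m) : dot 0 x = 0.
Proof. by rewrite /dot big1// => i _; rewrite mxE mul0r. Qed.

Lemma dot0r m (x : 'rV[R]_m) : dot x 0 = 0.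
Proof. by rewrite dotC dot0l. Qed.

Lemma dot_suml m I (r : seq I) (P : pred I) (a : I -> 'rV[R]_m) x :
  dot (\sum_(i <- r | P i) a i) x = \sum_(i <- r | P i) dot (a i) x.
Proof.
apply: (big_morph (fun a => dot a x)) => [a' b'|]; [exact: dotDl|exact: dot0l].
Qed.

Lemma dot_sumr m I (r : seq I) (P : pred I) (a : I -> 'rV[R]_m) x :
  dot x (\sum_(i <- r | P i) a i) = \sum_(i <- r | P i) dot x (a i).
Proof. by rewrite dotC dot_suml; apply: eq_bigr => i _; rewrite dotC. Qed.

Lemma dot_mulmx m n (x : 'rV[R]_m) (M : 'M[R]_(m, n)) (y : 'rV[R]_n) :
  dot (x *m M) y = dot x (y *m M^T).
Proof.
have E k (a b : 'rV[R]_k) : dot a b = (a *m b^T) 0 0.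
  by rewrite mxE; apply: eq_bigr => i _; rewrite mxE.
by rewrite !E trmx_mul trmxK mulmxA.
Qed.

Lemma is_derive_sum_fun E (I : Type) (r : seq I) (f : I -> E -> R) x v (d : I -> R) :
  (forall i, is_derive x v (f i) (d i)) ->
  is_derive x v (fun y => \sum_(i <- r) f i y) (\sum_(i <- r) d i).
Proof.
move=> fd; elim: r => [|i r IH].
  rewrite big_nil (_ : (fun y => _) = fun=> 0); first exact: is_derive_cst.
  by apply/funext => y; rewrite big_nil.
rewrite big_cons (_ : (fun y => _) = fun y => f i y + \sum_(j <- r) f j y).
  exact: is_deriveD.
by apply/funext => y; rewrite big_cons.
Qed.

Lemma is_derive_dot E m (a b : E -> 'rV[R]_m) x v da db :
  is_derive x v a da -> is_derive x v b db ->
  is_derive x v (fun y => dot (a y) (b y)) (dot da (b x) + dot (a x) db).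
Proof.
move=> /is_derive_rV ad /is_derive_rV bd.
rewrite /dot -big_split /=; apply: is_derive_sum_fun => i.
exact: is_derive_mul (ad i) (bd i).
Qed.

Variables (E : normedModType R) (O : set E) (m : nat).
Hypothesis oO : open O.
Implicit Types X Y : E -> R -> 'rV[R]_m.

Lemma slab_smooth_dot X Y : slab_smooth O X -> slab_smooth O Y ->
  slab_smooth O (fun s x => dot (X s x) (Y s x)).
Proof.
move=> /(slab_smooth_rV _ oO) XC /(slab_smooth_rV _ oO) YC.
by apply: slab_smooth_sum => // i; apply: slab_smoothM => //.
Qed.

Lemma locally_supported_filter (F : normedModType R) (V : Type) (z : V) (X : E -> R -> V)
    (Y : E -> R -> F) : (forall t x, X t x = z -> Y t x = 0) ->
  (forall s, O s -> exists A : R, \forall t \near s, forall x, A <= `|x| -> X t x = z) ->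
  locally_supported O Y.
Proof.
move=> XY XS s /XS[A HA]; exists A; apply: filterS HA => t H x /H; exact: XY.
Qed.

Lemma locally_supported_dotl X Y : locally_supported O X ->
  locally_supported O (fun s x => dot (X s x) (Y s x)).
Proof.
move=> XS; apply: (locally_supported_filter (X := X)) XS => t x ->.
exact: dot0l.
Qed.

Lemma locally_supported_dotr X Y : locally_supported O Y ->
  locally_supported O (fun s x => dot (X s x) (Y s x)).
Proof.
move=> XS; apply: (locally_supported_filter (X := Y)) XS => t x ->.
exact: dot0r.
Qed.

End dot_product.

(** * Hessians of functionals and their symmetry *)

Section functionals.
Context {R : realType} {N : nat} (U : set 'rV[R]_N) (c : 'rV[R]_N).
Hypothesis oU : open U.

(** The Hessian of [I] at [u] applied to the tangent vector [X]. *)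
Definition dvder (I : functional U c) (u X : R -> 'rV[R]_N) (x : R) : 'rV[R]_N :=
  'D_(1 : R) (fun e : R => vder I (fun y => u y + e *: X y) x) 0.

Lemma field_family_derive_supported k (O : set 'rV[R]_k) phi v : field_family U c O phi ->
  locally_supported O (fun s x => 'D_v (fun t => phi t x) s).
Proof.
move=> [oO _ _ pc] s Os; have [A /near_join HA] := pc s Os; exists A.
near=> t => x xA.
rewrite -[RHS](derive_cst c t v); apply: near_eq_derive.
have : \forall t' \near t, forall x, A <= `|x| -> phi t' x = c by near: t.
by apply: filterS => t'; exact.
Unshelve. all: by end_near. Qed.

Lemma equal_ends_derive1 k (O : set 'rV[R]_k) m (X : 'rV[R]_k -> R -> 'rV[R]_m) v :
  equal_ends O X -> equal_ends O (fun s x => 'D_v (fun t => X t x) s).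
Proof.
move=> XE s Os; have [A /near_join HA] := XE s Os; exists A.
near=> t => x y xA yA; apply: near_eq_derive.
have : \forall t' \near t, forall x y, A <= `|x| -> A <= `|y| -> X t' x = X t' y by near: t.
by apply: filterS => t'; exact.
Unshelve. all: by end_near. Qed.

(** With [k = 0] this turns statements about families into statements about a single field. *)
Lemma const_family k u : field U c u -> field_family U c [set: 'rV[R]_k] (fun=> u).
Proof.
move=> [uC uU [A uA]]; split=> //.
- exact: openT.
- apply: (@smooth_affine R ('rV[R]_k * R)%type R _ _ setT u snd snd) uC => //.
  + by apply: open_slab; exact: openT.
  + by move=> p; exact: cvg_snd.
- by move=> s _; exists A; near=> t.
Unshelve. all: by end_near. Qed.

Lemma family_field k (O : set 'rV[R]_k) phi s : field_family U c O phi -> O s -> field U c (phi s).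
Proof.
move=> [oO pC pU pc] Os; split=> [|x|].
- have /smooth_rV H := pC; apply/smooth_rV; first exact: openT.
  move=> j; apply: (@slab_smooth_x _ _ _ oO (fun s x => phi s x 0 j)) => //.
  by apply: (slab_smooth_rV _ oO).1.
- exact: pU.
- by have [A /nbhs_singleton HA] := pc s Os; exists A.
Qed.

Section directional.
Variables (k : nat) (O : set 'rV[R]_k) (phi X : 'rV[R]_k -> R -> 'rV[R]_N).
Hypotheses (phiF : field_family U c O phi) (XC : slab_smooth O X) (XS : locally_supported O X).

Let Phi := ext_family phi X.
Let O' := ext_domain U O phi X.
Let PhiF : field_family U c O' Phi := ext_family_field oU phiF XC XS.
Let oO : open O. Proof. by case: phiF. Qed.
Let oO' : open O'. Proof. by case: PhiF. Qed.
Let iota (s : 'rV[R]_k) : 'rV[R]_(k + 1) := row_mx s 0.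
Let delta : 'rV[R]_(k + 1) := row_mx 0 (const_mx 1).

Let iotaZ z v (h : R) : iota (z + h *: v) = iota z + h *: iota v.
Proof. by rewrite /iota scale_row_mx add_row_mx scaler0 addr0. Qed.

Lemma ext_family_line s (e : R) :
  Phi (iota s + e *: delta) = (fun y => phi s y + e *: X s y).
Proof.
apply/funext => y; rewrite /Phi /ext_family linearD linearZ /= !row_mxKl scaler0 addr0.
congr (_ + _ *: _).
by rewrite [LHS]mxE /iota row_mxEr [X in _ + X]mxE /delta row_mxEr !mxE add0r mulr1.
Qed.

Let Phi0 s : Phi (iota s) = phi s.
Proof.
have := ext_family_line s 0; rewrite scale0r addr0 => ->.
by apply/funext => y; rewrite scale0r addr0.
Qed.

Let O'iota s : O s -> O' (iota s).
Proof.
move=> Os; split; first by rewrite /= row_mxKl.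
by move=> x; rewrite -/Phi Phi0; have [_ _ pU _] := phiF; exact: pU.
Qed.

Lemma near_perturb s : O s -> \forall e \near (0 : R),
  field U c (fun y => phi s y + e *: X s y).
Proof.
move=> Os.
have n : nbhs (iota s) O' by apply: open_nbhs_nbhs; split=> //; exact: O'iota.
have cl : {for 0, continuous (fun e : R => iota s + e *: delta)}.
  by apply: cvgD; [exact: cvg_cst|apply: cvgZr_tmp; exact: cvg_id].
have : \forall e \near (0 : R), O' (iota s + e *: delta).
  by apply: cl; rewrite scale0r addr0.
by apply: filterS => e Oe; rewrite -ext_family_line; exact: family_field PhiF Oe.
Qed.

Variable I : functional U c.
Let vC : slab_smooth O' (fun p => vder I (Phi p)).
Proof. by have [] := vderP I PhiF. Qed.

Let vder_line s x : (fun t : R => vder I (Phi (iota s + t *: delta)) x) =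
  (fun e : R => vder I (fun y => phi s y + e *: X s y) x).
Proof. by apply/funext => e; rewrite ext_family_line. Qed.

Lemma dvderE s x : O s ->
  is_derive (iota s) delta (fun p => vder I (Phi p) x) (dvder I (phi s) (X s) x).
Proof.
move=> Os; have H := slab_derive1 x delta vC (O'iota Os).
suff -> : dvder I (phi s) (X s) x = 'D_delta (fun p => vder I (Phi p) x) (iota s) by [].
move: H => /is_derive_line0; rewrite vder_line => -[_ <-].
by [].
Qed.

Lemma dvder_smooth : slab_smooth O (fun s => dvder I (phi s) (X s)).
Proof.
apply: (@slab_smooth_eq _ _ _ oO _ (fun s x =>
  'D_delta (fun p => vder I (Phi p) x) (iota s))).
  by move=> s x Os; have [_ ->] := dvderE x Os.
have := slab_smooth_derive1 oO' delta vC.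
apply: (@smooth_affine R ('rV[R]_k * R)%type ('rV[R]_(k + 1) * R)%type _ _ _ _
  (fun p => (iota p.1, p.2)) (fun p => (iota p.1, p.2))).
- exact: open_slab.
- by apply: continuous_pair_slab; exact: continuous_row_mx0.
- by move=> [z a] [v b] h; rewrite /= iotaZ.
- by move=> [s x] [/= Os _]; split=> //; exact: O'iota.
Qed.

Lemma dvder_ends : equal_ends O (fun s => dvder I (phi s) (X s)).
Proof.
have vE : equal_ends O' (fun p => vder I (Phi p)) by have [] := vderP I PhiF.
move=> s Os; have [A HA] := equal_ends_derive1 delta vE (O'iota Os).
exists A; near=> t => x y xA yA.
have Ot : O t by near: t; exact: open_nbhs_nbhs.
have [_ <-] := dvderE x Ot; have [_ <-] := dvderE y Ot.
move: x y xA yA; near: t.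
exact: (@continuous_row_mx0 R k 1 s _ HA).
Unshelve. all: by end_near. Qed.

Lemma fval_perturb s : O s ->
  is_derive (0 : R) (1 : R) (fun e => fval I (fun y => phi s y + e *: X s y))
    (integral (fun x => dot (vder I (phi s) x) (X s x))).
Proof.
move=> Os; have [_ _ /(_ _ delta (O'iota Os))] := vderP I PhiF.
rewrite Phi0 => /is_derive_line0.
rewrite (_ : (fun t : R => fval I (Phi (iota s + t *: delta))) =
  (fun e => fval I (fun y => phi s y + e *: X s y))); last first.
  by apply/funext => e; rewrite ext_family_line.
move=> H; apply: (is_derive_eq H); congr Defs.integral; apply/funext => x; congr (dot _ _).
have [_ <-] // : is_derive (iota s) delta (fun p => Phi p x) (X s x).
apply/is_derive_epsP => e e0; exists 1 => // h _.
by rewrite ext_family_line Phi0 [phi s x + _]addrC addrK subrr normr0 mulr_ge0// ltW.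
Qed.

End directional.

(** Mixed second derivatives of [fval I] along the family [phi + e w], in the directions [v] and
    [e], coincide. Neither [w] nor [D_v phi] depends on the parameter used for the second
    differentiation of its pairing or on [e], so that only [vder I] gets differentiated. *)
Lemma hessian_symmetric (I : functional U c) k (O : set 'rV[R]_k)
    (phi : 'rV[R]_k -> R -> 'rV[R]_N) (w : R -> 'rV[R]_N) s v :
  field_family U c O phi -> smooth setT w -> (exists A : R, forall x, A <= `|x| -> w x = 0) ->
  O s ->
  integral (fun x => dot ('D_v (fun t => vder I (phi t) x) s) (w x)) =
  integral (fun x => dot (dvder I (phi s) w x) ('D_v (fun t => phi t x) s)).
Proof.
move=> phiF wC [A wA] Os.
have [oO phiC _ _] := phiF.
have XC : slab_smooth O (fun=> w).
  apply: (@smooth_affine R ('rV[R]_k * R)%type R _ _ setT w snd snd) wC => //.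
    exact: open_slab.
  by move=> p; exact: cvg_snd.
have XS : locally_supported O (fun=> w) by move=> t _; exists A; near=> t'.
pose Phi := ext_family phi (fun=> w); pose O' := ext_domain U O phi (fun=> w).
have PhiF : field_family U c O' Phi := ext_family_field oU phiF XC XS.
have [oO' PhiC _ _] := PhiF.
pose iota (s : 'rV[R]_k) : 'rV[R]_(k + 1) := row_mx s 0.
pose delta : 'rV[R]_(k + 1) := row_mx 0 (const_mx 1).
have O's : O' (iota s).
  split; first by rewrite /= row_mxKl.
  move=> x; rewrite /ext_family row_mxKl row_mxEr mxE scale0r addr0.
  by have [_ _ pU _] := phiF; exact: pU.
have Phi0 t : Phi (iota t) = phi t.
  by apply/funext => x; rewrite /Phi /ext_family row_mxKl row_mxEr mxE scale0r addr0.
have [vC vE vD] := vderP I PhiF.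
have vC' : slab_smooth O' (fun p => vder I (Phi p)) := vC.
have dphiC := slab_smooth_derive1 oO v phiC.
have O'O p : O' p -> O (lsubmx p) by case.
have dphiC' : slab_smooth O' (fun p x => 'D_v (fun t => phi t x) (lsubmx p)).
  apply/slab_smooth_rV => // j.
  have := (slab_smooth_rV _ oO).1 dphiC j.
  move=> /(slab_smooth_lsubmx oO); apply: smooth_subset => -[p x] [/= Op _].
  by split=> //; exact: O'O.
have dphiS := field_family_derive_supported v phiF.
have dphiS' : locally_supported O' (fun p x => 'D_v (fun t => phi t x) (lsubmx p)).
  move=> p /O'O /dphiS[B HB]; exists B.
  exact: (continuous_lsubmx HB).
have wC' : slab_smooth O' (fun=> w).
  apply: (@smooth_affine R ('rV[R]_(k + 1) * R)%type R _ _ setT w snd snd) wC => //.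
    exact: open_slab.
  by move=> p; exact: cvg_snd.
have wS' : locally_supported O' (fun=> w) by move=> t _; exists A; near=> t'.
have PhiD p z x : O' p -> is_derive p z (fun q => Phi q x)
    ('D_(lsubmx z) (fun t => phi t x) (lsubmx p) + z 0 (rshift k ord0) *: w x).
  move=> Op; apply: is_deriveD.
    apply: (is_derive_lsubmx (f := fun t => phi t x)).
    exact: (slab_derive1 _ _ phiC (O'O _ Op)).
  apply/is_derive_epsP => e e0; exists 1 => // h _.
  by rewrite !mxE scalerDl [X in X - _]addrAC subrr add0r scalerA subrr normr0 mulr_ge0// ltW.
(* Integrands of the first variations of [I] in the directions [v] and [e]. *)
pose g1 (p : 'rV[R]_(k + 1)) x := dot (vder I (Phi p) x) ('D_v (fun t => phi t x) (lsubmx p)).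
pose g2 (p : 'rV[R]_(k + 1)) x := dot (vder I (Phi p) x) (w x).
have g1C : slab_smooth O' g1 by exact: slab_smooth_dot.
have g2C : slab_smooth O' g2 by exact: slab_smooth_dot.
have g1S : locally_supported O' g1 by exact: locally_supported_dotr.
have g2S : locally_supported O' g2 by exact: locally_supported_dotr.
have E1 p : O' p -> is_derive p (iota v) (fun q => fval I (Phi q)) (integral (g1 p)).
  move=> Op; apply: is_derive_eq (vD p (iota v) Op) _.
  congr Defs.integral; apply/funext => x; congr (dot _ _).
  by have [_ ->] := PhiD p (iota v) x Op; rewrite row_mxKl row_mxEr mxE scale0r addr0.
have E2 p : O' p -> is_derive p delta (fun q => fval I (Phi q)) (integral (g2 p)).
  move=> Op; apply: is_derive_eq (vD p delta Op) _.
  congr Defs.integral; apply/funext => x; congr (dot _ _).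
  have [_ ->] := PhiD p delta x Op.
  by rewrite row_mxKl row_mxEr mxE scale1r derive0 add0r.
have E12 p : O' p -> is_derive p delta (fun q => integral (g1 q))
    (integral (fun x => 'D_delta (fun q => g1 q x) p)).
  by move=> Op; exact: (integral_derive oO').
have E21 p : O' p -> is_derive p (iota v) (fun q => integral (g2 q))
    (integral (fun x => 'D_(iota v) (fun q => g2 q x) p)).
  by move=> Op; exact: (integral_derive oO').
have C12 : {for iota s, continuous (fun p => integral (fun x => 'D_delta (fun q => g1 q x) p))}.
  apply: smooth_continuous O's; apply: (integral_smooth oO').
    exact: slab_smooth_derive1.
  exact: locally_supported_derive1.
have C21 : {for iota s, continuous (fun p => integral (fun x => 'D_(iota v) (fun q => g2 q x) p))}.
  apply: smooth_continuous O's; apply: (integral_smooth oO').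
    exact: slab_smooth_derive1.
  exact: locally_supported_derive1.
have nO' : nbhs (iota s) O' by apply: open_nbhs_nbhs.
have := derive_commute_near nO' E1 E2 E12 E21 C12 C21.
rewrite (_ : (fun x => 'D_delta (fun q => g1 q x) (iota s)) =
  (fun x => dot (dvder I (phi s) w x) ('D_v (fun t => phi t x) s))); last first.
  apply/funext => x.
  have d1 := dvderE phiF XC XS I x Os.
  have d2 : is_derive (iota s) delta (fun q => 'D_v (fun t => phi t x) (lsubmx q)) 0.
    apply: (is_derive_lsubmx (f := fun t => 'D_v (fun t' => phi t' x) t)).
    have -> : lsubmx delta = 0 by rewrite row_mxKl.
    exact: is_derive0.
  have [_ ->] := is_derive_dot d1 d2.
  by rewrite dot0r addr0 row_mxKl.
rewrite (_ : (fun x => 'D_(iota v) (fun q => g2 q x) (iota s)) =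
  (fun x => dot ('D_v (fun t => vder I (phi t) x) s) (w x))); last first.
  apply/funext => x.
  have d1 := slab_derive1 x (iota v) vC' O's.
  have [_ ->] := is_derive_dot d1 (is_derive_cst (w x) (iota s) (iota v)).
  rewrite dot0r addr0; congr (dot _ (w x)).
  have d3 : is_derive s v (fun t => vder I (Phi (iota t)) x)
      ('D_(iota v) (fun p => vder I (Phi p) x) (iota s)).
    exact: (is_derive_row_mx0 (f := fun p => vder I (Phi p) x)).
  have E : (fun t => vder I (Phi (iota t)) x) = (fun t => vder I (phi t) x).
    by apply/funext => t; rewrite Phi0.
  by move: d3; rewrite E => -[_ ->].
by move=> ->.
Unshelve. all: by end_near. Qed.

End functionals.

(** * Hessians and flows of hydrodynamic type *)

Section pointwise_algebra.
Context {R : realType} {N L : nat}.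
Variables (eta : 'M[R]_N) (mu : 'M[R]_L) (H : 'I_L -> 'M[R]_N).
Hypotheses (eta_sym : eta^T = eta) (H_sym : forall m, (H m)^T = H m).

Lemma sym_entry n (M : 'M[R]_n) i j : M^T = M -> M i j = M j i.
Proof. by move=> sM; rewrite -[in LHS]sM mxE. Qed.

(** The hypothesis says that [H m eta H n] equals its transpose, which is [H n eta H m]. *)
Lemma hessians_commute :
  (forall a b k l, \sum_i \sum_j eta i j * (H a i k * H b j l - H a i l * H b j k) = 0) ->
  forall m n, H m *m eta *m H n = H n *m eta *m H m.
Proof.
move=> eqe m n.
have E : H m *m eta *m H n = (H m *m eta *m H n)^T.
  apply/matrixP => k l; apply/eqP; rewrite -subr_eq0; apply/eqP.
  rewrite [X in _ - X]mxE [X in X - _]mxE [X in _ - X]mxE -[RHS](eqe m n k l).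
  under eq_bigr do rewrite mxE mulr_suml.
  under [X in _ - X]eq_bigr do rewrite mxE mulr_suml.
  rewrite -sumrB exchange_big; apply: eq_bigr => i _; rewrite -sumrB; apply: eq_bigr => j _.
  by rewrite (sym_entry k j (H_sym m)) (sym_entry l j (H_sym m)); ring.
by rewrite E !trmx_mul eta_sym !H_sym mulmxA.
Qed.

Let h m (p x : 'rV[R]_N) := \sum_i \sum_k p 0 i * x 0 k * H m i k.

Let dot_h m (x xi : 'rV[R]_N) : dot (x *m (H m *m eta)) xi = h m (xi *m eta) x.
Proof.
rewrite mulmxA dot_mulmx eta_sym dot_mulmx H_sym dotC.
rewrite /dot /h; under eq_bigr do rewrite mxE mulr_suml.
rewrite exchange_big; apply: eq_bigr => i _; apply: eq_bigr => k _.
by rewrite mulrAC.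
Qed.

(** Both sides expand into sums over [i, j, k, l] weighted by [p_i q_j x_k y_l] with [p = xi eta]
    and [q = ze eta]. Their difference contracts exactly the expression that the hypothesis
    annihilates. *)
Lemma quadratic_swap_entries :
  (forall i j k l, \sum_a \sum_b mu a b * (H a i k * H b j l - H a i l * H b j k) = 0) ->
  forall x y xi ze : 'rV[R]_N,
  \sum_m \sum_n mu m n * (dot (x *m (H m *m eta)) xi * dot (y *m (H n *m eta)) ze) =
  \sum_m \sum_n mu m n * (dot (y *m (H m *m eta)) xi * dot (x *m (H n *m eta)) ze).
Proof.
move=> eqm x y xi ze.
under eq_bigr do under eq_bigr do rewrite !dot_h.
under [RHS]eq_bigr do under eq_bigr do rewrite !dot_h.
set p := xi *m eta; set q := ze *m eta.
have E x' y' m n : h m p x' * h n q y' =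
    \sum_i \sum_j \sum_k \sum_l p 0 i * q 0 j * (x' 0 k * y' 0 l) * (H m i k * H n j l).
  rewrite /h mulr_suml; apply: eq_bigr => i _.
  rewrite mulr_sumr; apply: eq_bigr => j _.
  rewrite mulr_suml; apply: eq_bigr => k _.
  by rewrite mulr_sumr; apply: eq_bigr => l _; ring.
have E2 m n : h m p y * h n q x =
    \sum_i \sum_j \sum_k \sum_l p 0 i * q 0 j * (x 0 k * y 0 l) * (H m i l * H n j k).
  rewrite E; apply: eq_bigr => i _; apply: eq_bigr => j _.
  by rewrite exchange_big; apply: eq_bigr => k _; apply: eq_bigr => l _; ring.
apply/eqP; rewrite -subr_eq0 -sumrB; apply/eqP.
transitivity (\sum_i \sum_j \sum_k \sum_l p 0 i * q 0 j * (x 0 k * y 0 l) *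
    (\sum_m \sum_n mu m n * (H m i k * H n j l - H m i l * H n j k))); last first.
  by do 4!(apply: big1 => ? _); rewrite eqm mulr0.
have E3 m n : mu m n * (h m p x * h n q y) - mu m n * (h m p y * h n q x) =
    \sum_i \sum_j \sum_k \sum_l p 0 i * q 0 j * (x 0 k * y 0 l) *
      (mu m n * (H m i k * H n j l - H m i l * H n j k)).
  rewrite -mulrBr E E2 -sumrB mulr_sumr; apply: eq_bigr => i _.
  rewrite -sumrB mulr_sumr; apply: eq_bigr => j _.
  rewrite -sumrB mulr_sumr; apply: eq_bigr => k _.
  by rewrite -sumrB mulr_sumr; apply: eq_bigr => l _; ring.
under eq_bigr do rewrite -sumrB.
under eq_bigr do under eq_bigr do rewrite E3.
rewrite pair_big /=.
rewrite exchange_big; apply: eq_bigr => i _.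
rewrite exchange_big; apply: eq_bigr => j _.
rewrite exchange_big; apply: eq_bigr => k _.
rewrite exchange_big; apply: eq_bigr => l _.
by rewrite pair_big /= mulr_sumr.
Qed.

End pointwise_algebra.

(** * The matrices of the flows and their pointwise identities *)

Section geometry.
Context {R : realType} {N L : nat}.
Variables (eta : 'M[R]_N) (mu : 'M[R]_L) (D : set 'rV[R]_N) (psi : 'I_L -> 'rV[R]_N -> R).
Hypotheses (eta_sym : eta^T = eta) (D_open : open D).
Hypothesis psi_smooth : forall n, smooth D (psi n).
Hypothesis eq_mu : forall u, D u -> forall i j k l : 'I_N,
      \sum_(a < L) \sum_(b < L) mu a b *
        (partial2 i k (psi a) u * partial2 j l (psi b) u
         - partial2 i l (psi a) u * partial2 j k (psi b) u) = 0.
Hypothesis eq_eta : forall u, D u -> forall (a b : 'I_L) (k l : 'I_N),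
      \sum_(i < N) \sum_(j < N) eta i j *
        (partial2 i k (psi a) u * partial2 j l (psi b) u
         - partial2 i l (psi a) u * partial2 j k (psi b) u) = 0.

Definition hess m (z : 'rV[R]_N) : 'M[R]_N := \matrix_(i, j) partial2 i j (psi m) z.
Definition grad (f : 'rV[R]_N -> R) (z : 'rV[R]_N) : 'rV[R]_N := \row_s partial s f z.
(** Vectors are rows and matrices act from the right, so, both factors being symmetric, this is the
    transpose of the matrix [eta^{is} psi_{sj}] of the flow. *)
Definition affinor m z := hess m z *m eta.

Lemma hessE m z i j : hess m z i j = partial2 i j (psi m) z.
Proof. exact: mxE. Qed.

Lemma affinorE m z : affinor m z = hess m z *m eta.
Proof. by []. Qed.

#[local] Opaque hess partial2.

Lemma hess_sym m z : D z -> (hess m z)^T = hess m z.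
Proof.
move=> Dz; apply/matrixP => i j; rewrite mxE !hessE.
exact: (smooth_derive_commute (delta_mx 0 i) (delta_mx 0 j) D_open (psi_smooth m) Dz).
Qed.

Let hess_minor a b z i j k l : hess a z i k * hess b z j l - hess a z i l * hess b z j k =
  partial2 i k (psi a) z * partial2 j l (psi b) z - partial2 i l (psi a) z * partial2 j k (psi b) z.
Proof.
exact (congr2 (fun x y => x - y) (congr2 *%R (hessE a z i k) (hessE b z j l))
  (congr2 *%R (hessE a z i l) (hessE b z j k))).
Qed.

Lemma hess_commute m n z : D z -> hess m z *m eta *m hess n z = hess n z *m eta *m hess m z.
Proof.
move=> Dz.
have eqe a b k l : \sum_i \sum_j eta i j *
    (hess a z i k * hess b z j l - hess a z i l * hess b z j k) = 0.
  rewrite -[RHS](eq_eta Dz a b k l).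
  apply: eq_bigr => i _; apply: eq_bigr => j _.
  exact (congr1 (fun x => eta i j * x) (hess_minor a b z i j k l)).
exact: (hessians_commute eta_sym (fun o => hess_sym o Dz) eqe m n).
Qed.

Lemma affinor_commute m n z : D z -> affinor m z *m affinor n z = affinor n z *m affinor m z.
Proof.
move=> Dz; have := hess_commute m n Dz; rewrite /affinor.
by move: (hess m z) (hess n z) => A B E; rewrite !mulmxA E.
Qed.

Lemma hess_swap z i j k l : D z ->
  \sum_a \sum_b mu a b * (hess a z i k * hess b z j l) =
  \sum_a \sum_b mu a b * (hess a z i l * hess b z j k).
Proof.
move=> Dz; apply/eqP; rewrite -subr_eq0 -sumrB; apply/eqP; rewrite -[RHS](eq_mu Dz i j k l).
apply: eq_bigr => a _; rewrite -sumrB; apply: eq_bigr => b _; rewrite -mulrBr.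
exact (congr1 (fun x => mu a b * x) (hess_minor a b z i j k l)).
Qed.

Lemma quadratic_swap z (x y xi ze : 'rV[R]_N) : D z ->
  \sum_m \sum_n mu m n * (dot (x *m affinor m z) xi * dot (y *m affinor n z) ze) =
  \sum_m \sum_n mu m n * (dot (y *m affinor m z) xi * dot (x *m affinor n z) ze).
Proof.
move=> Dz.
have eqm i j k l : \sum_a \sum_b mu a b *
    (hess a z i k * hess b z j l - hess a z i l * hess b z j k) = 0.
  rewrite -[RHS](eq_mu Dz i j k l).
  apply: eq_bigr => a _; apply: eq_bigr => b _.
  exact (congr1 (fun x => mu a b * x) (hess_minor a b z i j k l)).
exact (quadratic_swap_entries eta_sym (fun o => hess_sym o Dz) eqm x y xi ze).
Qed.

Lemma hydro_flowE m u x : D (u x) ->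
  hydro_flow eta (psi m) u x = derive1 u x *m affinor m (u x).
Proof.
move=> Du; apply/rowP => i; rewrite mxE /affinor mulmxA mxE.
apply: eq_bigr => s _; rewrite mxE mulr_suml; apply: eq_bigr => j _.
rewrite (sym_entry i s eta_sym) -(hessE m (u x) s j) (sym_entry s j (hess_sym m Du)); ring.
Qed.

Lemma const_opE u xi x : const_op eta u xi x = derive1 xi x *m eta.
Proof.
apply/rowP => i; rewrite !mxE; apply: eq_bigr => j _.
by rewrite mulrC (sym_entry i j eta_sym).
Qed.

Lemma smooth_comp_rV (E : normedModType R) (A : set E) (B : set 'rV[R]_N) (G : E -> 'rV[R]_N) (f : 'rV[R]_N -> R) :
  open A -> open B -> smooth A G -> (forall x, A x -> B (G x)) -> smooth B f ->
  smooth A (fun x => f (G x)).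
Proof.
move=> oA oB GC AB fC.
apply: (@smooth_comp R E 'rV[R]_N N A B f (fun j => delta_mx 0 j) (fun j x => G x 0 j)) => //.
- move=> z z'; apply/rowP => j; rewrite mxE summxE (bigD1 j)//= !mxE !eqxx mulr1.
  rewrite big1 ?addr0; first by rewrite addrC subrK.
  by move=> i ij; rewrite !mxE eqxx/= eq_sym (negPf ij) mulr0.
- by move=> j; exact: (smooth_rV _ oA).1.
Qed.

Lemma is_derive_comp_rV (E : normedModType R) (A : set E) (B : set 'rV[R]_N) (G : E -> 'rV[R]_N) (f : 'rV[R]_N -> R) x v :
  open A -> open B -> smooth A G -> A x -> B (G x) -> smooth B f ->
  is_derive x v (fun x => f (G x)) (dot ('D_v G x) (grad f (G x))).
Proof.
move=> oA oB GC Ax BG fC.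
have GE z z' : G z' = G z + \sum_i (G z' 0 i - G z 0 i) *: delta_mx 0 i.
  apply/rowP => j; rewrite mxE summxE (bigD1 j)//= !mxE !eqxx mulr1.
  rewrite big1 ?addr0; first by rewrite addrC subrK.
  by move=> i ij; rewrite !mxE eqxx/= eq_sym (negPf ij) mulr0.
have GjC j : smooth A (fun x => G x 0 j) by exact: (smooth_rV _ oA).1.
have H := smooth_derive_comp v oB GE BG fC Ax GjC.
apply: (is_derive_eq H); apply: eq_bigr => j _.
have [_ ->] := (is_derive_rV _ _ _ _).1 (smooth_derivable v GC Ax) j.
by congr (_ * _); rewrite [RHS]mxE.
Qed.

End geometry.

#[local] Opaque hess affinor.

(** * Functions with equal values near both ends *)

Section ends.
Context {R : realType}.

Definition eq_ends (V : Type) (f : R -> V) :=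
  exists A : R, forall x y : R, A <= `|x| -> A <= `|y| -> f x = f y.

Lemma eq_ends2 (V W X : Type) (op : V -> W -> X) f g : eq_ends f -> eq_ends g ->
  eq_ends (fun x => op (f x) (g x)).
Proof.
move=> [A fA] [B gB]; exists (Num.max A B) => x y.
by rewrite !ge_max => /andP[xA xB] /andP[yA yB]; rewrite (fA x y)// (gB x y).
Qed.

Lemma eq_ends_map (V W : Type) (h : V -> W) f : eq_ends f -> eq_ends (fun x => h (f x)).
Proof. by move=> [A fA]; exists A => x y xA yA; rewrite (fA x y). Qed.

Lemma eq_ends_sum (I : Type) (r : seq I) (f : I -> R -> R) :
  (forall i, eq_ends (f i)) -> eq_ends (fun x => \sum_(i <- r) f i x).
Proof.
move=> fE; elim: r => [|i r IH].
  by exists 0 => x y _ _; rewrite !big_nil.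
have [A H] := eq_ends2 +%R (fE i) IH.
by exists A => x y xA yA; rewrite !big_cons; exact: H.
Qed.

(** Beyond the support [dinv f] is plus or minus half the integral of [f], and the sign cancels in a
    product of two. This is where the skew normalisation of [d^{-1}] is essential. *)
Lemma eq_ends_dinvM (f g : R -> R) : compactly_supported f -> compactly_supported g ->
  eq_ends (fun x => dinv f x * dinv g x).
Proof.
move=> cf cg; have [A [_ _ fA]] := support_enlarge 0 cf.
have [C [_ AC gC]] := support_enlarge A cg.
have fC x : C <= `|x| -> f x = 0 by move=> Cx; apply: fA; exact: le_trans Cx.
suff E x : C <= `|x| -> dinv f x * dinv g x = (integral f / 2) * (integral g / 2).
  by exists C => x y /E -> /E ->.
rewrite ler_normr !dinvE// => /orP[Cx|Cx].
  by rewrite !(primitive_right _ _ Cx)//; lra.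
rewrite lerNr in Cx.
by rewrite (primitive_left fC)// (primitive_left gC)//; lra.
Qed.

Lemma integral_eq_derive (F1 F2 Z : R -> R) :
  compactly_supported F1 -> compactly_supported F2 ->
  (forall x, is_derive (x : R) (1 : R) Z (F1 x - F2 x)) -> eq_ends Z ->
  integral F1 = integral F2.
Proof.
move=> c1 c2 dZ ZE; apply/eqP; rewrite -subr_eq0 -integralB//; apply/eqP.
apply: (integral_derive0 dZ) => //.
by have [] := compactly_supportedB c1 c2.
Qed.

End ends.

(** * Vector-valued functions of parameter and position *)

Section slab_vectors.
Context {R : realType} (E : normedModType R) (O : set E).
Hypothesis oO : open O.

Lemma slab_smooth_of_x (F : normedModType R) (f : R -> F) :
  smooth setT f -> slab_smooth O (fun=> f).
Proof.
apply: (@smooth_affine R (E * R)%type R _ _ setT f snd snd) => //.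
  exact: open_slab.
by move=> p; exact: cvg_snd.
Qed.

Lemma is_derive_mulmxr (F : normedModType R) m n (f : F -> 'rV[R]_m) (M : 'M[R]_(m, n)) x v d :
  is_derive x v f d -> is_derive x v (fun y => f y *m M) (d *m M).
Proof.
move=> /is_derive_rV fd; apply/is_derive_rV => j.
rewrite mxE (_ : (fun t => _) = fun t => \sum_i f t 0 i * M i j); last first.
  by apply/funext => t; rewrite mxE.
apply: is_derive_sum_fun => i.
have := is_derive_mul (fd i) (is_derive_cst (M i j) x v).
by rewrite mulr0 addr0.
Qed.

Lemma smooth_mulmxr (F : normedModType R) (A : set F) m n (f : F -> 'rV[R]_m)
    (M : F -> 'M[R]_(m, n)) : open A -> smooth A f ->
  (forall i j, smooth A (fun x => M x i j)) -> smooth A (fun x => f x *m M x).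
Proof.
move=> oA /(smooth_rV _ oA) fC MC; apply/smooth_rV => // j.
apply: (@smooth_eq _ _ _ _ (fun x => \sum_i f x 0 i * M x i j)) => //.
  by move=> x _; rewrite mxE.
by apply: smooth_sum => // i; exact: smoothM.
Qed.

Lemma smooth_scale (F : normedModType R) (A : set F) m (k : F -> R) (f : F -> 'rV[R]_m) :
  open A -> smooth A k -> smooth A f -> smooth A (fun x => k x *: f x).
Proof.
move=> oA kC /(smooth_rV _ oA) fC; apply/smooth_rV => // j.
apply: (@smooth_eq _ _ _ _ (fun x => k x * f x 0 j)) => //.
  by move=> x _; rewrite mxE.
exact: smoothM.
Qed.

Lemma smooth_addv (F : normedModType R) (A : set F) m (f g : F -> 'rV[R]_m) :
  open A -> smooth A f -> smooth A g -> smooth A (fun x => f x + g x).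
Proof.
move=> oA /(smooth_rV _ oA) fC /(smooth_rV _ oA) gC; apply/smooth_rV => // j.
apply: (@smooth_eq _ _ _ _ (fun x => f x 0 j + g x 0 j)) => //.
  by move=> x _; rewrite mxE.
exact: smoothD.
Qed.

Lemma smooth_sumv (F : normedModType R) (A : set F) m (I : Type) (r : seq I) (f : I -> F -> 'rV[R]_m) :
  open A -> (forall i, smooth A (f i)) -> smooth A (fun x => \sum_(i <- r) f i x).
Proof.
move=> oA fC; apply/smooth_rV => // j.
apply: (@smooth_eq _ _ _ _ (fun x => \sum_(i <- r) f i x 0 j)) => //.
  by move=> x _; rewrite summxE.
by apply: smooth_sum => // i; exact: (smooth_rV _ oA).1.
Qed.

Lemma smooth_derivable2 m (X : E -> R -> 'rV[R]_m) s x : slab_smooth O X -> O s ->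
  forall j, derive1 (X s) x 0 j = derive1 (fun y => X s y 0 j) x.
Proof.
move=> XC Os j; have := slab_derive2 x XC Os.
by move=> /is_derive_rV /(_ j)[_ <-]; rewrite derive1E.
Qed.

Lemma slab_derive1_coord m (X : E -> R -> 'rV[R]_m) s x v j : slab_smooth O X -> O s ->
  ('D_v (fun t => X t x) s) 0 j = 'D_v (fun t => X t x 0 j) s.
Proof.
move=> XC Os.
have [_ H] := (is_derive_rV _ _ _ _).1 (slab_derive1 x v XC Os) j.
exact (esym H).
Qed.

Lemma slab_derive_commute_rV m (X : E -> R -> 'rV[R]_m) s x v : slab_smooth O X -> O s ->
  'D_v (fun t => derive1 (X t) x) s = derive1 (fun y => 'D_v (fun t => X t y) s) x.
Proof.
move=> XC Os; apply/rowP => j.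
have XjC : slab_smooth O (fun s x => X s x 0 j) by exact: (slab_smooth_rV _ oO).1.
apply: (etrans (slab_derive1_coord x v j (slab_smooth_derive2 oO XC) Os)).
apply: (@etrans _ _ ('D_v (fun t => derive1 (fun y => X t y 0 j) x) s)).
  apply: near_eq_derive; near=> t; apply: smooth_derivable2 => //.
  by near: t; exact: open_nbhs_nbhs.
apply: (etrans (slab_derive_commute oO x v XjC Os)).
apply: (etrans _ (esym (smooth_derivable2 x (slab_smooth_derive1 oO v XC) Os j))).
congr (derive1 _ x); apply/funext => y.
exact (esym (slab_derive1_coord y v j XC Os)).
Unshelve. all: by end_near. Qed.

Lemma locally_supported_derive2 (F : normedModType R) (X : E -> R -> F) : equal_ends O X ->
  locally_supported O (fun s x => derive1 (X s) x).
Proof.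
move=> XE s Os; have [A HA] := XE s Os; exists (A + 1); apply: filterS HA => t H x xA.
rewrite derive1E -[RHS](derive_cst (X t x) x (1 : R)); apply: near_eq_derive.
near=> y; apply: H; last by rewrite (le_trans _ xA)// lerDl.
have H1 : `|y - x| < 1 by near: y; apply: (@near_dist R R x 1).
have := lerB_dist x y; rewrite distrC => H2; lra.
Unshelve. all: by end_near. Qed.

Lemma equal_ends_supported (F : normedModType R) (X : E -> R -> F) :
  locally_supported O X -> equal_ends O X.
Proof.
move=> XS s Os; have [A HA] := XS s Os; exists A; apply: filterS HA => t H x y xA yA.
by rewrite !H.
Qed.

Lemma equal_ends_at (V : Type) (X : E -> R -> V) s : equal_ends O X -> O s -> eq_ends (X s).
Proof. by move=> XE Os; have [A /nbhs_singleton HA] := XE s Os; exists A. Qed.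

Lemma equal_ends2 (V W X : Type) (op : V -> W -> X) (f : E -> R -> V) (g : E -> R -> W) :
  equal_ends O f -> equal_ends O g -> equal_ends O (fun s x => op (f s x) (g s x)).
Proof.
move=> fE gE s Os; have [A HA] := fE s Os; have [B HB] := gE s Os.
exists (Num.max A B); near=> t => x y; rewrite !ge_max => /andP[xA xB] /andP[yA yB].
congr (op _ _).
  by move: x y xA yA xB yB; near: t; apply: filterS HA => t H x y xA yA _ _; exact: H.
by move: x y xA yA xB yB; near: t; apply: filterS HB => t H x y _ _ xA yA; exact: H.
Unshelve. all: by end_near. Qed.

Lemma locally_supported2 (F G H : normedModType R) (op : F -> G -> H) (X : E -> R -> F) (Y : E -> R -> G) :
  op 0 0 = 0 -> locally_supported O X -> locally_supported O Y ->
  locally_supported O (fun s x => op (X s x) (Y s x)).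
Proof.
move=> op0 XS YS s Os; have [A HA] := XS s Os; have [B HB] := YS s Os.
exists (Num.max A B); near=> t => x; rewrite !ge_max => /andP[xA xB].
rewrite -op0; congr (op _ _).
  by move: x xA xB; near: t; apply: filterS HA => t H' x xA _; exact: H'.
by move: x xA xB; near: t; apply: filterS HB => t H' x _ xA; exact: H'.
Unshelve. all: by end_near. Qed.

Lemma locally_supported_map (F G : normedModType R) (h : R -> E -> F -> G) (X : E -> R -> F) :
  (forall x s, h x s 0 = 0) -> locally_supported O X ->
  locally_supported O (fun s x => h x s (X s x)).
Proof.
move=> h0 XS; apply: (locally_supported_filter (X := X)) XS => t x ->.
exact: h0.
Qed.

Lemma locally_supported_sumv m (I : Type) (r : seq I) (X : I -> E -> R -> 'rV[R]_m) :
  (forall i, locally_supported O (X i)) ->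
  locally_supported O (fun s x => \sum_(i <- r) X i s x).
Proof.
move=> XS; elim: r => [|i r IH] s Os.
  by exists 0; near=> t => x _; rewrite big_nil.
have [A HA] := @locally_supported2 _ _ _ +%R _ _ (addr0 0) (XS i) IH s Os.
by exists A; apply: filterS HA => t H x xA; rewrite big_cons; exact: H.
Unshelve. all: by end_near. Qed.

End slab_vectors.

(** * The pencil of operators *)

Section operator.
Context {R : realType} {N L : nat}.
Variables (eta : 'M[R]_N) (mu : 'M[R]_L) (D : set 'rV[R]_N) (psi : 'I_L -> 'rV[R]_N -> R).
Hypothesis D_open : open D.
Hypothesis psi_smooth : forall n, smooth D (psi n).
Variables (a b : R).

Local Notation V := (affinor eta psi).

Definition potential m (z : 'rV[R]_N) : 'rV[R]_N := grad (psi m) z *m eta.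
Definition hflow m (u : R -> 'rV[R]_N) (x : R) : 'rV[R]_N := derive1 u x *m V m (u x).
Definition moment n (u xi : R -> 'rV[R]_N) (x : R) : R := dot (hflow n u x) (xi x).
(** [a M_1 + b M_2], with the sums over components and one factor [eta] moved under [d^{-1}]. *)
Definition pencil (u xi : R -> 'rV[R]_N) (x : R) : 'rV[R]_N :=
  a *: (\sum_m \sum_n (mu m n * dinv (moment n u xi) x) *: hflow m u x)
  + b *: (derive1 xi x *m eta).

Lemma hess_smooth (E : normedModType R) (A : set E) (G : E -> 'rV[R]_N) m i j :
  open A -> smooth A G -> (forall x, A x -> D (G x)) ->
  smooth A (fun x => hess psi m (G x) i j).
Proof.
move=> oA GC AD.
apply: (@smooth_eq _ _ _ _ (fun x => partial i (partial j (psi m)) (G x))) => //.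
  by move=> x _; rewrite hessE.
apply: (smooth_comp_rV (f := partial i (partial j (psi m))) oA D_open GC AD).
exact: smooth_derive (smooth_derive _ (psi_smooth m)).
Qed.

Lemma affinor_smooth (E : normedModType R) (A : set E) (G : E -> 'rV[R]_N) m i j :
  open A -> smooth A G -> (forall x, A x -> D (G x)) ->
  smooth A (fun x => V m (G x) i j).
Proof.
move=> oA GC AD.
apply: (@smooth_eq _ _ _ _ (fun x => \sum_k hess psi m (G x) i k * eta k j)) => //.
  by move=> x _; rewrite affinorE [RHS]mxE.
apply: smooth_sum => // k; apply: smoothM => //; last exact: smooth_cst.
exact: hess_smooth.
Qed.

Lemma grad_smooth (E : normedModType R) (A : set E) (B : set 'rV[R]_N) (G : E -> 'rV[R]_N) f :
  open A -> open B -> smooth A G -> (forall x, A x -> B (G x)) -> smooth B f ->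
  smooth A (fun x => grad f (G x)).
Proof.
move=> oA oB GC AB fC; apply/smooth_rV => // j.
apply: (@smooth_eq _ _ _ _ (fun x => partial j f (G x))) => //.
  by move=> x _; rewrite [RHS]mxE.
exact: (smooth_comp_rV (f := partial j f) oA oB GC AB (smooth_derive _ fC)).
Qed.

Lemma potential_smooth (E : normedModType R) (A : set E) (G : E -> 'rV[R]_N) m :
  open A -> smooth A G -> (forall x, A x -> D (G x)) -> smooth A (fun x => potential m (G x)).
Proof.
move=> oA GC AD.
apply: (smooth_mulmxr (M := fun=> eta)) => //; last by move=> i j; exact: smooth_cst.
exact: grad_smooth GC AD (psi_smooth m).
Qed.

Lemma is_derive_potential (E : normedModType R) (A : set E) (G : E -> 'rV[R]_N) m x v :
  open A -> smooth A G -> A x -> D (G x) ->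
  is_derive x v (fun x => potential m (G x)) ('D_v G x *m V m (G x)).
Proof.
move=> oA GC Ax DG; rewrite affinorE mulmxA; apply: is_derive_mulmxr.
apply/is_derive_rV => j.
have H := is_derive_comp_rV v oA D_open GC Ax DG (smooth_derive (delta_mx 0 j) (psi_smooth m)).
rewrite (_ : (fun t => _) = fun x => 'D_(delta_mx 0 j) (psi m) (G x)); last first.
  by apply/funext => t; rewrite [LHS]mxE.
apply: (is_derive_eq H); rewrite [RHS]mxE; apply: eq_bigr => i _.
by congr (_ * _); rewrite hessE [LHS]mxE.
Qed.

Lemma hflowE u x m : smooth setT u -> (forall x, D (u x)) ->
  derive1 (fun y => potential m (u y)) x = hflow m u x.
Proof.
move=> uC uD; rewrite derive1E.
by have [_ ->] := is_derive_potential m (1 : R) openT uC (I : setT x) (uD x); rewrite /hflow derive1E.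
Qed.

Section family.
Variables (U : set 'rV[R]_N) (c : 'rV[R]_N) (k : nat) (O : set 'rV[R]_k)
  (phi : 'rV[R]_k -> R -> 'rV[R]_N).
Hypotheses (UD : U `<=` D) (phiF : field_family U c O phi).
Let oO : open O. Proof. by case: phiF. Qed.
Let phiC : slab_smooth O phi. Proof. by case: phiF. Qed.
Let phiD s x : O s -> D (phi s x).
Proof. by move=> Os; apply: UD; case: phiF => _ _ pU _; exact: pU. Qed.
Let phi_smooth s : O s -> smooth setT (phi s).
Proof. by move=> Os; have [] := family_field phiF Os. Qed.
Let phiE : equal_ends O phi.
Proof.
move=> s Os; have [_ _ _ /(_ s Os)[A HA]] := phiF; exists A.
by apply: filterS HA => t H x y xA yA; rewrite !H.
Qed.

Let potential_slab m : slab_smooth O (fun s x => potential m (phi s x)).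
Proof.
apply: (potential_smooth m (open_slab oO) phiC).
by move=> [s x] [/= Os _]; exact: phiD.
Qed.

Lemma hflow_slab m : slab_smooth O (fun s => hflow m (phi s)).
Proof.
apply: (slab_smooth_eq oO _ (slab_smooth_derive2 oO (potential_slab m))) => s x Os.
by rewrite hflowE//; [exact: phi_smooth|move=> y; exact: phiD].
Qed.

Lemma hflow_supported m : locally_supported O (fun s => hflow m (phi s)).
Proof.
apply: (locally_supported_filter (z := 0) (X := fun s x => derive1 (phi s) x)).
  by move=> t x E; rewrite /hflow E mul0mx.
exact: locally_supported_derive2.
Qed.

Definition hflow_shift m s v x := 'D_v (fun t => phi t x) s *m V m (phi s x).

Lemma hflow_shiftE m s v x : O s ->
  'D_v (fun t => potential m (phi t x)) s = hflow_shift m s v x.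
Proof.
move=> Os.
have := @is_derive_potential _ _ _ m (s, x) (v, 0 : R) (open_slab oO) phiC (conj Os I) (phiD x Os).
move=> /(is_derive_slab1 (fun s x => potential m (phi s x)))[_ ->].
by rewrite /hflow_shift -(slab_derive1E x v phiC Os).
Qed.

Lemma hflow_shift_slab m v : slab_smooth O (fun s => hflow_shift m s v).
Proof.
apply: (slab_smooth_eq oO _ (slab_smooth_derive1 oO v (potential_slab m))) => s x Os.
exact: hflow_shiftE.
Qed.

Lemma hflow_shift_supported m v : locally_supported O (fun s => hflow_shift m s v).
Proof.
apply: (locally_supported_filter (z := 0) (X := fun s x => 'D_v (fun t => phi t x) s)).
  by move=> t x E; rewrite /hflow_shift E mul0mx.
exact: field_family_derive_supported phiF.
Qed.

(** The flow is the x-derivative of [potential m], so its parameter derivative is the x-derivative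
    of the parameter derivative of the potential. No third derivatives of [psi] have to be written
    down. *)
Lemma hflow_derive m s v x : O s ->
  is_derive s v (fun t => hflow m (phi t) x) (derive1 (hflow_shift m s v) x).
Proof.
move=> Os; have := slab_derive1 x v (hflow_slab m) Os; set d := 'D_v _ s.
suff -> : d = derive1 (hflow_shift m s v) x by [].
apply: (@etrans _ _ ('D_v (fun t => derive1 (fun y => potential m (phi t y)) x) s)).
  apply: near_eq_derive; near=> t.
  have Ot : O t by near: t; exact: open_nbhs_nbhs.
  by rewrite hflowE//; [exact: phi_smooth|move=> y; exact: phiD].
apply: (etrans (slab_derive_commute_rV oO x v (potential_slab m) Os)).
by congr (derive1 _ x); apply/funext => y; exact: hflow_shiftE.
Unshelve. all: by end_near. Qed.

Section covector.
Variable xi : 'rV[R]_k -> R -> 'rV[R]_N.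
Hypotheses (xiC : slab_smooth O xi) (xiE : equal_ends O xi).

Lemma moment_slab n : slab_smooth O (fun s => moment n (phi s) (xi s)).
Proof. exact (slab_smooth_dot oO (hflow_slab n) xiC). Qed.

Lemma moment_supported n : locally_supported O (fun s => moment n (phi s) (xi s)).
Proof. exact (locally_supported_dotl xi (hflow_supported n)). Qed.

Lemma moment_compact n s : O s -> compactly_supported (moment n (phi s) (xi s)).
Proof. exact: (slab_compactly_supported oO (moment_slab n) (moment_supported n)). Qed.

Lemma pencil_slab : slab_smooth O (fun s => pencil (phi s) (xi s)).
Proof.
have oS := open_slab oO.
apply: smooth_addv => //.
  apply: smooth_scale => //; first exact: smooth_cst.
  apply: smooth_sumv => // m; apply: smooth_sumv => // n.
  apply: smooth_scale => //; last exact: hflow_slab.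
  apply: smoothM => //; first exact: smooth_cst.
  exact: (dinv_smooth oO (moment_slab n) (moment_supported n)).
apply: smooth_scale => //; first exact: smooth_cst.
apply: (smooth_mulmxr (M := fun=> eta)) => //; last by move=> i j; exact: smooth_cst.
exact: (slab_smooth_derive2 oO xiC).
Qed.

Lemma pencil_supported : locally_supported O (fun s => pencil (phi s) (xi s)).
Proof.
apply: (@locally_supported2 _ _ _ _ _ _ +%R _ _ (addr0 0)).
  apply: (@locally_supported_map _ _ _ _ _ (fun _ _ z => a *: z)).
    by move=> *; rewrite scaler0.
  apply: locally_supported_sumv => m; apply: locally_supported_sumv => n.
  apply: (@locally_supported_map _ _ _ _ _
    (fun x s z => (mu m n * dinv (moment n (phi s) (xi s)) x) *: z)).
    by move=> *; rewrite scaler0.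
  exact: hflow_supported.
apply: (@locally_supported_map _ _ _ _ _ (fun _ _ z => b *: (z *m eta))).
  by move=> *; rewrite mul0mx scaler0.
exact: locally_supported_derive2.
Qed.

Lemma moment_derive n s v x : O s ->
  is_derive s v (fun t => moment n (phi t) (xi t) x)
    (dot (derive1 (hflow_shift n s v) x) (xi s x)
     + dot (hflow n (phi s) x) ('D_v (fun t => xi t x) s)).
Proof.
move=> Os; apply: is_derive_dot; first exact: hflow_derive.
exact: slab_derive1.
Qed.

Definition moment_shift n s v x := 'D_v (fun t => moment n (phi t) (xi t) x) s.

Lemma moment_shift_compact n s v : O s -> compactly_supported (moment_shift n s v).
Proof.
exact: (slab_compactly_supported oO (slab_smooth_derive1 oO v (moment_slab n))
  (locally_supported_derive1 v (moment_supported n))).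
Qed.

End covector.
End family.
End operator.

(** * Derivative of the bracket *)

Section weighted_sums.
Context {R : realType} {L : nat} (mu : 'M[R]_L).

Definition msum (f : 'I_L -> 'I_L -> R) := \sum_m \sum_n mu m n * f m n.

Lemma eq_msum f g : (forall m n, f m n = g m n) -> msum f = msum g.
Proof. by move=> fg; apply: eq_bigr => m _; apply: eq_bigr => n _; rewrite fg. Qed.

Lemma msumD f g : msum f + msum g = msum (fun m n => f m n + g m n).
Proof.
rewrite /msum -big_split; apply: eq_bigr => m _; rewrite -big_split; apply: eq_bigr => n _.
by rewrite mulrDr.
Qed.

Lemma msumB f g : msum f - msum g = msum (fun m n => f m n - g m n).
Proof.
rewrite /msum -sumrB; apply: eq_bigr => m _; rewrite -sumrB; apply: eq_bigr => n _.
by rewrite mulrBr.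
Qed.

Lemma msumN f : msum (fun m n => - f m n) = - msum f.
Proof.
rewrite /msum -sumrN; apply: eq_bigr => m _; rewrite -sumrN; apply: eq_bigr => n _.
by rewrite mulrN.
Qed.

Lemma msum_swap f : mu^T = mu -> msum f = msum (fun m n => f n m).
Proof.
move=> mu_sym; rewrite /msum exchange_big; apply: eq_bigr => m _; apply: eq_bigr => n _.
by rewrite (sym_entry n m mu_sym).
Qed.

Lemma is_derive_msum (E : normedModType R) (f : 'I_L -> 'I_L -> E -> R) x v d :
  (forall m n, is_derive x v (f m n) (d m n)) ->
  is_derive x v (fun y => msum (fun m n => f m n y)) (msum d).
Proof.
by move=> fd; apply: is_derive_sum_fun => m; apply: is_derive_sum_fun => n.
Qed.

Lemma is_derive_scalel (E : normedModType R) (k : R) (f : E -> R) x v d :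
  is_derive x v f d -> is_derive x v (fun y => k * f y) (k * d).
Proof.
move=> fd; have := is_derive_mul (is_derive_cst k x v) fd.
by rewrite mul0r add0r.
Qed.

Lemma is_derive_addf (E F : normedModType R) (f g : E -> F) x v d d' :
  is_derive x v f d -> is_derive x v g d' -> is_derive x v (fun y => f y + g y) (d + d').
Proof. by move=> fd gd; apply: is_deriveD. Qed.

Lemma is_derive_subf (E F : normedModType R) (f g : E -> F) x v d d' :
  is_derive x v f d -> is_derive x v g d' -> is_derive x v (fun y => f y - g y) (d - d').
Proof. by move=> fd gd; apply: is_deriveB. Qed.

Lemma slab_smooth_msum (E : normedModType R) (O : set E) (f : 'I_L -> 'I_L -> E -> R -> R) :
  open O -> (forall m n, slab_smooth O (f m n)) ->
  slab_smooth O (fun s x => msum (fun m n => f m n s x)).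
Proof.
move=> oO fC; apply: slab_smooth_sum => // m; apply: slab_smooth_sum => // n.
by apply: slab_smoothM => //; exact: slab_smooth_cst.
Qed.

Lemma locally_supported_msum (E : normedModType R) (O : set E) (f : 'I_L -> 'I_L -> E -> R -> R) :
  (forall m n, locally_supported O (f m n)) ->
  locally_supported O (fun s x => msum (fun m n => f m n s x)).
Proof.
move=> fS; apply: locally_supported_sum => m; apply: locally_supported_sum => n.
exact (locally_supportedMl (fun _ _ => mu m n) (fS m n)).
Qed.

Lemma eq_ends_msum (f : 'I_L -> 'I_L -> R -> R) :
  (forall m n, eq_ends (f m n)) -> eq_ends (fun x => msum (fun m n => f m n x)).
Proof.
move=> fE; apply: eq_ends_sum => m; apply: eq_ends_sum => n.
exact: (eq_ends_map (fun z => mu m n * z)).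
Qed.

End weighted_sums.

(* [ring] up to opaque scalars: comparing the sums up to conversion is slow. *)
Ltac ring_scalars :=
  repeat match goal with
  | |- context [msum ?m ?f] => move: (msum m f) => ?
  | |- context [dot ?x ?y] => move: (dot x y) => ?
  end; ring.

Section bracket.
Context {R : realType} {N L : nat}.
Variables (eta : 'M[R]_N) (mu : 'M[R]_L) (D : set 'rV[R]_N) (psi : 'I_L -> 'rV[R]_N -> R).
Hypotheses (eta_sym : eta^T = eta) (mu_sym : mu^T = mu) (D_open : open D).
Hypothesis psi_smooth : forall n, smooth D (psi n).
Variables (a b : R).

Local Notation V := (affinor eta psi).
Local Notation flow := (hflow eta psi).
Local Notation mom := (moment eta psi).
Local Notation M := (pencil eta mu psi a b).

Lemma dot_eta_swap (x y : 'rV[R]_N) : dot x (y *m eta) = dot y (x *m eta).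
Proof. by rewrite dotC dot_mulmx eta_sym. Qed.

Lemma dot_pencil (u xi : R -> 'rV[R]_N) x (w : 'rV[R]_N) :
  dot w (M u xi x) =
  a * msum mu (fun m n => dinv (mom n u xi) x * dot (flow m u x) w)
  + b * dot w (derive1 xi x *m eta).
Proof.
rewrite /pencil dotDr !dotZr; congr (a * _ + _).
rewrite dot_sumr; apply: eq_bigr => m _; rewrite dot_sumr; apply: eq_bigr => n _.
by rewrite dotZr mulrA (dotC w).
Qed.

Section family.
Variables (U : set 'rV[R]_N) (c : 'rV[R]_N) (k : nat) (O : set 'rV[R]_k)
  (phi : 'rV[R]_k -> R -> 'rV[R]_N).
Hypotheses (UD : U `<=` D) (phiF : field_family U c O phi).
Let oO : open O. Proof. by case: phiF. Qed.
Variables xi ze : 'rV[R]_k -> R -> 'rV[R]_N.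
Hypotheses (xiC : slab_smooth O xi) (xiE : equal_ends O xi).
Hypotheses (zeC : slab_smooth O ze) (zeE : equal_ends O ze).

Lemma dot_pencil_slab : slab_smooth O (fun s x => dot (xi s x) (M (phi s) (ze s) x)).
Proof. exact (slab_smooth_dot oO xiC (pencil_slab eta mu D_open psi_smooth a b UD phiF zeC)). Qed.

Lemma dot_pencil_supported : locally_supported O (fun s x => dot (xi s x) (M (phi s) (ze s) x)).
Proof. exact (locally_supported_dotr xi (pencil_supported eta mu psi a b phiF zeE)). Qed.

Lemma dot_pencil_compact s : O s ->
  compactly_supported (fun x => dot (xi s x) (M (phi s) (ze s) x)).
Proof. exact (slab_compactly_supported oO dot_pencil_slab dot_pencil_supported). Qed.

End family.

Section bracket_formulas.
Variables (U : set 'rV[R]_N) (c : 'rV[R]_N) (k : nat) (O : set 'rV[R]_k)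
  (phi : 'rV[R]_k -> R -> 'rV[R]_N).
Hypotheses (UD : U `<=` D) (phiF : field_family U c O phi).
Let oO : open O. Proof. by case: phiF. Qed.
Variables xi ze : 'rV[R]_k -> R -> 'rV[R]_N.
Hypotheses (xiC : slab_smooth O xi) (xiE : equal_ends O xi).
Hypotheses (zeC : slab_smooth O ze) (zeE : equal_ends O ze).
Variable s : 'rV[R]_k.
Hypothesis Os : O s.

Let al m := mom m (phi s) (xi s).
Let be n := mom n (phi s) (ze s).
Let alc m : compactly_supported (al m).
Proof. exact: (moment_compact eta D_open psi_smooth UD phiF xiC m Os). Qed.
Let bec n : compactly_supported (be n).
Proof. exact: (moment_compact eta D_open psi_smooth UD phiF zeC n Os). Qed.

Let dot_M x : dot (xi s x) (M (phi s) (ze s) x) =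
  a * msum mu (fun m n => dinv (be n) x * al m x) + b * dot (xi s x) (derive1 (ze s) x *m eta).
Proof. exact: dot_pencil. Qed.

Let dot_M' x : dot (ze s x) (M (phi s) (xi s) x) =
  a * msum mu (fun m n => dinv (al n) x * be m x) + b * dot (ze s x) (derive1 (xi s) x *m eta).
Proof. exact: dot_pencil. Qed.

(** The two integrands add up to the derivative of [Z]. The nonlocal part uses the product rule for
    two antiderivatives and the symmetry of [mu], the local part the symmetry of [eta]. *)
Lemma bracket_skew : integral (fun x => dot (xi s x) (M (phi s) (ze s) x)) =
  - integral (fun x => dot (ze s x) (M (phi s) (xi s) x)).
Proof.
have c2 := dot_pencil_compact UD phiF zeC xiC xiE Os.
rewrite -integralN//.
pose Z x := a * msum mu (fun m n => dinv (be n) x * dinv (al m) x) + b * dot (xi s x) (ze s x *m eta).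
apply: (@integral_eq_derive _ _ _ Z).
- exact: (dot_pencil_compact UD phiF xiC zeC zeE Os).
- have := compactly_supportedZ (-1) c2; congr compactly_supported; apply/funext => x.
  by rewrite mulN1r.
- move=> x; rewrite opprK dot_M dot_M' (msum_swap (fun m n => dinv (al n) x * be m x) mu_sym).
  have H1 : is_derive x (1 : R) (fun x => msum mu (fun m n => dinv (be n) x * dinv (al m) x))
      (msum mu (fun m n => be n x * dinv (al m) x + dinv (be n) x * al m x)).
    apply: is_derive_msum => m n; apply: is_derive_mul; exact: is_derive_dinv.
  have H2 : is_derive x (1 : R) (fun x => dot (xi s x) (ze s x *m eta))
     (dot (derive1 (xi s) x) (ze s x *m eta) + dot (xi s x) (derive1 (ze s) x *m eta)).
    apply: is_derive_dot; first exact: (slab_derive2 x xiC Os).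
    by apply: is_derive_mulmxr; exact: (slab_derive2 x zeC Os).
  apply: (is_derive_eq (is_derive_addf (is_derive_scalel a H1) (is_derive_scalel b H2))).
  rewrite (dot_eta_swap (derive1 _ _)) -msumD.
  have -> : msum mu (fun m n => be n x * dinv (al m) x) = msum mu (fun m n => dinv (al m) x * be n x).
    by apply: eq_msum => m n; rewrite mulrC.
  ring_scalars.
apply: (eq_ends2 +%R).
  apply: (eq_ends_map (fun z => a * z)); apply: eq_ends_msum => m n.
  exact: eq_ends_dinvM.
apply: (eq_ends_map (fun z => b * z)).
exact (eq_ends2 (fun z w => dot z (w *m eta)) (equal_ends_at xiE Os) (equal_ends_at zeE Os)).
Qed.

Variable v : 'rV[R]_k.

Let dxi x := 'D_v (fun t => xi t x) s.
Let dze x := 'D_v (fun t => ze t x) s.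
Let T m := hflow_shift eta psi phi m s v.

(** The effect of varying [u] inside [M_1], where the flow changes by the x-derivative of [T m]. The
    second term comes from the flow under [d^{-1}], moved out by an integration by parts, hence the
    sign. *)
Definition bracket_variation_nonlocal x :=
  a * msum mu (fun m n => dinv (be n) x * dot (derive1 (T m) x) (xi s x)
                        - dinv (al n) x * dot (derive1 (T m) x) (ze s x)).

Let shift_slab m : slab_smooth O (fun s => derive1 (hflow_shift eta psi phi m s v)).
Proof.
exact: (slab_smooth_derive2 oO (hflow_shift_slab eta D_open psi_smooth UD phiF m v)).
Qed.

Let shift_supported m : locally_supported O (fun s => derive1 (hflow_shift eta psi phi m s v)).
Proof.
apply: locally_supported_derive2; apply: equal_ends_supported.
exact: (hflow_shift_supported eta psi phiF m v).
Qed.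

Lemma bracket_variation_nonlocal_compact : compactly_supported bracket_variation_nonlocal.
Proof.
apply: (slab_compactly_supported oO (g := fun s x => a * msum mu (fun m n =>
  dinv (mom n (phi s) (ze s)) x * dot (derive1 (hflow_shift eta psi phi m s v) x) (xi s x) -
  dinv (mom n (phi s) (xi s)) x * dot (derive1 (hflow_shift eta psi phi m s v) x) (ze s x)))) => //.
  apply: slab_smoothM => //; first exact: slab_smooth_cst.
  apply: slab_smooth_msum => // m n; apply: slab_smoothB => //; apply: slab_smoothM => //.
  - exact: (dinv_smooth oO (moment_slab eta D_open psi_smooth UD phiF zeC n)
      (moment_supported eta psi phiF ze n)).
  - exact: (slab_smooth_dot oO (shift_slab m) xiC).
  - exact: (dinv_smooth oO (moment_slab eta D_open psi_smooth UD phiF xiC n)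
      (moment_supported eta psi phiF xi n)).
  - exact: (slab_smooth_dot oO (shift_slab m) zeC).
apply: (locally_supportedMl (fun _ _ => a)); apply: locally_supported_msum => m n.
apply: (@locally_supported2 _ _ _ _ _ _ (fun x y => x - y)); first by rewrite subr0.
  apply: (locally_supportedMl (fun s x => dinv (mom n (phi s) (ze s)) x)).
  exact: (locally_supported_dotl xi (shift_supported m)).
apply: (locally_supportedMl (fun s x => dinv (mom n (phi s) (xi s)) x)).
exact: (locally_supported_dotl ze (shift_supported m)).
Qed.

Lemma dot_dxi_compact : compactly_supported (fun x => dot (dxi x) (M (phi s) (ze s) x)).
Proof.
exact: (dot_pencil_compact UD phiF (slab_smooth_derive1 oO v xiC) zeC zeE Os).
Qed.

Lemma dot_dze_compact : compactly_supported (fun x => dot (dze x) (M (phi s) (xi s) x)).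
Proof.
exact: (dot_pencil_compact UD phiF (slab_smooth_derive1 oO v zeC) xiC xiE Os).
Qed.

(** The derivative of the integrand differs from the integrands on the right by the derivative of
    [Z]. This is the primitive used for skewness, with [ze] and its moments replaced by their
    variations. *)
Lemma bracket_derive :
  is_derive s v (fun t => integral (fun x => dot (xi t x) (M (phi t) (ze t) x)))
    (integral (fun x => dot (dxi x) (M (phi s) (ze s) x))
     - integral (fun x => dot (dze x) (M (phi s) (xi s) x))
     + integral bracket_variation_nonlocal).
Proof.
have gC := dot_pencil_slab UD phiF xiC zeC; have gS := dot_pencil_supported phiF xi zeE.
apply: (is_derive_eq (integral_derive oO v gC gS Os)).
have c1 := dot_dxi_compact; have c2 := dot_dze_compact.
have c3 := bracket_variation_nonlocal_compact.
have c12 := compactly_supportedB c1 c2.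
rewrite -integralB// -integralD//.
pose sh n := moment_shift eta psi phi ze n s v.
pose sh' n := moment_shift eta psi phi xi n s v.
have shc n : compactly_supported (sh n) by exact: (moment_shift_compact eta D_open psi_smooth UD phiF zeC).
have dC := slab_smooth_derive1 oO v zeC.
pose Z x := a * msum mu (fun m n => dinv (sh n) x * dinv (al m) x) + b * dot (xi s x) (dze x *m eta).
apply: (@integral_eq_derive _ _ _ Z).
- exact: (slab_compactly_supported oO (slab_smooth_derive1 oO v gC) (locally_supported_derive1 v gS) Os).
- exact: compactly_supportedD.
- move=> x.
  have H1 : is_derive x (1 : R) (fun x => msum mu (fun m n => dinv (sh n) x * dinv (al m) x))
      (msum mu (fun m n => sh n x * dinv (al m) x + dinv (sh n) x * al m x)).
    apply: is_derive_msum => m n; apply: is_derive_mul; exact: is_derive_dinv.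
  have H2 : is_derive x (1 : R) (fun x => dot (xi s x) (dze x *m eta))
     (dot (derive1 (xi s) x) (dze x *m eta) + dot (xi s x) (derive1 dze x *m eta)).
    apply: is_derive_dot; first exact: (slab_derive2 x xiC Os).
    by apply: is_derive_mulmxr; exact: (slab_derive2 x dC Os).
  apply: (is_derive_eq (is_derive_addf (is_derive_scalel a H1) (is_derive_scalel b H2))).
  have H3 : is_derive s v (fun t => dot (xi t x) (M (phi t) (ze t) x))
      (a * msum mu (fun m n => dinv (sh n) x * al m x + dinv (be n) x * sh' m x)
       + b * (dot (dxi x) (derive1 (ze s) x *m eta) + dot (xi s x) (derive1 dze x *m eta))).
    rewrite (_ : (fun t => _) = fun t => a * msum mu (fun m n =>
      dinv (mom n (phi t) (ze t)) x * mom m (phi t) (xi t) x)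
      + b * dot (xi t x) (derive1 (ze t) x *m eta)); last first.
      by apply/funext => t; exact: dot_pencil.
    apply: is_derive_addf; apply: is_derive_scalel.
      apply: is_derive_msum => m n; apply: is_derive_mul.
        exact: (dinv_derive1 oO x v (moment_slab eta D_open psi_smooth UD phiF zeC n)
          (moment_supported eta psi phiF ze n) Os).
      exact: (slab_derive1 x v (moment_slab eta D_open psi_smooth UD phiF xiC m) Os).
    apply: is_derive_dot; first exact: (slab_derive1 x v xiC Os).
    apply: is_derive_mulmxr.
    rewrite -(slab_derive_commute_rV oO x v zeC Os).
    exact: (slab_derive1 x v (slab_smooth_derive2 oO zeC) Os).
  have [_ ->] := H3.
  have shE n : sh n x = dot (derive1 (T n) x) (ze s x) + dot (flow n (phi s) x) (dze x).
    by have [_] := moment_derive eta D_open psi_smooth UD phiF zeC n v x Os.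
  have shE' n : sh' n x = dot (derive1 (T n) x) (xi s x) + dot (flow n (phi s) x) (dxi x).
    by have [_] := moment_derive eta D_open psi_smooth UD phiF xiC n v x Os.
  rewrite !dot_pencil /bracket_variation_nonlocal.
  rewrite (dot_eta_swap (derive1 (xi s) x) (dze x)) -!msumD !msumN.
  have -> : msum mu (fun m n => dinv (be n) x * sh' m x) =
      msum mu (fun m n => dinv (be n) x * dot (derive1 (T m) x) (xi s x)) +
      msum mu (fun m n => dinv (be n) x * dot (flow m (phi s) x) (dxi x)).
    by rewrite msumD; apply: eq_msum => m n; rewrite shE' mulrDr.
  have -> : msum mu (fun m n => sh n x * dinv (al m) x) =
      msum mu (fun m n => dinv (al n) x * dot (derive1 (T m) x) (ze s x)) +
      msum mu (fun m n => dinv (al n) x * dot (flow m (phi s) x) (dze x)).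
    rewrite msumD (msum_swap _ mu_sym); apply: eq_msum => m n.
    by rewrite shE mulrC mulrDr.
  rewrite -/(be _) -/(al _); ring_scalars.
apply: (eq_ends2 +%R).
  apply: (eq_ends_map (fun z => a * z)); apply: eq_ends_msum => m n.
  exact: eq_ends_dinvM.
apply: (eq_ends_map (fun z => b * z)).
exact (eq_ends2 (fun z w => dot z (w *m eta)) (equal_ends_at xiE Os)
  (equal_ends_at (equal_ends_derive1 v zeE) Os)).
Qed.

End bracket_formulas.
End bracket.

(** * The bracket as a functional *)

Section bracket_functional.
Context {R : realType} {N L : nat}.
Variables (eta : 'M[R]_N) (mu : 'M[R]_L) (D : set 'rV[R]_N) (psi : 'I_L -> 'rV[R]_N -> R).
Hypotheses (eta_sym : eta^T = eta) (mu_sym : mu^T = mu) (D_open : open D).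
Hypothesis psi_smooth : forall n, smooth D (psi n).
Variables (a b : R).

Local Notation V := (affinor eta psi).
Local Notation flow := (hflow eta psi).
Local Notation mom := (moment eta psi).
Local Notation M := (pencil eta mu psi a b).
Variables (U : set 'rV[R]_N) (c : 'rV[R]_N).
Hypotheses (oU : open U) (UD : U `<=` D).

(** The x-derivative of [d^{-1}<w_n, ze> xi - d^{-1}<w_n, xi> ze]: what the shift [T m] of the
    potential is paired with once its x-derivative has been integrated by parts. *)
Definition theta n (u xi ze : R -> 'rV[R]_N) (x : R) : 'rV[R]_N :=
  (mom n u ze x *: xi x + dinv (mom n u ze) x *: derive1 xi x)
  + (-1) *: (mom n u xi x *: ze x + dinv (mom n u xi) x *: derive1 ze x).

Definition correction (u xi ze : R -> 'rV[R]_N) (x : R) : 'rV[R]_N :=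
  \sum_m \sum_n mu m n *: (theta n u xi ze x *m (V m (u x))^T).

Lemma eq_ends_zero (f : R -> R) : (exists A : R, forall x, A <= `|x| -> f x = 0) -> eq_ends f.
Proof. by move=> [A fA]; exists A => x y xA yA; rewrite !fA. Qed.

Lemma dot_correction u xi ze x (t : 'rV[R]_N) : dot (correction u xi ze x) t =
  msum mu (fun m n => dot (t *m V m (u x)) (theta n u xi ze x)).
Proof.
rewrite dot_suml; apply: eq_bigr => m _; rewrite dot_suml; apply: eq_bigr => n _.
by rewrite dotZl dot_mulmx trmxK dotC.
Qed.

Lemma is_derive_scalev (k : R -> R) (f : R -> 'rV[R]_N) (x dk : R) df :
  is_derive x (1 : R) k dk -> is_derive x (1 : R) f df ->
  is_derive x (1 : R) (fun y => k y *: f y) (dk *: f x + k x *: df).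
Proof.
move=> kd /is_derive_rV fd; apply/is_derive_rV => j.
rewrite !mxE (_ : (fun t => _) = fun t => k t * f t 0 j); last first.
  by apply/funext => t; rewrite mxE.
exact: is_derive_mul kd (fd j).
Qed.

Section family.
Variables (k : nat) (O : set 'rV[R]_k) (phi : 'rV[R]_k -> R -> 'rV[R]_N).
Hypothesis phiF : field_family U c O phi.
Let oO : open O. Proof. by case: phiF. Qed.
Let phiC : slab_smooth O phi. Proof. by case: phiF. Qed.
Let phiD s x : O s -> D (phi s x).
Proof. by move=> Os; apply: UD; case: phiF => _ _ pU _; exact: pU. Qed.

Section covectors.
Variables xi ze : 'rV[R]_k -> R -> 'rV[R]_N.
Hypotheses (xiC : slab_smooth O xi) (xiE : equal_ends O xi).
Hypotheses (zeC : slab_smooth O ze) (zeE : equal_ends O ze).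

Let half_slab (x1 x2 : 'rV[R]_k -> R -> 'rV[R]_N) n :
  slab_smooth O x1 -> slab_smooth O x2 ->
  slab_smooth O (fun s x => mom n (phi s) (x2 s) x *: x1 s x
    + dinv (mom n (phi s) (x2 s)) x *: derive1 (x1 s) x).
Proof.
move=> C1 C2; have oS := open_slab oO; apply: smooth_addv => //; apply: smooth_scale => //.
- exact (moment_slab eta D_open psi_smooth UD phiF C2 n).
- exact (dinv_smooth oO (moment_slab eta D_open psi_smooth UD phiF C2 n)
     (moment_supported eta psi phiF x2 n)).
- exact (slab_smooth_derive2 oO C1).
Qed.

Let half_supported (x1 x2 : 'rV[R]_k -> R -> 'rV[R]_N) n :
  equal_ends O x1 ->
  locally_supported O (fun s x => mom n (phi s) (x2 s) x *: x1 s x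
    + dinv (mom n (phi s) (x2 s)) x *: derive1 (x1 s) x).
Proof.
move=> E1; apply: (@locally_supported2 _ _ _ _ _ _ +%R _ _ (addr0 0)).
  apply: (locally_supported_filter (z := 0) (X := fun s => mom n (phi s) (x2 s))).
    by move=> t x ->; rewrite scale0r.
  exact: (moment_supported eta psi phiF x2 n).
apply: (@locally_supported_map _ _ _ _ _ (fun x s z => dinv (mom n (phi s) (x2 s)) x *: z)).
  by move=> *; rewrite scaler0.
exact: locally_supported_derive2.
Qed.

Lemma theta_slab n : slab_smooth O (fun s => theta n (phi s) (xi s) (ze s)).
Proof.
have oS := open_slab oO.
apply: smooth_addv => //; first exact (half_slab n xiC zeC).
apply: smooth_scale => //; first exact: smooth_cst.
exact (half_slab n zeC xiC).
Qed.

Lemma theta_supported n : locally_supported O (fun s => theta n (phi s) (xi s) (ze s)).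
Proof.
apply: (@locally_supported2 _ _ _ _ _ _ +%R _ _ (addr0 0)); first exact: half_supported.
apply: (@locally_supported_map _ _ _ _ _ (fun _ _ z => (-1) *: z)).
  by move=> *; rewrite scaler0.
exact: half_supported.
Qed.

Lemma correction_slab : slab_smooth O (fun s => correction (phi s) (xi s) (ze s)).
Proof.
have oS := open_slab oO.
apply: smooth_sumv => // m; apply: smooth_sumv => // n.
apply: smooth_scale => //; first exact: smooth_cst.
apply: (smooth_mulmxr (M := fun p => (V m (phi p.1 p.2))^T)) => //; first exact: theta_slab.
move=> i j; apply: (@smooth_eq _ _ _ _ (fun p => V m (phi p.1 p.2) j i)) => //.
  by move=> p _; rewrite [RHS]mxE.
apply: (affinor_smooth eta D_open psi_smooth m j i oS phiC).
by move=> [s x] [/= Os _]; exact: phiD.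
Qed.

Lemma correction_supported : locally_supported O (fun s => correction (phi s) (xi s) (ze s)).
Proof.
apply: locally_supported_sumv => m; apply: locally_supported_sumv => n.
apply: (@locally_supported_map _ _ _ _ _ (fun x s z => mu m n *: (z *m (V m (phi s x))^T))).
  by move=> *; rewrite mul0mx scaler0.
exact: theta_supported.
Qed.

Lemma nonlocal_by_parts s v : O s ->
  integral (bracket_variation_nonlocal eta mu psi a phi xi ze s v) =
  integral (fun x => - a * dot (correction (phi s) (xi s) (ze s) x) ('D_v (fun t => phi t x) s)).
Proof.
move=> Os.
have bvc := bracket_variation_nonlocal_compact eta mu D_open psi_smooth a UD phiF xiC zeC Os v.
have dphiC := slab_smooth_derive1 oO v phiC.
have dphiS := field_family_derive_supported v phiF.
pose T m := hflow_shift eta psi phi m s v.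
pose al m := mom m (phi s) (xi s).
pose be n := mom n (phi s) (ze s).
have alc m : compactly_supported (al m) by exact: (moment_compact eta D_open psi_smooth UD phiF xiC m Os).
have bec m : compactly_supported (be m) by exact: (moment_compact eta D_open psi_smooth UD phiF zeC m Os).
(* [Z] vanishes near both ends because [T m] contains the parameter derivative of the field, which
   has compact support. *)
pose Z x := a * msum mu (fun m n => dinv (be n) x * dot (T m x) (xi s x)
                                  - dinv (al n) x * dot (T m x) (ze s x)).
apply: (@integral_eq_derive _ _ _ Z) => //.
- apply: compactly_supportedZ.
  apply: (slab_compactly_supported oO (g := fun s x =>
    dot (correction (phi s) (xi s) (ze s) x) ('D_v (fun t => phi t x) s))) => //.
    exact (slab_smooth_dot oO correction_slab dphiC).
  exact (locally_supported_dotr (fun s => correction (phi s) (xi s) (ze s)) dphiS).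
- move=> x.
  have dT m : is_derive x (1 : R) (T m) (derive1 (T m) x).
    exact (slab_derive2 x (hflow_shift_slab eta D_open psi_smooth UD phiF m v) Os).
  have H m n : is_derive x (1 : R) (fun x => dinv (be n) x * dot (T m x) (xi s x)
                                  - dinv (al n) x * dot (T m x) (ze s x))
     ((be n x * dot (T m x) (xi s x) + dinv (be n) x *
        (dot (derive1 (T m) x) (xi s x) + dot (T m x) (derive1 (xi s) x))) -
      (al n x * dot (T m x) (ze s x) + dinv (al n) x *
        (dot (derive1 (T m) x) (ze s x) + dot (T m x) (derive1 (ze s) x)))).
    apply: is_derive_subf; (apply: is_derive_mul; first exact: is_derive_dinv).
      exact (is_derive_dot (dT m) (slab_derive2 x xiC Os)).
    exact (is_derive_dot (dT m) (slab_derive2 x zeC Os)).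
  have H0 := @is_derive_msum R L mu R _ x 1 _ H.
  apply: (is_derive_eq (is_derive_scalel a H0)).
  rewrite dot_correction mulNr opprK /bracket_variation_nonlocal -mulrDr; congr (a * _).
  rewrite msumD; apply: eq_msum => m n.
  rewrite -/(T m) -/(be n) -/(al n) -/(hflow_shift eta psi phi m s v x) -/(T m x) /theta.
  rewrite -/(be n) -/(al n) dotDr dotZr !dotDr !dotZr.
  ring_scalars.
apply: eq_ends_zero.
have [A /nbhs_singleton HA] := dphiS s Os; exists A => x xA.
rewrite /Z (_ : msum _ _ = msum mu (fun _ _ => 0)); last first.
  apply: eq_msum => m n; have -> : T m x = 0 by rewrite /T /hflow_shift HA// mul0mx.
  by rewrite !dot0l !mulr0 subr0.
by rewrite /msum big1 ?mulr0// => m _; rewrite big1// => n _; rewrite mulr0.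
Qed.

End covectors.
End family.

Section functionals.
Variables I J : functional U c.

(** Read off from [bracket_derive]: symmetry of the Hessians isolates the tangent vector in the
    first two terms, [nonlocal_by_parts] in the third. *)
Definition bracket_vder (u : R -> 'rV[R]_N) (x : R) : 'rV[R]_N :=
  dvder I u (M u (vder J u)) x + (-1) *: dvder J u (M u (vder I u)) x
  + (- a) *: correction u (vder I u) (vder J u) x.

Lemma bracket_vderP : has_variational_derivative U c (bracket M I J) bracket_vder.
Proof.
move=> k O phi phiF.
have [oO phiC pU pc] := phiF.
have [xiC xiE _] := vderP I phiF; have [zeC zeE _] := vderP J phiF.
set xi := fun s => vder I (phi s) in xiC xiE.
set ze := fun s => vder J (phi s) in zeC zeE.
have XIC : slab_smooth O (fun s => M (phi s) (xi s)).
  exact (pencil_slab eta mu D_open psi_smooth a b UD phiF (xiC : slab_smooth O xi)).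
have XJC : slab_smooth O (fun s => M (phi s) (ze s)).
  exact (pencil_slab eta mu D_open psi_smooth a b UD phiF (zeC : slab_smooth O ze)).
have XIS : locally_supported O (fun s => M (phi s) (xi s)).
  exact (pencil_supported eta mu psi a b phiF (xiE : equal_ends O xi)).
have XJS : locally_supported O (fun s => M (phi s) (ze s)).
  exact (pencil_supported eta mu psi a b phiF (zeE : equal_ends O ze)).
have dIC := dvder_smooth oU phiF XJC XJS I; have dJC := dvder_smooth oU phiF XIC XIS J.
have dIE := dvder_ends oU phiF XJC XJS I; have dJE := dvder_ends oU phiF XIC XIS J.
have cC := correction_slab phiF (xiC : slab_smooth O xi) (zeC : slab_smooth O ze).
have cS := correction_supported phiF (xiE : equal_ends O xi) (zeE : equal_ends O ze).
have oS := open_slab oO.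
split.
- apply: (smooth_addv oS).
    apply: (smooth_addv oS dIC); apply: (smooth_scale oS _ dJC); exact: smooth_cst.
  by apply: (smooth_scale oS _ cC); exact: smooth_cst.
- apply: (equal_ends2 (fun x y => x + (- a) *: y) _ (equal_ends_supported cS)).
  exact (equal_ends2 (fun x y => x + (-1) *: y) dIE dJE).
move=> s v Os.
apply: (is_derive_eq (bracket_derive eta_sym mu_sym D_open psi_smooth a b UD phiF xiC xiE zeC zeE Os v)).
have dphiC := slab_smooth_derive1 oO v phiC.
have dphiS := field_family_derive_supported v phiF.
have vsmooth (X : 'rV[R]_k -> R -> 'rV[R]_N) : slab_smooth O X -> smooth setT (X s).
  move=> XC; apply: (@smooth_affine R R ('rV[R]_k * R)%type 'rV[R]_N setT (O `*` setT)
    (fun p => X p.1 p.2) (fun x => (s, x)) (fun x => (0, x))) => //.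
  - exact: openT.
  - move=> x V' [[A B] /= [As Bx] AB]; apply: filterS Bx => y By.
    by apply: (AB (s, y)); split=> //; exact: nbhs_singleton As.
  - by move=> z w h; congr (_, _); rewrite /= scaler0 addr0.
have supp (X : 'rV[R]_k -> R -> 'rV[R]_N) : locally_supported O X -> exists A : R, forall x, A <= `|x| -> X s x = 0.
  by move=> /(_ s Os)[A /nbhs_singleton HA]; exists A.
have H1 := hessian_symmetric oU I v phiF (vsmooth _ XJC) (supp _ XJS) Os.
have H2 := hessian_symmetric oU J v phiF (vsmooth _ XIC) (supp _ XIS) Os.
have H3 := nonlocal_by_parts phiF (xiC : slab_smooth O xi) (zeC : slab_smooth O ze) v Os.
apply: (etrans (congr2 +%R (congr2 (fun p q => p - q) H1 H2) H3)).
have dotc (X : 'rV[R]_k -> R -> 'rV[R]_N) : slab_smooth O X ->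
    compactly_supported (fun x => dot (X s x) ('D_v (fun t => phi t x) s)).
  move=> XC; apply: (slab_compactly_supported oO (g := fun s x =>
    dot (X s x) ('D_v (fun t => phi t x) s))) => //.
    exact (slab_smooth_dot oO XC dphiC).
  exact (locally_supported_dotr X dphiS).
have c1 := dotc _ dIC; have c2 := dotc _ dJC; have c3 := compactly_supportedZ (- a) (dotc _ cC).
have c12 := compactly_supportedB c1 c2.
rewrite -integralB// -integralD//; apply: eq_integral => x.
rewrite /bracket_vder !dotDl !dotZl mulN1r.
by [].
Qed.

Lemma bracket_functional : exists K : functional U c, represents K (bracket M I J).
Proof. by exists (Functional bracket_vderP). Qed.

End functionals.
End bracket_functional.

(** * The Jacobi identity *)

(* As [ring_scalars], but abstracting syntactic occurrences only. *)
Ltac ring_atoms :=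
  repeat match goal with
  | |- context [msum ?m ?f] => generalize (msum m f); intro
  | |- context [dot ?x ?y] => generalize (dot x y); intro
  end; ring.

Section jacobi_sums.
Context {R : realType} {L : nat} (mu : 'M[R]_L).

Lemma msum_lin (a b : R) (f g : 'I_L -> 'I_L -> R) :
  msum mu (fun m n => a * f m n + b * g m n) = a * msum mu f + b * msum mu g.
Proof.
rewrite /msum !mulr_sumr -big_split; apply: eq_bigr => m _.
by rewrite /= !mulr_sumr -big_split; apply: eq_bigr => n _; rewrite /=; ring.
Qed.

(** Both sides are the bilinear form [Y] evaluated at the vectors [mu P] and [mu Q], in the two
    orders. *)
Let double_swap (P Q : 'I_L -> R) (Y : 'I_L -> 'I_L -> R) : (forall p m, Y p m = Y m p) ->
  msum mu (fun m n => P n * msum mu (fun p q => Q q * Y p m)) =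
  msum mu (fun m n => Q n * msum mu (fun p q => P q * Y p m)).
Proof.
move=> Ysym.
have E (P' Q' : 'I_L -> R) : msum mu (fun m n => P' n * msum mu (fun p q => Q' q * Y p m)) =
    \sum_m \sum_p (\sum_n mu m n * P' n) * (\sum_q mu p q * Q' q) * Y p m.
  apply: eq_bigr => m _.
  under eq_bigr do rewrite mulrA.
  rewrite -mulr_suml mulr_sumr; apply: eq_bigr => p _.
  rewrite -mulrA; congr (_ * _); rewrite mulr_suml; apply: eq_bigr => q _.
  by rewrite mulrA.
rewrite !E exchange_big; apply: eq_bigr => m _; apply: eq_bigr => p _.
by rewrite Ysym [X in X * _]mulrC.
Qed.

(** The part of the cyclic sum quadratic in [M_1], which vanishes without integration. In the
    application [A] is a moment and [P] its [d^{-1}], while [Y] and [Z] are [u_x V_p V_m] and its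
    x-derivative paired with a covector. The terms in [Z] cancel by [double_swap], those in [Y] by
    the three exchange hypotheses. *)
Lemma jacobi_cancellation (P1 P2 P3 A1 A2 A3 : 'I_L -> R) (Y1 Y2 Y3 Z1 Z2 Z3 : 'I_L -> 'I_L -> R) :
  (forall p m, Z1 p m = Z1 m p) -> (forall p m, Z2 p m = Z2 m p) ->
  (forall p m, Z3 p m = Z3 m p) ->
  (forall m, msum mu (fun p q => A3 q * Y1 p m) = msum mu (fun p q => A1 q * Y3 p m)) ->
  (forall m, msum mu (fun p q => A1 q * Y2 p m) = msum mu (fun p q => A2 q * Y1 p m)) ->
  (forall m, msum mu (fun p q => A2 q * Y3 p m) = msum mu (fun p q => A3 q * Y2 p m)) ->
  let W P A Y Z m := msum mu (fun p q => A q * Y p m + P q * Z p m) in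
  msum mu (fun m n => P2 n * W P3 A3 Y1 Z1 m - P1 n * W P3 A3 Y2 Z2 m) +
  msum mu (fun m n => P3 n * W P1 A1 Y2 Z2 m - P2 n * W P1 A1 Y3 Z3 m) +
  msum mu (fun m n => P1 n * W P2 A2 Y3 Z3 m - P3 n * W P2 A2 Y1 Z1 m) = 0.
Proof.
move=> s1 s2 s3 h31 h12 h23 W.
have WE P A Y Z m : W P A Y Z m = msum mu (fun p q => A q * Y p m) + msum mu (fun p q => P q * Z p m).
  by rewrite msumD.
pose K (P A : 'I_L -> R) Y := msum mu (fun m n => P n * msum mu (fun p q => A q * Y p m)).
have EW P P' A Y Z : msum mu (fun m n => P n * W P' A Y Z m) = K P A Y + K P P' Z.
  by rewrite /K msumD; apply: eq_msum => m n; rewrite WE mulrDr.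
have KE P A Y A' Y' : (forall m, msum mu (fun p q => A q * Y p m) = msum mu (fun p q => A' q * Y' p m)) ->
    K P A Y = K P A' Y' by move=> H; apply: eq_msum => m n; rewrite H.
rewrite -!msumB !EW (KE _ _ _ _ _ h31) (KE _ _ _ _ _ h12) (KE _ _ _ _ _ h23).
rewrite /K (double_swap P3 P2 s1) (double_swap P1 P3 s2) (double_swap P2 P1 s3).
ring_atoms.
Qed.

End jacobi_sums.

(** * Straight lines in the space of fields *)

Section flows.
Context {R : realType} {N : nat} (U : set 'rV[R]_N) (c : 'rV[R]_N).
Hypothesis oU : open U.

Lemma slab_smooth_xv (E : normedModType R) (F : normedModType R) (O : set E) (X : E -> R -> F) s :
  open O -> slab_smooth O X -> O s -> smooth setT (X s).
Proof.
move=> oO XC Os.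
apply: (@smooth_affine R R (E * R)%type F setT (O `*` setT)
  (fun p => X p.1 p.2) (fun x => (s, x)) (fun x => (0, x))) => //.
- exact: openT.
- move=> x V' [[A B] /= [As Bx] AB]; apply: filterS Bx => y By.
  by apply: (AB (s, y)); split=> //; exact: nbhs_singleton As.
- by move=> z w h; congr (_, _); rewrite /= scaler0 addr0.
Qed.

Variables (u X : R -> 'rV[R]_N).
Hypotheses (uF : field U c u) (XC : smooth setT X) (XS : exists A : R, forall x, A <= `|x| -> X x = 0).

(** The base family has no parameters, so the only one left is the coefficient of [X]. *)
Definition flow_line := ext_family (fun _ : 'rV[R]_0 => u) (fun=> X).
Definition flow_domain := ext_domain U [set: 'rV[R]_0] (fun=> u) (fun=> X).
Definition flow_origin : 'rV[R]_(0 + 1) := row_mx 0 0.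
Definition flow_direction : 'rV[R]_(0 + 1) := row_mx 0 (const_mx 1).

Let u0 := @const_family R N U c 0 u uF.
Let X0 : slab_smooth [set: 'rV[R]_0] (fun=> X).
Proof. by apply: slab_smooth_of_x => //; exact: openT. Qed.
Let XS0 : locally_supported [set: 'rV[R]_0] (fun=> X).
Proof. by move=> s _; have [A XA] := XS; exists A; near=> t. Unshelve. all: by end_near. Qed.

Lemma flow_line_family : field_family U c flow_domain flow_line.
Proof. exact: ext_family_field. Qed.

Lemma flow_line_origin : flow_line flow_origin = u.
Proof.
apply/funext => x; rewrite /flow_line /ext_family /flow_origin row_mxEr mxE.
by rewrite scale0r addr0.
Qed.

Lemma flow_origin_domain : flow_domain flow_origin.
Proof.
split=> // x; rewrite -/(flow_line flow_origin x) flow_line_origin.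
by have [_ uU _] := uF.
Qed.

Lemma flow_line_derive x :
  'D_flow_direction (fun p => flow_line p x) flow_origin = X x.
Proof.
have E := @ext_family_line R N 0 (fun=> u) (fun=> X).
have [_ ->] // : is_derive flow_origin flow_direction (fun p => flow_line p x) (X x).
apply/is_derive_epsP => e e0; exists 1 => // h _.
rewrite /flow_line /flow_origin E -/(flow_line flow_origin) flow_line_origin.
by rewrite [u x + _]addrC addrK subrr normr0 mulr_ge0// ltW.
Qed.

Lemma flow_vder_derive (I : functional U c) x :
  'D_flow_direction (fun p => vder I (flow_line p) x) flow_origin = dvder I u X x.
Proof. by have [_ ->] := dvderE oU u0 X0 XS0 I x (Logic.I : [set: 'rV[R]_0] 0). Qed.

Lemma flow_fval (I : functional U c) :
  is_derive (0 : R) (1 : R) (fun e => fval I (fun y => u y + e *: X y))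
    (integral (fun x => dot (vder I u x) (X x))).
Proof. exact: (fval_perturb oU u0 X0 XS0 I (Logic.I : [set: 'rV[R]_0] 0)). Qed.

Lemma flow_near : \forall e \near (0 : R), field U c (fun y => u y + e *: X y).
Proof. exact: (near_perturb oU u0 X0 XS0 (Logic.I : [set: 'rV[R]_0] 0)). Qed.

Lemma dvder_symmetric (I : functional U c) (Y : R -> 'rV[R]_N) :
  smooth setT Y -> (exists A : R, forall x, A <= `|x| -> Y x = 0) ->
  integral (fun x => dot (dvder I u X x) (Y x)) = integral (fun x => dot (dvder I u Y x) (X x)).
Proof.
move=> YC YS.
have H := hessian_symmetric oU I flow_direction flow_line_family YC YS flow_origin_domain.
rewrite flow_line_origin in H.
apply: (etrans _ (etrans H _)); apply: eq_integral => x.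
  by rewrite flow_vder_derive.
by rewrite flow_line_derive.
Qed.

End flows.

(** * Linearity, skewness and the Jacobi identity at a fixed field *)

Section hamiltonian.
Context {R : realType} {N L : nat}.
Variables (eta : 'M[R]_N) (mu : 'M[R]_L) (D : set 'rV[R]_N) (psi : 'I_L -> 'rV[R]_N -> R).
Hypotheses (eta_sym : eta^T = eta) (mu_sym : mu^T = mu) (D_open : open D).
Hypothesis psi_smooth : forall n, smooth D (psi n).
Variables (a b : R).

Local Notation V := (affinor eta psi).
Local Notation flow := (hflow eta psi).
Local Notation mom := (moment eta psi).
Local Notation M := (pencil eta mu psi a b).
Hypothesis eq_mu : forall u, D u -> forall i j k l : 'I_N,
      \sum_(a < L) \sum_(b < L) mu a b *
        (partial2 i k (psi a) u * partial2 j l (psi b) u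
         - partial2 i l (psi a) u * partial2 j k (psi b) u) = 0.
Hypothesis eq_eta : forall u, D u -> forall (a b : 'I_L) (k l : 'I_N),
      \sum_(i < N) \sum_(j < N) eta i j *
        (partial2 i k (psi a) u * partial2 j l (psi b) u
         - partial2 i l (psi a) u * partial2 j k (psi b) u) = 0.
Variables (U : set 'rV[R]_N) (c : 'rV[R]_N).
Hypotheses (oU : open U) (UD : U `<=` D).

(** [bracket_variation_nonlocal] with an arbitrary tangent vector [X] in place of a parameter
    derivative. *)
Let variation u xi ze (X : R -> 'rV[R]_N) x :=
  a * msum mu (fun m n => dinv (mom n u ze) x * dot (derive1 (fun y => X y *m V m (u y)) x) (xi x)
                        - dinv (mom n u xi) x * dot (derive1 (fun y => X y *m V m (u y)) x) (ze x)).

Section fixed_field.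
Variable u : R -> 'rV[R]_N.
Hypothesis uF : field U c u.

Let u0 := @const_family R N U c 0 u uF.
Let oT : open [set: 'rV[R]_0]. Proof. exact: openT. Qed.
Let uC : smooth setT u. Proof. by case: uF. Qed.
Let uD x : D (u x). Proof. by case: uF => _ uU _; exact: UD. Qed.

Let vC (I : functional U c) : slab_smooth [set: 'rV[R]_0] (fun=> vder I u).
Proof. by have [] := vderP I u0. Qed.
Let vE (I : functional U c) : equal_ends [set: 'rV[R]_0] (fun=> vder I u).
Proof. by have [] := vderP I u0. Qed.
Let vsm (I : functional U c) : smooth setT (vder I u).
Proof. exact: (slab_smooth_xv oT (vC I) (Logic.I : [set: 'rV[R]_0] 0)). Qed.

Lemma pencil_smooth (I : functional U c) : smooth setT (M u (vder I u)).
Proof.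
have := pencil_slab eta mu D_open psi_smooth a b UD u0 (vC I).
by move=> H; exact: (slab_smooth_xv oT H (Logic.I : [set: 'rV[R]_0] 0)).
Qed.

Lemma pencil_compact (I : functional U c) : exists A : R, forall x, A <= `|x| -> M u (vder I u) x = 0.
Proof.
have [A /nbhs_singleton HA] := pencil_supported eta mu psi a b u0 (vE I) (Logic.I : [set: 'rV[R]_0] 0).
by exists A.
Qed.

Let flow_smooth m : smooth setT (flow m u).
Proof.
exact: (slab_smooth_xv oT (hflow_slab eta D_open psi_smooth UD u0 m) (Logic.I : [set: 'rV[R]_0] 0)).
Qed.

Let momc n (I : functional U c) : compactly_supported (mom n u (vder I u)).
Proof. exact: (moment_compact eta D_open psi_smooth UD u0 (vC I) n (Logic.I : [set: 'rV[R]_0] 0)). Qed.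

Lemma bracket_skew_field (I J : functional U c) : bracket M I J u = - bracket M J I u.
Proof.
exact: (bracket_skew eta_sym mu_sym D_open psi_smooth a b UD u0 (vC I) (vE I) (vC J) (vE J)
  (Logic.I : [set: 'rV[R]_0] 0)).
Qed.

(** By skewness the bracket with [S] is minus the derivative of [fval S] along the fixed tangent
    vector [M (vder I)]. It depends on the values of [S] alone, and the variational derivatives
    themselves need not be compared. *)
Lemma bracket_linear (I J K S : functional U c) (k : R) :
  represents S (fun u => k * fval J u + fval K u) ->
  bracket M I S u = k * bracket M I J u + bracket M I K u.
Proof.
move=> SE; rewrite !(bracket_skew_field I) mulrN -opprD; congr (- _).
have dF T := flow_fval oU uF (pencil_smooth I) (pencil_compact I) T.
have H : is_derive (0 : R) (1 : R) (fun e => fval S (fun y => u y + e *: M u (vder I u) y))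
    (k * bracket M J I u + bracket M K I u).
  apply: near_eq_is_derive (is_derive_addf (is_derive_scalel k (dF J)) (dF K)).
  by apply: filterS (flow_near oU uF (pencil_smooth I) (pencil_compact I)) => e eF; rewrite SE.
exact: derive_unique (dF S) H.
Qed.

Let P (I : functional U c) n x := dinv (mom n u (vder I u)) x.
Let A (I : functional U c) n x := mom n u (vder I u) x.
(** [yv] and [kk] are the images under [V_m] of the nonlocal and of the local part of
    [M (vder I)]. *)
Let yv m p y := flow p u y *m V m (u y).
Let kk (I : functional U c) m y := (derive1 (vder I u) y *m eta) *m V m (u y).

Let affinor_comp_smooth m i j : smooth setT (fun x => V m (u x) i j).
Proof. exact: (affinor_smooth eta D_open psi_smooth m i j openT uC (fun x _ => uD x)). Qed.

Let yv_smooth m p : smooth setT (yv m p).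
Proof.
apply: (smooth_mulmxr (M := fun x => V m (u x))) => //; first exact: openT.
Qed.

Let dvsm (I : functional U c) : smooth setT (derive1 (vder I u)).
Proof.
apply: (smooth_eq openT _ (smooth_derive (1 : R) (vsm I))) => x _.
by rewrite derive1E.
Qed.

Let kk_smooth (I : functional U c) m : smooth setT (kk I m).
Proof.
apply: (smooth_mulmxr (M := fun x => V m (u x))) => //; first exact: openT.
apply: (smooth_mulmxr (M := fun=> eta)) => //; first exact: openT.
by move=> i j; exact: smooth_cst.
Qed.

Let smooth_d1 (f : R -> 'rV[R]_N) x : smooth setT f -> is_derive x (1 : R) f (derive1 f x).
Proof. by move=> fC; rewrite derive1E; exact: (smooth_derivable (1 : R) fC (Logic.I : setT x)). Qed.

Let shift_smooth (I : functional U c) m : smooth setT (fun y => M u (vder I u) y *m V m (u y)).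
Proof.
apply: (smooth_mulmxr (M := fun x => V m (u x))) => //; first exact: openT.
exact: pencil_smooth.
Qed.

Let dot_cst_derive (f : R -> 'rV[R]_N) x w : smooth setT f ->
  is_derive x (1 : R) (fun y => dot (f y) w) (dot (derive1 f x) w).
Proof.
move=> /(smooth_d1 x) fd; have := is_derive_dot fd (is_derive_cst w x (1 : R)).
by rewrite dot0r addr0.
Qed.

(** Both sides are x-derivatives of the same function, in which the vector [w] is held constant. *)
Let shift_dot (I : functional U c) m x w :
  dot (derive1 (fun y => M u (vder I u) y *m V m (u y)) x) w =
  a * msum mu (fun p q => A I q x * dot (yv m p x) w + P I q x * dot (derive1 (yv m p) x) w)
  + b * dot (derive1 (kk I m) x) w.
Proof.
have H1 := dot_cst_derive x w (shift_smooth I m).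
have E y : dot (M u (vder I u) y *m V m (u y)) w =
    a * msum mu (fun p q => P I q y * dot (yv m p y) w) + b * dot (kk I m y) w.
  rewrite dot_mulmx dotC dot_pencil; congr (a * _ + b * _).
    by apply: eq_msum => p q; rewrite /yv [in RHS]dot_mulmx.
  by rewrite /kk [in RHS]dot_mulmx dotC.
have H2 : is_derive x (1 : R) (fun y => a * msum mu (fun p q => P I q y * dot (yv m p y) w)
      + b * dot (kk I m y) w)
    (a * msum mu (fun p q => A I q x * dot (yv m p x) w + P I q x * dot (derive1 (yv m p) x) w)
     + b * dot (derive1 (kk I m) x) w).
  apply: is_derive_addf; apply: is_derive_scalel; last exact: dot_cst_derive.
  apply: is_derive_msum => p q; apply: is_derive_mul; last exact: dot_cst_derive.
  exact: is_derive_dinv.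
have EE : (fun y => dot (M u (vder I u) y *m V m (u y)) w) = (fun y =>
    a * msum mu (fun p q => P I q y * dot (yv m p y) w) + b * dot (kk I m y) w).
  by apply/funext.
by rewrite EE in H1; exact: derive_unique H1 H2.
Qed.

Let yv_sym m p : yv m p = yv p m.
Proof.
apply/funext => y.
have C := affinor_commute eta_sym D_open psi_smooth eq_eta p m (uD y).
have E (X : 'rV[R]_N) (Y Z : 'M[R]_N) : Y *m Z = Z *m Y -> X *m Y *m Z = X *m Z *m Y.
  by move=> YZ; rewrite -mulmxA YZ mulmxA.
exact (E _ _ _ C).
Qed.

(** Once [V_m] and [V_p] are interchanged, this is [quadratic_swap] with [x = u_x V_m] and
    [y = u_x]. *)
Let yv_swap (I J : functional U c) x m :
  msum mu (fun p q => A J q x * dot (yv m p x) (vder I u x)) =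
  msum mu (fun p q => A I q x * dot (yv m p x) (vder J u x)).
Proof.
have Q := quadratic_swap eta_sym D_open psi_smooth eq_mu (derive1 u x *m V m (u x))
  (derive1 u x) (vder I u x) (vder J u x) (uD x).
have E w p : dot (yv m p x) w = dot (derive1 u x *m V m (u x) *m V p (u x)) w.
  by rewrite yv_sym.
apply: (@etrans _ _ (msum mu (fun p q => dot (derive1 u x *m V m (u x) *m V p (u x)) (vder I u x)
    * dot (derive1 u x *m V q (u x)) (vder J u x)))).
  apply: eq_msum => p q; apply: (etrans (mulrC _ _)).
  exact (congr2 *%R (E (vder I u x) p) (erefl (A J q x))).
apply: (etrans Q); apply: (etrans (msum_swap _ mu_sym)).
apply: eq_msum => p q.
exact (congr2 *%R (erefl (A I q x)) (esym (E (vder J u x) p))).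
Qed.

(** The matrix [eta V_m = eta psi_m'' eta] is symmetric. *)
Let kk_sym (I J : functional U c) m x : dot (kk J m x) (derive1 (vder I u) x) = dot (kk I m x) (derive1 (vder J u) x).
Proof.
have S : (eta *m V m (u x))^T = eta *m V m (u x).
  by rewrite affinorE !trmx_mul eta_sym (hess_sym D_open psi_smooth m (uD x)) !mulmxA.
have E (X Y : 'rV[R]_N) (Z W : 'M[R]_N) : (Z *m W)^T = Z *m W ->
    dot (X *m Z *m W) Y = dot (Y *m Z *m W) X.
  by move=> ZW; rewrite -mulmxA dot_mulmx ZW dotC mulmxA.
exact (E _ _ _ _ S).
Qed.

(** [quadratic_swap] with [x] the vector [eta] makes of the x-derivative of [vder J], and
    [y = u_x]. *)
Let kk_quad (J I1 I2 : functional U c) x :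
  msum mu (fun m n => A I2 n x * dot (kk J m x) (vder I1 u x)) =
  msum mu (fun m n => A I1 n x * dot (kk J m x) (vder I2 u x)).
Proof.
have Q := quadratic_swap eta_sym D_open psi_smooth eq_mu (derive1 (vder J u) x *m eta)
  (derive1 u x) (vder I1 u x) (vder I2 u x) (uD x).
apply: (@etrans _ _ (msum mu (fun m n => dot (derive1 (vder J u) x *m eta *m V m (u x)) (vder I1 u x)
    * dot (derive1 u x *m V n (u x)) (vder I2 u x)))).
  by apply: eq_msum => p q; exact (mulrC _ _).
apply: (etrans Q); exact (msum_swap _ mu_sym).
Qed.

(** The [a ^ 2] part vanishes pointwise by [jacobi_cancellation]. What is left mixes [M_1] with the
    derivative in [M_2], and only this part needs an integration. *)
Let variation_sum (I1 I2 I3 : functional U c) x :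
  variation u (vder I1 u) (vder I2 u) (M u (vder I3 u)) x
  + variation u (vder I2 u) (vder I3 u) (M u (vder I1 u)) x
  + variation u (vder I3 u) (vder I1 u) (M u (vder I2 u)) x =
  a * b * msum mu (fun m n =>
    P I2 n x * (dot (derive1 (kk I3 m) x) (vder I1 u x) - dot (derive1 (kk I1 m) x) (vder I3 u x))
  + P I3 n x * (dot (derive1 (kk I1 m) x) (vder I2 u x) - dot (derive1 (kk I2 m) x) (vder I1 u x))
  + P I1 n x * (dot (derive1 (kk I2 m) x) (vder I3 u x) - dot (derive1 (kk I3 m) x) (vder I2 u x))).
Proof.
have JC := @jacobi_cancellation R L mu (P I1 ^~ x) (P I2 ^~ x) (P I3 ^~ x)
  (A I1 ^~ x) (A I2 ^~ x) (A I3 ^~ x)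
  (fun p m => dot (yv m p x) (vder I1 u x)) (fun p m => dot (yv m p x) (vder I2 u x))
  (fun p m => dot (yv m p x) (vder I3 u x))
  (fun p m => dot (derive1 (yv m p) x) (vder I1 u x))
  (fun p m => dot (derive1 (yv m p) x) (vder I2 u x))
  (fun p m => dot (derive1 (yv m p) x) (vder I3 u x))
  (fun p m => congr1 (fun f => dot (derive1 f x) (vder I1 u x)) (yv_sym m p))
  (fun p m => congr1 (fun f => dot (derive1 f x) (vder I2 u x)) (yv_sym m p))
  (fun p m => congr1 (fun f => dot (derive1 f x) (vder I3 u x)) (yv_sym m p))
  (yv_swap I1 I3 x) (yv_swap I2 I1 x) (yv_swap I3 I2 x).
pose w (I J : functional U c) m := msum mu (fun p q => A I q x * dot (yv m p x) (vder J u x)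
  + P I q x * dot (derive1 (yv m p) x) (vder J u x)).
pose k (I J : functional U c) m := dot (derive1 (kk I m) x) (vder J u x).
have VE (I J K : functional U c) : variation u (vder I u) (vder J u) (M u (vder K u)) x =
    a * (a * msum mu (fun m n => P J n x * w K I m - P I n x * w K J m)
    + b * msum mu (fun m n => P J n x * k K I m - P I n x * k K J m)).
  apply: (congr1 (fun z => a * z)); apply: (etrans _ (msum_lin _ _ _ _ _)).
  apply: eq_msum => m n.
  apply: (etrans (congr2 (fun p q => P J n x * p - P I n x * q)
    (shift_dot K m x (vder I u x)) (shift_dot K m x (vder J u x)))).
  rewrite -/(w K I m) -/(w K J m) -/(k K I m) -/(k K J m).
  move: (w K I m) (w K J m) (k K I m) (k K J m) (P J n x) (P I n x) => *; ring.
apply: (etrans (congr2 +%R (congr2 +%R (VE I1 I2 I3) (VE I2 I3 I1)) (VE I3 I1 I2))).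
have E (s1 s2 s3 t1 t2 t3 t : R) : s1 + s2 + s3 = 0 -> t1 + t2 + t3 = t ->
    a * (a * s1 + b * t1) + a * (a * s2 + b * t2) + a * (a * s3 + b * t3) = a * b * t.
  by move=> s0 <-; have -> : s3 = - s1 - s2 by [lra]; ring.
apply: E; first exact JC.
apply: (etrans (congr1 (fun z => z + _) (msumD _ _ _))); apply: (etrans (msumD _ _ _)).
apply: eq_msum => m n; rewrite /k.
generalize (P I1 n x), (P I2 n x), (P I3 n x); intros; ring_atoms.
Qed.

(** Primitives for the mixed terms. Differentiating the second factor gives the wanted terms and two
    more that cancel by [kk_sym]; differentiating [P] gives terms whose cyclic sum vanishes by
    [kk_quad]. *)
Let G (I J K : functional U c) m n x := P I n x * (dot (kk J m x) (vder K u x) - dot (kk K m x) (vder J u x)).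

Let G_derive I J K m n x : is_derive x (1 : R) (G I J K m n)
  (A I n x * (dot (kk J m x) (vder K u x) - dot (kk K m x) (vder J u x))
   + P I n x * (dot (derive1 (kk J m) x) (vder K u x) - dot (derive1 (kk K m) x) (vder J u x))).
Proof.
have H (J' K' : functional U c) : is_derive x (1 : R) (fun y => dot (kk J' m y) (vder K' u y))
    (dot (derive1 (kk J' m) x) (vder K' u x) + dot (kk J' m x) (derive1 (vder K' u) x)).
  by apply: is_derive_dot; exact: smooth_d1.
have H1 := is_derive_mul (is_derive_dinv x (momc n I)) (is_derive_subf (H J K) (H K J)).
apply: (is_derive_eq H1).
have E (p q r s t z : R) : q = s -> z + t * (p + q - (r + s)) = z + t * (p - r).
  by move=> ->; ring.
exact (E _ _ _ _ _ _ (kk_sym K J m x)).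
Qed.

Let G_ends I J K m n : eq_ends (G I J K m n).
Proof.
apply: eq_ends_zero.
have H (J' : functional U c) := locally_supported_derive2 (vE J').
have [A1 /nbhs_singleton E1] := H J 0 (Logic.I : setT 0).
have [A2 /nbhs_singleton E2] := H K 0 (Logic.I : setT 0).
exists (Num.max A1 A2) => x; rewrite ge_max => /andP[x1 x2].
by rewrite /G /kk E1// E2// !mul0mx !dot0l subrr mulr0.
Qed.

Section transport.
Variable X : R -> 'rV[R]_N.
Hypotheses (XC : smooth setT X) (XS : exists A : R, forall x, A <= `|x| -> X x = 0).

Let phi := flow_line u X.
Let phiF : field_family U c (flow_domain U u X) phi.
Proof. exact: (flow_line_family oU uF XC XS). Qed.
Let o : flow_domain U u X flow_origin.
Proof. exact: (flow_origin_domain X uF). Qed.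

Let IC (I : functional U c) : slab_smooth (flow_domain U u X) (fun p => vder I (phi p)).
Proof. by have [] := vderP I phiF. Qed.
Let IE (I : functional U c) : equal_ends (flow_domain U u X) (fun p => vder I (phi p)).
Proof. by have [] := vderP I phiF. Qed.

Let variation_nonlocalE (I J : functional U c) :
  bracket_variation_nonlocal eta mu psi a phi (fun p => vder I (phi p)) (fun p => vder J (phi p))
    flow_origin flow_direction =
  variation u (vder I u) (vder J u) X.
Proof.
apply/funext => x; rewrite /bracket_variation_nonlocal /variation; congr (a * _).
apply: eq_msum => m n.
have E : hflow_shift eta psi phi m flow_origin flow_direction = (fun y => X y *m V m (u y)).
  apply/funext => y; rewrite /hflow_shift.
  exact (congr2 (fun p q => p *m V m q) (flow_line_derive u X y) (congr1 (@^~ y) (flow_line_origin u X))).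
exact (congr2 (fun F p => dinv (mom n p (vder J p)) x * dot (derive1 F x) (vder I p x)
  - dinv (mom n p (vder I p)) x * dot (derive1 F x) (vder J p x)) E (flow_line_origin u X)).
Qed.

Lemma variation_compact (I J : functional U c) :
  compactly_supported (variation u (vder I u) (vder J u) X).
Proof.
have := bracket_variation_nonlocal_compact eta mu D_open psi_smooth a UD phiF (IC I) (IC J) o flow_direction.
by rewrite variation_nonlocalE.
Qed.

Lemma bracket_line_derive (I J : functional U c) :
  is_derive flow_origin flow_direction (fun p => bracket M I J (phi p))
    (integral (fun x => dot (dvder I u X x) (M u (vder J u) x))
     - integral (fun x => dot (dvder J u X x) (M u (vder I u) x))
     + integral (variation u (vder I u) (vder J u) X)).
Proof.
have H := bracket_derive eta_sym mu_sym D_open psi_smooth a b UD phiF (IC I) (IE I) (IC J) (IE J) o flow_direction.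
rewrite variation_nonlocalE in H.
have E (I' J' : functional U c) :
    integral (fun x => dot ('D_flow_direction (fun p => vder I' (phi p) x) flow_origin)
      (M (phi flow_origin) (vder J' (phi flow_origin)) x)) =
    integral (fun x => dot (dvder I' u X x) (M u (vder J' u) x)).
  apply: eq_integral => x.
  exact (congr2 (fun z q => dot z (M q (vder J' q) x)) (flow_vder_derive oU uF XC XS I' x) (flow_line_origin u X)).
exact (is_derive_eq H (congr2 (fun p q => p - q + _) (E I J) (E J I))).
Qed.

(** [IJ] is any functional with these values, not necessarily the one built from [bracket_vder]. Its
    pairing with [X] is still determined, as the derivative of the values along [u + e X]. *)
Lemma represented_bracket_derive (I J IJ : functional U c) : represents IJ (bracket M I J) ->
  integral (fun x => dot (vder IJ u x) (X x)) =
  integral (fun x => dot (dvder I u X x) (M u (vder J u) x))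
  - integral (fun x => dot (dvder J u X x) (M u (vder I u) x))
  + integral (variation u (vder I u) (vder J u) X).
Proof.
move=> IJE; have [_ _ /(_ _ flow_direction o) H] := vderP IJ phiF.
have oO : open (flow_domain U u X) by case: phiF.
have H2 := bracket_line_derive I J.
have H3 : is_derive flow_origin flow_direction (fun p => fval IJ (phi p))
    (integral (fun x => dot (dvder I u X x) (M u (vder J u) x))
     - integral (fun x => dot (dvder J u X x) (M u (vder I u) x))
     + integral (variation u (vder I u) (vder J u) X)).
  apply: near_eq_is_derive H2; apply: filterS (open_nbhs_nbhs (conj oO o)) => p Op.
  by rewrite IJE//; exact: (family_field phiF).
apply: etrans (derive_unique H H3); apply: eq_integral => x; apply: esym.
exact (congr2 (fun q z => dot (vder IJ q x) z) (flow_line_origin u X) (flow_line_derive u X x)).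
Qed.

End transport.

Lemma variation_cyclic (I1 I2 I3 : functional U c) :
  integral (variation u (vder I1 u) (vder I2 u) (M u (vder I3 u)))
  + integral (variation u (vder I2 u) (vder I3 u) (M u (vder I1 u)))
  + integral (variation u (vder I3 u) (vder I1 u) (M u (vder I2 u))) = 0.
Proof.
have cv (I J K : functional U c) := variation_compact (pencil_smooth K) (pencil_compact K) I J.
have c12 := compactly_supportedD (cv I1 I2 I3) (cv I2 I3 I1).
have c123 := compactly_supportedD c12 (cv I3 I1 I2).
rewrite -integralD// -integralD//.
pose Z x := a * b * msum mu (fun m n => G I2 I3 I1 m n x + G I3 I1 I2 m n x + G I1 I2 I3 m n x).
apply: (@integral_derive0 _ Z).
- move=> x.
  have dG m n := is_derive_addf (is_derive_addf (G_derive I2 I3 I1 m n x) (G_derive I3 I1 I2 m n x))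
      (G_derive I1 I2 I3 m n x).
  have H := is_derive_scalel (a * b) (@is_derive_msum R L mu _ _ _ _ _ dG).
  apply: (is_derive_eq H); apply: (etrans _ (esym (variation_sum I1 I2 I3 x))).
  congr (_ * _).
  have K0 : msum mu (fun m n =>
      A I2 n x * (dot (kk I3 m x) (vder I1 u x) - dot (kk I1 m x) (vder I3 u x))
      + A I3 n x * (dot (kk I1 m x) (vder I2 u x) - dot (kk I2 m x) (vder I1 u x))
      + A I1 n x * (dot (kk I2 m x) (vder I3 u x) - dot (kk I3 m x) (vder I2 u x))) = 0.
    have B (f1 f2 f3 g1 g2 g3 : 'I_L -> 'I_L -> R) : msum mu f1 = msum mu g1 ->
        msum mu f2 = msum mu g2 -> msum mu f3 = msum mu g3 ->
        msum mu (fun m n => (f1 m n - g1 m n) + (f2 m n - g2 m n) + (f3 m n - g3 m n)) = 0.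
      by move=> e1 e2 e3; rewrite -(msumD mu (fun m n => f1 m n - g1 m n + (f2 m n - g2 m n)))
        -(msumD mu (fun m n => f1 m n - g1 m n)) -!msumB e1 e2 e3 !subrr !addr0.
    have := B _ _ _ _ _ _ (kk_quad I3 I1 I2 x) (kk_quad I1 I2 I3 x) (kk_quad I2 I3 I1 x).
    apply: etrans; apply: eq_msum => m n.
    generalize (A I1 n x), (A I2 n x), (A I3 n x); intros; ring_atoms.
  apply: (etrans _ (add0r _)); rewrite -[X in X + _]K0.
  apply: (etrans _ (esym (msumD _ _ _))); apply: eq_msum => m n.
  generalize (A I1 n x), (A I2 n x), (A I3 n x), (P I1 n x), (P I2 n x), (P I3 n x); intros.
  ring_atoms.
- by have [] := c123.
- apply: (eq_ends_map (fun z => a * b * z)); apply: eq_ends_msum => m n.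
  by apply: (eq_ends2 +%R); [apply: (eq_ends2 +%R)|]; exact: G_ends.
Qed.

Lemma jacobi (I J K IJ JK KI : functional U c) :
  represents IJ (bracket M I J) -> represents JK (bracket M J K) ->
  represents KI (bracket M K I) ->
  bracket M IJ K u + bracket M JK I u + bracket M KI J u = 0.
Proof.
have T (I1 I2 I3 S : functional U c) : represents S (bracket M I1 I2) ->
    bracket M S I3 u = integral (fun x => dot (dvder I1 u (M u (vder I3 u)) x) (M u (vder I2 u) x))
    - integral (fun x => dot (dvder I2 u (M u (vder I3 u)) x) (M u (vder I1 u) x))
    + integral (variation u (vder I1 u) (vder I2 u) (M u (vder I3 u))).
  move=> SE; exact (represented_bracket_derive (pencil_smooth I3) (pencil_compact I3) SE).
(* By this symmetry the six Hessian terms of the cyclic sum cancel in pairs. *)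
have S (I1 I2 I3 : functional U c) :
    integral (fun x => dot (dvder I1 u (M u (vder I3 u)) x) (M u (vder I2 u) x)) =
    integral (fun x => dot (dvder I1 u (M u (vder I2 u)) x) (M u (vder I3 u) x)).
  exact (dvder_symmetric oU uF (pencil_smooth I3) (pencil_compact I3) I1 (pencil_smooth I2) (pencil_compact I2)).
move=> /(T _ _ K)-> /(T _ _ I)-> /(T _ _ J)->.
apply: (etrans _ (variation_cyclic I J K)).
have E (p q p2 q2 p3 q3 s t v : R) : q = p2 -> q2 = p3 -> p = q3 ->
  p - q + s + (p2 - q2 + t) + (p3 - q3 + v) = s + t + v.
  by move=> -> -> ->; ring.
exact (E _ _ _ _ _ _ _ _ _ (S J I K) (S K J I) (S I J K)).
Qed.

End fixed_field.

Theorem pencil_hamiltonian : hamiltonian U c M.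
Proof.
split.
- exact: (bracket_functional eta_sym mu_sym D_open psi_smooth a b oU UD).
- by move=> I J K S k SE u uF; exact: bracket_linear.
- by move=> I J u uF; exact: bracket_skew_field.
- by move=> I J K IJ JK KI h1 h2 h3 u uF; exact: jacobi h1 h2 h3.
Qed.

End hamiltonian.

(** * Local functionals and commuting flows *)

Section operators.
Context {R : realType} {N L : nat}.
Variables (eta : 'M[R]_N) (mu : 'M[R]_L) (D : set 'rV[R]_N) (psi : 'I_L -> 'rV[R]_N -> R).
Hypotheses (eta_sym : eta^T = eta) (D_open : open D).
Hypothesis psi_smooth : forall n, smooth D (psi n).
Variables (U : set 'rV[R]_N) (c : 'rV[R]_N).
Hypothesis UD : U `<=` D.

Lemma derive1_compact (u : R -> 'rV[R]_N) i : field U c u ->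
  compactly_supported (fun y => derive1 u y 0 i).
Proof.
move=> uF; have [uC uU uc] := uF.
have u0 := @const_family R N U c 0 u uF.
have uE : equal_ends [set: 'rV[R]_0] (fun=> u).
  move=> s _; have [A uA] := uc; exists A; near=> t => x y xA yA; by rewrite !uA.
have [A /nbhs_singleton HA] := locally_supported_derive2 uE (Logic.I : setT 0).
split; last by exists A => x xA; rewrite HA// mxE.
have dC : smooth setT (derive1 u).
  by apply: (smooth_eq openT _ (smooth_derive (1 : R) uC)) => x _; rewrite derive1E.
by move=> x; exact: (smooth_continuous ((smooth_rV _ openT).1 dC i) (Logic.I : setT x)).
Unshelve. all: by end_near. Qed.

(** Moving sums and constants through [dinv] rests on compact supports. They come from [u_x], which
    is why [u] is a field while [xi] need only be continuous. *)
Lemma nonlocal_opE (u xi : R -> 'rV[R]_N) x : field U c u -> (forall j, continuous (fun y => xi y 0 j)) ->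
  nonlocal_op eta mu psi u xi x =
  \sum_m \sum_n (mu m n * dinv (moment eta psi n u xi) x) *: hflow eta psi m u x.
Proof.
move=> uF xic; have [uC uU uc] := uF.
have uD y : D (u y) by exact: UD.
pose f n r j y := \sum_(s < N) partial2 r s (psi n) (u y) * derive1 u y 0 s * xi y 0 j.
have fc n r j : compactly_supported (f n r j).
  apply: compactly_supported_sum => s; apply: compactly_supportedMr => //.
  apply: compactly_supportedMl; last exact: derive1_compact.
  move=> y; have H : smooth setT (fun y => partial2 r s (psi n) (u y)).
    apply: (smooth_eq openT _ (hess_smooth D_open psi_smooth n r s openT uC (fun y _ => uD y))).
    by move=> z _; rewrite hessE.
  exact: (smooth_continuous H (Logic.I : setT y)).
have momE n : dinv (moment eta psi n u xi) x = \sum_(j < N) \sum_(r < N) eta j r * dinv (f n r j) x.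
  transitivity (dinv (fun y => \sum_(j < N) \sum_(r < N) eta j r * f n r j y) x).
    apply: eq_dinv => y; rewrite /moment /dot; apply: eq_bigr => j _.
    rewrite /hflow -(hydro_flowE eta_sym D_open psi_smooth n (uD y)) mxE mulr_suml.
    apply: eq_bigr => r _; rewrite /f mulr_suml mulr_sumr; apply: eq_bigr => s _.
    by rewrite !mulrA.
  rewrite dinv_sum; last by move=> j; apply: compactly_supported_sum => r; exact: compactly_supportedZ.
  apply: eq_bigr => j _; rewrite dinv_sum; last by move=> r; exact: compactly_supportedZ.
  by apply: eq_bigr => r _; exact: dinvZ.
apply/rowP => i; rewrite mxE summxE exchange_big; apply: eq_bigr => m _.
rewrite summxE exchange_big; apply: eq_bigr => n _.
rewrite [RHS]mxE /hflow -(hydro_flowE eta_sym D_open psi_smooth m (uD x)) [X in _ = _ * X]mxE momE.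
rewrite [mu m n * _]mulr_sumr mulr_suml; apply: eq_bigr => j _.
rewrite exchange_big [mu m n * _]mulr_sumr mulr_suml; apply: eq_bigr => r _.
rewrite mulr_sumr; apply: eq_bigr => p _; rewrite mulr_sumr; apply: eq_bigr => k _.
rewrite -/(f n r j); ring.
Qed.

Lemma op_comb_pencil a b (u xi : R -> 'rV[R]_N) x : field U c u ->
  (forall j, continuous (fun y => xi y 0 j)) ->
  op_comb a b (nonlocal_op eta mu psi) (const_op eta) u xi x = pencil eta mu psi a b u xi x.
Proof. by move=> uF xic; rewrite /op_comb nonlocal_opE// const_opE. Qed.

End operators.

Section transfer.
Context {R : realType} {N : nat} (U : set 'rV[R]_N) (c : 'rV[R]_N) (M M' : operator R N).
Hypothesis MM' : forall u (J : functional U c), field U c u -> forall x,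
  M u (vder J u) x = M' u (vder J u) x.

(** Brackets see an operator only on variational derivatives, so agreement there suffices. The
    operator with component sums outside [d^{-1}] and [pencil] are compared on continuous covectors
    only. *)
Lemma hamiltonian_ext : hamiltonian U c M -> hamiltonian U c M'.
Proof.
have B (I J : functional U c) u : field U c u -> bracket M' I J u = bracket M I J u.
  by move=> uF; apply: eq_integral => x; rewrite MM'.
have RE (K I J : functional U c) : represents K (bracket M' I J) -> represents K (bracket M I J).
  by move=> H u uF; rewrite H// B.
move=> [h1 h2 h3 h4]; split.
- by move=> I J; have [K HK] := h1 I J; exists K => u uF; rewrite HK// B.
- by move=> I J K S a SE u uF; rewrite !B//; exact: h2.
- by move=> I J u uF; rewrite !B//; exact: h3.
- move=> I J K IJ JK KI /RE r1 /RE r2 /RE r3 u uF; rewrite !B//; exact: h4.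
Qed.

End transfer.

Lemma vder_continuous {R : realType} {N : nat} (U : set 'rV[R]_N) (c : 'rV[R]_N) (J : functional U c) u j :
  field U c u -> continuous (fun y => vder J u y 0 j).
Proof.
move=> uF x; have u0 := @const_family R N U c 0 u uF.
have [JC _ _] := vderP J u0.
have C := slab_smooth_xv openT (JC : slab_smooth [set: 'rV[R]_0] (fun=> vder J u)) (Logic.I : setT 0).
exact: (smooth_continuous ((smooth_rV _ openT).1 C j) (Logic.I : setT x)).
Qed.

Section local_functional.
Context {R : realType} {N : nat} (U : set 'rV[R]_N) (c : 'rV[R]_N) (h : 'rV[R]_N -> R).
Hypotheses (oU : open U) (hC : smooth U h).

Lemma local_variational_derivative : has_variational_derivative U c
  (fun u => integral (fun x => h (u x) - h c)) (fun u x => grad h (u x)).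
Proof.
move=> k O phi phiF; have [oO phiC pU pc] := phiF.
have oS := open_slab oO.
have SU p : (O `*` [set: R]) p -> U (phi p.1 p.2) by case: p => s x [/= Os _]; exact: pU.
split.
- exact: grad_smooth oS oU phiC SU hC.
- move=> s Os; have [A HA] := pc s Os; exists A; apply: filterS HA => t H x y xA yA.
  by rewrite !H.
- move=> s v Os.
  have gC : slab_smooth O (fun s x => h (phi s x) - h c).
    by apply: slab_smoothB => //; [exact: smooth_comp_rV oS oU phiC SU hC|exact: slab_smooth_cst].
  have gS : locally_supported O (fun s x => h (phi s x) - h c).
    move=> t Ot; have [A HA] := pc t Ot; exists A; apply: filterS HA => t' H x xA.
    by rewrite H// subrr.
  apply: (is_derive_eq (integral_derive oO v gC gS Os)); apply: eq_integral => x.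
  have H := is_derive_comp_rV (v, 0 : R) oS oU phiC (conj Os Logic.I : (O `*` setT) (s, x)) (SU (s, x) (conj Os Logic.I)) hC.
  have H2 := is_derive_subf H (is_derive_cst (h c) (s, x) (v, 0 : R)).
  have [_ E] := (is_derive_slab1 (fun s x => h (phi s x) - h c) s x v _).1 H2.
  apply: (etrans E); rewrite subr0 dotC; congr dot.
  exact (slab_derive1E x v phiC Os).
Qed.

Definition local_functional := Functional local_variational_derivative.

End local_functional.

(** * Commutation of the flows *)

Section commuting.
Context {R : realType} {N L : nat}.
Variables (eta : 'M[R]_N) (D : set 'rV[R]_N) (psi : 'I_L -> 'rV[R]_N -> R).
Hypotheses (eta_sym : eta^T = eta) (D_open : open D).
Hypothesis psi_smooth : forall n, smooth D (psi n).
Hypothesis eq_eta : forall u, D u -> forall (a b : 'I_L) (k l : 'I_N),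
      \sum_(i < N) \sum_(j < N) eta i j *
        (partial2 i k (psi a) u * partial2 j l (psi b) u
         - partial2 i l (psi a) u * partial2 j k (psi b) u) = 0.

(** The third derivatives of [psi n] contracted with [X] and [W], the remaining index being raised
    by [eta]. *)
Definition third n (z X W : 'rV[R]_N) : 'rV[R]_N :=
  (\row_j \sum_s X 0 s * dot W (grad (partial s (partial j (psi n))) z)) *m eta.

Lemma third_sym n z X W : D z -> third n z X W = third n z W X.
Proof.
move=> Dz; rewrite /third; congr (_ *m eta); apply/rowP => j; rewrite !mxE.
have E (X' W' : 'rV[R]_N) : \sum_s X' 0 s * dot W' (grad (partial s (partial j (psi n))) z) =
    \sum_s \sum_k X' 0 s * W' 0 k * partial k (partial s (partial j (psi n))) z.
  apply: eq_bigr => s _; rewrite mulr_sumr; apply: eq_bigr => k _.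
  by rewrite mxE mulrA.
rewrite !E exchange_big; apply: eq_bigr => s _; apply: eq_bigr => k _.
have C : partial s (partial k (partial j (psi n))) z = partial k (partial s (partial j (psi n))) z.
  exact (smooth_derive_commute (delta_mx 0 k) (delta_mx 0 s) D_open
    (smooth_derive (delta_mx 0 j) (psi_smooth n)) Dz).
exact (congr2 *%R (mulrC _ _) C).
Qed.

Lemma is_derive_mul_affinor (E : normedModType R) (A : set E) (X G : E -> 'rV[R]_N) n x v dX :
  open A -> smooth A G -> A x -> D (G x) -> is_derive x v X dX ->
  is_derive x v (fun t => X t *m affinor eta psi n (G t))
    (dX *m affinor eta psi n (G x) + third n (G x) (X x) ('D_v G x)).
Proof.
move=> oA GC Ax DG Xd.
have H : is_derive x v (fun t => X t *m hess psi n (G t))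
    (dX *m hess psi n (G x) + \row_j \sum_s X x 0 s * dot ('D_v G x) (grad (partial s (partial j (psi n))) (G x))).
  apply/is_derive_rV => j.
  rewrite (_ : (fun t => _) = fun t => \sum_s X t 0 s * partial s (partial j (psi n)) (G t)); last first.
    by apply/funext => t; rewrite mxE; apply: eq_bigr => s _; rewrite hessE.
  have K s : is_derive x v (fun t => X t 0 s * partial s (partial j (psi n)) (G t))
      (dX 0 s * partial s (partial j (psi n)) (G x)
       + X x 0 s * dot ('D_v G x) (grad (partial s (partial j (psi n))) (G x))).
    exact (is_derive_mul ((is_derive_rV _ _ _ _).1 Xd s) (is_derive_comp_rV v oA D_open GC Ax DG
      (smooth_derive (delta_mx 0 s) (smooth_derive (delta_mx 0 j) (psi_smooth n))))).
  refine (is_derive_eq (is_derive_sum_fun (index_enum 'I_N) K) _).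
  rewrite !mxE -big_split; apply: eq_bigr => s _; by rewrite hessE.
have H2 := is_derive_mulmxr eta H.
have VE (w : 'rV[R]_N) z : w *m affinor eta psi n z = w *m hess psi n z *m eta.
  by rewrite affinorE mulmxA.
have FE : (fun t => X t *m affinor eta psi n (G t)) = (fun t => X t *m hess psi n (G t) *m eta).
  by apply/funext => t; exact: VE.
rewrite FE; apply: (is_derive_eq H2); rewrite mulmxDl.
exact (congr1 (fun z => z + third n (G x) (X x) ('D_v G x)) (esym (VE dX (G x)))).
Qed.

Lemma flows_commute n m : commuting D (hydro_flow eta (psi n)) (hydro_flow eta (psi m)).
Proof.
suff S n' m' (u : R -> 'rV[R]_N) : smooth setT u -> (forall x, D (u x)) -> forall x,
    is_derive (0 : R) (1 : R) (fun e => hydro_flow eta (psi n') (fun y => u y + e *: hydro_flow eta (psi m') u y) x)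
     (derive1 (fun y => derive1 u y *m affinor eta psi m' (u y) *m affinor eta psi n' (u y)) x).
  move=> u uC uD x; exists (derive1 (fun y => derive1 u y *m affinor eta psi m (u y) *m affinor eta psi n (u y)) x).
  split; first exact: S.
  rewrite (_ : (fun y => _) = (fun y => derive1 u y *m affinor eta psi n (u y) *m affinor eta psi m (u y))).
    exact: S.
  apply/funext => y.
  have E (X : 'rV[R]_N) (Y Z : 'M[R]_N) : Y *m Z = Z *m Y -> X *m Y *m Z = X *m Z *m Y.
    by move=> YZ; rewrite -mulmxA YZ mulmxA.
  exact (E _ _ _ (affinor_commute eta_sym D_open psi_smooth eq_eta m n (uD y))).
move=> uC uD x.
have dC : smooth setT (derive1 u).
  by apply: (smooth_eq openT _ (smooth_derive (1 : R) uC)) => y _; rewrite derive1E.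
pose W y := derive1 u y *m affinor eta psi m' (u y).
have WE : hydro_flow eta (psi m') u = W by apply/funext => y; exact (hydro_flowE eta_sym D_open psi_smooth m' (uD y)).
rewrite WE.
have WC : smooth setT W.
  apply: (smooth_mulmxr (M := fun y => affinor eta psi m' (u y))) => //; first exact: openT.
  by move=> i j; exact: (affinor_smooth eta D_open psi_smooth m' i j openT uC (fun x _ => uD x)).
have d1 (f : R -> 'rV[R]_N) y : smooth setT f -> is_derive y (1 : R) f (derive1 f y).
  by move=> fC; rewrite derive1E; exact: (smooth_derivable (1 : R) fC (Logic.I : setT y)).
(* The x-derivative of [W V(u)] and the e-derivative of [(u + e W)_x V(u + e W)] share the term
   [W_x V]. They differ only in the order of the arguments of [third], which is symmetric. *)
have H1 := is_derive_mul_affinor n' openT uC (Logic.I : setT x) (uD x) (d1 _ x WC).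
rewrite derive1E; have [_ ->] := H1; rewrite -derive1E.
(* Only the value at the one point [x] has to stay in [D]. The field is not assumed constant at
   infinity, so [u + e W] may leave [D] elsewhere for arbitrarily small [e]. *)
pose A := [set e : R | D (u x + e *: W x)].
pose G (e : R) := u x + e *: W x.
have affd (p q : 'rV[R]_N) e : is_derive e (1 : R) (fun e => p + e *: q) q.
  apply/is_derive_epsP => ep ep0; exists 1 => // h _.
  rewrite [h%:A]mulr1 scalerDl addrA [p + _ + _]addrC addrK subrr normr0.
  by rewrite mulr_ge0// ltW.
have GC : smooth setT G.
  apply/(smooth_rV _ openT) => j.
  rewrite (_ : (fun e => _) = fun e => u x 0 j + e * W x 0 j); last first.
    by apply/funext => e; rewrite /G 2!mxE.
  apply: smoothD; [exact: openT|exact: smooth_cst|].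
  apply: smoothM; [exact: openT| |exact: smooth_cst].
  by apply: smooth_linear => [z|]//; exact: cvg_id.
have oA : open A by apply: open_comp D_open => e _; exact: smooth_continuous GC (Logic.I : setT e).
have A0 : A 0 by rewrite /A /= scale0r addr0.
have GA : smooth A G by exact: smooth_subset GC.
have G0 : G 0 = u x by rewrite /G scale0r addr0.
have H2 := is_derive_mul_affinor n' oA GA A0 A0 (affd (derive1 u x) (derive1 W x) 0).
have [_ DG] := affd (u x) (W x) 0.
rewrite -/(G 0) G0 scale0r addr0 DG in H2.
rewrite (third_sym n' _ _ (uD x)).
apply: (near_eq_is_derive _ H2).
apply: filterS (open_nbhs_nbhs (conj oA A0)) => e Ae.
have DE : derive1 (fun y => u y + e *: W y) x = derive1 u x + e *: derive1 W x.
  have := is_derive_addf (d1 _ x uC) (is_derive_scalev (is_derive_cst e x (1 : R)) (d1 _ x WC)).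
  rewrite scale0r add0r => dd; rewrite [LHS]derive1E; exact (@derive_val _ _ _ _ _ _ _ dd).
apply: (etrans _ (esym (hydro_flowE eta_sym D_open psi_smooth n' (Ae : D ((fun y => u y + e *: W y) x))))).
exact (congr1 (fun z => z *m affinor eta psi n' (G e)) (esym DE)).
Qed.

End commuting.

(** * The Poincare lemma on star-shaped sets *)

Section unit_interval.
Context {R : realType}.
Implicit Types f df : R -> R.

Lemma unit_nondecreasing f df :
  (forall t : R, 0 <= t <= 1 -> is_derive t (1 : R) f (df t)) ->
  (forall t : R, 0 <= t <= 1 -> 0 <= df t) -> forall t : R, 0 <= t <= 1 -> f 0 <= f t.
Proof.
move=> fd df0 t /andP[t0 t1].
have [||x xt E] := @MVT_segment R f df 0 t t0.
- move=> x; rewrite in_itv/= => /andP[x0 xt]; apply: fd.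
  by rewrite (ltW x0)/= (le_trans (ltW xt)).
- apply: derivable_within_continuous => x; rewrite in_itv/= => /andP[x0 xt].
  by have [] := fd x; rewrite ?x0 ?(le_trans xt).
rewrite -subr_ge0 E subr0 mulr_ge0//; apply: df0.
by move: xt; rewrite in_itv/= => /andP[-> xt]; exact: le_trans xt t1.
Qed.

Lemma unit_derive_bound f df (g dg : R -> R) :
  (forall t : R, 0 <= t <= 1 -> is_derive t (1 : R) f (df t)) ->
  (forall t : R, 0 <= t <= 1 -> is_derive t (1 : R) g (dg t)) ->
  (forall t : R, 0 <= t <= 1 -> `|df t| <= dg t) -> `|f 0| <= g 0 ->
  forall t : R, 0 <= t <= 1 -> `|f t| <= g t.
Proof.
move=> fd gd fg; rewrite ler_norml => /andP[fg0 fg1] t t01.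
have H1 := unit_nondecreasing (fun t t01 => is_derive_subf (gd t t01) (fd t t01)) _ t01.
have H2 := unit_nondecreasing (fun t t01 => is_derive_addf (gd t t01) (fd t t01)) _ t01.
rewrite ler_norml; apply/andP; split.
  have : g 0 + f 0 <= g t + f t.
    by apply: H2 => x /fg; rewrite ler_norml => /andP[? _]; lra.
  lra.
have : g 0 - f 0 <= g t - f t.
  by apply: H1 => x /fg; rewrite ler_norml => /andP[_ ?]; lra.
lra.
Qed.

(** Extends [f] from [[0, 1]] to a compactly supported continuous function: reflected to negative
    times, frozen beyond 1 and damped linearly between 1 and 2. Then [primitive], which integrates
    from minus infinity, has the two-sided derivative [f] also at 0 and 1. *)
Definition cutoff f (t : R) : R := Num.max 0 (Num.min 1 (2 - `|t|)) * f (Num.min `|t| 1).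

Lemma continuous_cutoff f : (forall t : R, 0 <= t <= 1 -> {for t, continuous f}) ->
  compactly_supported (cutoff f).
Proof.
move=> fc; split=> [t|]; last first.
  exists 2 => t t2; rewrite /cutoff max_l ?mul0r// ge_min; apply/orP; right; lra.
have nc : {for t, continuous (fun t : R => `|t|)} by exact: norm_continuous.
have cc (k : R) : {for t, continuous (fun=> k : R)} by exact: cvg_cst.
have sc : {for t, continuous (fun t : R => 2 - `|t|)} by apply: cvgB; [exact: cvg_cst|exact: nc].
apply: cvgM; first exact (continuous_max (cc 0) (continuous_min (cc 1) sc)).
have mc : {for t, continuous (fun t : R => Num.min `|t| 1)}.
  exact (continuous_min nc (cc 1)).
apply: (@continuous_comp _ _ _ (fun t : R => Num.min `|t| 1) f) mc _.
by apply: fc; rewrite le_min ge_min normr_ge0 ler01 lexx orbT.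
Qed.

Lemma is_derive_cutoff_primitive f : (forall t : R, 0 <= t <= 1 -> {for t, continuous f}) ->
  forall t : R, 0 <= t <= 1 -> is_derive t (1 : R) (primitive (cutoff f)) (f t).
Proof.
move=> fc t /andP[t0 t1].
apply: (is_derive_eq (is_derive_primitive t (continuous_cutoff fc))).
rewrite /cutoff ger0_norm// (min_l t1) max_r ?le_min ?ler01/=; last lra.
by rewrite min_l ?mul1r//; lra.
Qed.

End unit_interval.

(** * Integration of closed one-forms along rays from the centre *)

Section rays.
Context {R : realType} {N : nat} (U : set 'rV[R]_N) (c : 'rV[R]_N).
Hypothesis oU : open U.
Hypothesis star : forall u (t : R), U u -> 0 <= t <= 1 -> U (c + t *: (u - c)).

Lemma is_derive_scale_dir (f : 'rV[R]_N -> R) z v (t : R) : smooth U f -> U z ->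
  is_derive z (t *: v) f (t * 'D_v f z).
Proof.
move=> fC Uz.
have := smooth_derive_lincomb (n := 1) (fun=> v) (fun=> t) oU fC Uz.
by rewrite !big_ord1.
Qed.

Lemma smooth_dot_cst (w : 'rV[R]_N) (g : 'rV[R]_N -> 'rV[R]_N) : smooth U g ->
  smooth U (fun z => dot w (g z)).
Proof.
move=> gC; apply: smooth_sum => // j; apply: smoothM => //; first exact: smooth_cst.
exact: (smooth_rV _ oU).1 gC j.
Qed.

Lemma is_derive_segment (f : 'rV[R]_N -> R) (p v : 'rV[R]_N) (t : R) : smooth U f -> U (p + t *: v) ->
  is_derive t (1 : R) (fun t => f (p + t *: v)) ('D_v f (p + t *: v)).
Proof. move=> fC Up; exact ((is_derive_line f p v _ t).1 (smooth_derivable v fC Up)). Qed.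

Lemma open_line u v : U u -> exists2 r : R, 0 < r & forall xi : R, `|xi| < r -> U (u + xi *: v).
Proof.
move=> Uu.
have cont : {for (0 : R), continuous (fun xi : R => u + xi *: v)}.
  by apply: cvgD; [exact: cvg_cst|apply: cvgZr_tmp; exact: cvg_id].
have : nbhs (0 : R) (fun xi => U (u + xi *: v)).
  by apply: cont; rewrite scale0r addr0; apply: open_nbhs_nbhs.
move=> /(nearP (0 : R))[r r0 rP]; exists r => // xi xr.
by apply: rP; rewrite subr0.
Qed.

Section closed_form.
Variable g : 'rV[R]_N -> 'rV[R]_N.
Hypothesis gC : smooth U g.

Definition ray_form u (t : R) := dot (u - c) (g (c + t *: (u - c))).
(** The integral of the one-form [g] over the segment from [c] to [u]; [cutoff] does not change the
    integrand there. *)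
Definition ray_primitive u :=
  primitive (cutoff (ray_form u)) 1 - primitive (cutoff (ray_form u)) 0.

Lemma ray_form_continuous u : U u -> forall t : R, 0 <= t <= 1 -> {for t, continuous (ray_form u)}.
Proof.
move=> Uu t t01; apply: derivable_continuous.
by apply: is_derive_segment (smooth_dot_cst (u - c) gC) _; exact: star.
Qed.

Lemma is_derive_ray u : U u -> forall t : R, 0 <= t <= 1 ->
  is_derive t (1 : R) (primitive (cutoff (ray_form u))) (ray_form u t).
Proof. by move=> Uu; apply: is_derive_cutoff_primitive; exact: ray_form_continuous. Qed.

Lemma ray_primitive_base : ray_primitive c = 0.
Proof.
have E t : cutoff (ray_form c) t = 0.
  by rewrite /cutoff /ray_form subrr dot0l mulr0.
have P : primitive (cutoff (ray_form c)) = primitive (fun=> 0).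
  by congr primitive; apply/funext.
have P0 x : primitive (fun=> 0 : R) x = 0 by rewrite /primitive Rintegral_cst ?mul0r.
by rewrite /ray_primitive P !P0 subrr.
Qed.

Hypothesis gclosed : forall z v w, U z ->
  'D_v (fun y => dot w (g y)) z = 'D_w (fun y => dot v (g y)) z.

(** Closedness turns the first variation [K 0 t] of the integrand into the t-derivative of
    [t <v, g(c + t w)>]. The remainder [q] therefore has a small derivative on [[0, 1]], and its
    increment over this interval is the error to be bounded. *)
Lemma poincare u v : U u -> is_derive u v ray_primitive (dot v (g u)).
Proof.
move=> Uu; pose w := u - c.
pose Dg a b z := 'D_b (fun y => dot a (g y)) z.
pose pt (xi t : R) := c + t *: (w + xi *: v).
pose K xi t := t * Dg w v (pt xi t) + (dot v (g (pt xi t)) + xi * (t * Dg v v (pt xi t))).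
have dC a := smooth_dot_cst a gC.
have DgC a b : smooth U (Dg a b) by exact: smooth_derive (dC a).
have [r0 r00 r0P] : exists2 r : R, 0 < r & forall xi, `|xi| < r -> U (u + xi *: v).
  exact: open_line.
have Upt (xi t : R) : `|xi| < r0 -> 0 <= t <= 1 -> U (pt xi t).
  move=> xr t01; have := star (r0P _ xr) t01; rewrite /pt /w.
  by rewrite (addrAC u).
(* [tube] works on symmetric intervals, hence the absolute value of the time. *)
have Kc (t : R) : `|t| <= 1 -> {for (0 : R, t), continuous (fun p : R * R => K p.1 `|p.2|)}.
  move=> t1; have nc : {for (0 : R, t), continuous (fun p : R * R => `|p.2|)}.
    apply: (@continuous_comp _ _ _ snd (fun t : R => `|t|)); first exact: cvg_snd.
    exact: norm_continuous.
  have ptc : {for (0 : R, t), continuous (fun p : R * R => pt p.1 `|p.2|)}.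
    apply: cvgD; first exact: cvg_cst.
    apply: cvgZ; first exact: nc.
    apply: cvgD; first exact: cvg_cst.
    by apply: cvgZr_tmp; exact: cvg_fst.
  have fc (f : 'rV[R]_N -> R) : smooth U f ->
      {for (0 : R, t), continuous (fun p : R * R => f (pt p.1 `|p.2|))}.
    move=> fC; apply: (@continuous_comp _ _ _ (fun p : R * R => pt p.1 `|p.2|) f _ ptc).
    by apply: smooth_continuous fC _; apply: Upt; rewrite ?normr0//= normr_ge0.
  apply: cvgD; first by apply: cvgM; [exact: nc|exact: fc (DgC w v)].
  apply: cvgD; first exact: fc (dC v).
  by apply: cvgM; [exact: cvg_fst|apply: cvgM; [exact: nc|exact: fc (DgC v v)]].
have Bd (xi t : R) : `|xi| < r0 -> 0 <= t <= 1 ->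
    is_derive xi (1 : R) (fun xi => dot (w + xi *: v) (g (pt xi t))) (K xi t).
  move=> xr t01; have Up := Upt _ _ xr t01.
  have ptd a : is_derive xi (1 : R) (fun xi => dot a (g (pt xi t))) (t * Dg a v (pt xi t)).
    apply: (is_derive_affine (f := fun z => dot a (g z)) (G := fun xi => pt xi t) (L := fun h => h *: (t *: v))).
      have E (z h k : R) : pt (z + k * h) t = pt z t + k *: (h *: (t *: v)).
        by apply/rowP => j; rewrite /pt !mxE; ring.
      exact: E.
    by rewrite scale1r; exact: is_derive_scale_dir.
  rewrite (_ : (fun xi => _) = fun xi => dot w (g (pt xi t)) + xi * dot v (g (pt xi t))); last first.
    by apply/funext => h; rewrite dotDl dotZl.
  refine (is_derive_eq (is_derive_addf (ptd w) (is_derive_mul (is_derive_id xi (1 : R)) (ptd v))) _).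
  by rewrite mul1r.
apply/is_derive_epsP => e e0.
have [r rr rP] := @tube R R (fun xi t => K xi `|t|) 0 1 e e0 Kc.
exists (Num.min r r0) => [|h]; first by rewrite lt_min rr.
rewrite lt_min => /andP[hr hr0].
have Uh := r0P _ hr0.
pose P y := primitive (cutoff (ray_form y)).
pose q t := P (u + h *: v) t - P u t - h * (t * dot v (g (c + t *: w))).
pose dq t := ray_form (u + h *: v) t - ray_form u t - h * K 0 t.
have qd (t : R) : 0 <= t <= 1 -> is_derive t (1 : R) q (dq t).
  move=> t01; apply: is_derive_subf; first by apply: is_derive_subf; exact: is_derive_ray.
  apply: is_derive_scalel.
  have Uw : U (c + t *: w) by exact: star.
  have H := is_derive_mul (is_derive_id t (1 : R)) (is_derive_segment (dC v) Uw).
  apply: (is_derive_eq H).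
  by rewrite /K /pt scale0r addr0 mul0r addr0 mul1r addrC; congr (_ * _ + _); exact: gclosed.
have dqB (t : R) : 0 <= t <= 1 -> `|dq t| <= e * `|h|.
  move=> t01; have /andP[t0 t1] := t01.
  have := @MVT_dir R R (fun xi => dot (w + xi *: v) (g (pt xi t))) (K^~ t) 0 1 h.
  case=> [xi xh|xi xh].
    by rewrite add0r [xi *: 1]mulr1; apply: Bd => //; exact: le_lt_trans hr0.
  rewrite !add0r [h *: 1]mulr1 [xi *: 1]mulr1 => E.
  have RE (k : R) : ray_form (u + k *: v) t = dot (w + k *: v) (g (pt k t)).
    by rewrite /ray_form /pt /w (addrAC u).
  have R0 : ray_form u t = dot (w + 0 *: v) (g (pt 0 t)) by rewrite -RE scale0r addr0.
  have -> : dq t = h * (K xi t - K 0 t).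
    rewrite [RHS]mulrBr.
    exact (congr1 (fun z => z - h * K 0 t) (etrans (congr2 (fun p q => p - q) (RE h) R0) E)).
  rewrite normrM mulrC ler_wpM2r//.
  have := rP xi; rewrite subr0 => /(_ (le_lt_trans xh hr) t).
  by rewrite (ger0_norm t0) => /(_ t1).
have := unit_derive_bound (f := fun t => q t - q 0) (g := fun t => e * `|h| * t) (df := dq) (dg := fun=> e * `|h|).
move=> /(_ _ _ dqB _ 1); rewrite ler01 lexx mulr1 subrr normr0 mulr0 => H.
have -> : ray_primitive (u + h *: v) - ray_primitive u - h *: dot v (g u) = q 1 - q 0.
  rewrite /q /ray_primitive -/(P u) -/(P (u + h *: v)) !mul1r mul0r mulr0 scale1r.
  have -> : c + w = u by rewrite /w addrC subrK.
  have E (p0 p1 p2 p3 d : R) : p0 - p1 - (p2 - p3) - d = p0 - p2 - d - (p1 - p3 - 0) by ring.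
  exact: E.
apply: H => // t t01.
  apply: (is_derive_eq (is_derive_subf (qd t t01) (is_derive_cst (q 0) t (1 : R)))).
  by rewrite subr0.
apply: (is_derive_eq (is_derive_scalel (e * `|h|) (is_derive_id t (1 : R)))).
by rewrite mulr1.
Qed.

End closed_form.
End rays.

(** * Linear systems with commuting closed connection forms *)

Section gradients.
Context {R : realType} {N : nat}.

Lemma near_bounded (E : normedModType R) (I : finType) (f : I -> E -> R) z :
  (forall i, {for z, continuous (f i)}) ->
  \forall y \near z, forall i, `|f i y| <= \sum_j (`|f j z| + 1).
Proof.
move=> fc.
have B i : \forall y \near z, `|f i y| <= `|f i z| + 1.
  have /cvgrPdist_le /(_ 1 ltr01) := fc i; apply: filterS => y.
  rewrite distrC => H; rewrite -[f i y](subrK (f i z)) (le_trans (ler_normD _ _))// addrC.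
  by rewrite lerD2l.
have {}B : \forall y \near z, forall i, `|f i y| <= `|f i z| + 1.
  by apply: filter_forall => i; exact: B.
apply: filterS B => y H i; rewrite (le_trans (H i))// (bigD1 i)//= lerDl.
by rewrite sumr_ge0// => k _; rewrite addr_ge0.
Qed.

Lemma continuous_nearP (E : normedModType R) (F : E -> R) z :
  {for z, continuous F} <-> forall e : R, 0 < e -> \forall y \near z, `|F y - F z| <= e.
Proof.
split=> [/cvgrPdist_le H e e0|H].
  by apply: filterS (H e e0) => y; rewrite distrC.
by apply/cvgrPdist_le => e /H; apply: filterS => y; rewrite distrC.
Qed.

Lemma entry_le_norm (x : 'rV[R]_N) j : `|x 0 j| <= `|x|.
Proof.
rewrite [leRHS]/Num.Def.normr/= mx_normrE; apply/bigmax_geP; right => /=.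
by exists (0, j).
Qed.

(** By the mean value theorem the bound on the gradient gives a Lipschitz estimate at [z]. Existence
    of all directional derivatives alone would not give continuity. *)
Lemma continuous_of_gradient (F : 'rV[R]_N -> R) (g : 'rV[R]_N -> 'rV[R]_N) z (C : R) :
  (\forall y \near z, (forall v, is_derive y v F (dot v (g y))) /\ forall j, `|g y 0 j| <= C) ->
  {for z, continuous F}.
Proof.
move=> /nearP[r r0 rP]; apply/continuous_nearP => e e0.
have C' (j : 'I_N) : 0 <= C.
  have zr : `|z - z| < r by rewrite subrr normr0.
  exact: le_trans (normr_ge0 _) ((rP z zr).2 j).
pose B := \sum_(j < N) C.
have B0 : 0 <= B by rewrite sumr_ge0// => j _; exact: C' j.
have B1 : 0 < B + 1 by rewrite ltr_wpDl.
apply/nearP; exists (Num.min r (e / (B + 1))); first by rewrite lt_min r0 divr_gt0.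
move=> y; rewrite lt_min => /andP[yr ye].
have [|t t1] := @MVT_dir R _ F (fun x => dot (y - z) (g x)) z (y - z) 1.
  move=> t; rewrite normr1 => t1; apply: (rP _ _).1.
  rewrite [z + _]addrC addrK normrZ (le_lt_trans _ yr)//.
  by rewrite -[X in _ <= X]mul1r ler_wpM2r.
rewrite scale1r mul1r [z + _]addrC subrK => E.
rewrite E; apply: (@le_trans _ _ (`|y - z| * B)); last first.
  move: ye; rewrite ltr_pdivlMr// => ye.
  by rewrite (le_trans _ (ltW ye))// ler_wpM2l// lerDl.
rewrite (le_trans (ler_norm_sum _ _ _))// mulr_sumr; apply: ler_sum => j _.
rewrite normrM ler_pM//; first exact: entry_le_norm.
apply: (rP _ _).2; rewrite [z + _]addrC addrK normrZ (le_lt_trans _ yr)//.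
rewrite -[X in _ <= X]mul1r ler_wpM2r//.
by rewrite normr1 in t1.
Qed.

Lemma open_radius (E : normedModType R) (U : set E) z : open U -> U z ->
  exists2 r : R, 0 < r & forall y, `|y - z| < r -> U y.
Proof. by move=> oU Uz; apply/(nearP z U); apply: open_nbhs_nbhs. Qed.

Lemma smooth_of_gradient (U : set 'rV[R]_N) (F : 'rV[R]_N -> R) (g : 'rV[R]_N -> 'rV[R]_N) :
  open U -> smooth U g -> (forall z v, U z -> is_derive z v F (dot v (g z))) -> smooth U F.
Proof.
move=> oU gC Fd.
have Fc z : U z -> {for z, continuous F}.
  move=> Uz; apply: (@continuous_of_gradient F g z (\sum_j (`|g z 0 j| + 1))).
  have gc j : {for z, continuous (fun y => g y 0 j)}.
    exact: smooth_continuous ((smooth_rV _ oU).1 gC j) Uz.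
  have /nearP[r1 r10 H1] := near_bounded (f := fun j y => g y 0 j) gc.
  have [r2 r20 H2] := open_radius oU Uz.
  apply/nearP; exists (Num.min r1 r2) => [|y]; first by rewrite lt_min r10.
  by rewrite lt_min => /andP[/H1 y1 /H2 y2]; split=> // v; exact: Fd.
case=> [|n]; first by split=> // z; exact: Fc.
split=> [z|v]; first exact: Fc.
split=> [z Uz|]; first by have [] := Fd z v Uz.
apply: (Cn_eq oU _ (smooth_dot_cst oU v gC n)) => z Uz.
by have [_ ->] := Fd z v Uz.
Qed.

Lemma closed_of_partials (U : set 'rV[R]_N) (g : 'rV[R]_N -> 'rV[R]_N) : open U -> smooth U g ->
  (forall z i j, U z -> 'D_(delta_mx 0 i) (fun y => g y 0 j) z = 'D_(delta_mx 0 j) (fun y => g y 0 i) z) ->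
  forall z v w, U z -> 'D_v (fun y => dot w (g y)) z = 'D_w (fun y => dot v (g y)) z.
Proof.
move=> oU gC gclosed z v w Uz.
have E (a b : 'rV[R]_N) : 'D_a (fun y => dot b (g y)) z =
    \sum_i \sum_j a 0 i * b 0 j * 'D_(delta_mx 0 i) (fun y => g y 0 j) z.
  have aE : a = \sum_i a 0 i *: delta_mx 0 i by rewrite {1}(row_sum_delta a).
  have [_] := smooth_derive_lincomb (fun i => delta_mx 0 i) (fun i => a 0 i) oU (smooth_dot_cst oU b gC) Uz.
  rewrite -aE => ->; apply: eq_bigr => i _.
  have H j : is_derive z (delta_mx 0 i) (fun y => b 0 j * g y 0 j) (b 0 j * 'D_(delta_mx 0 i) (fun y => g y 0 j) z).
    apply: is_derive_scalel.
    by exact: smooth_derivable ((smooth_rV _ oU).1 gC j) Uz.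
  have [_ D] := is_derive_sum_fun (index_enum 'I_N) H.
  apply: (etrans (congr1 (fun x => a 0 i * x) D)); rewrite mulr_sumr; apply: eq_bigr => j _.
  by rewrite mulrA.
rewrite !E exchange_big; apply: eq_bigr => i _; apply: eq_bigr => j _.
by rewrite gclosed// [v 0 j * _]mulrC.
Qed.

Lemma is_derive_exprn (k : nat) (t : R) : is_derive t (1 : R) (fun t => t ^+ k.+1) (k.+1%:R * t ^+ k).
Proof.
elim: k => [|k IH].
  by rewrite mul1r; exact: is_derive_id.
rewrite (_ : (fun t => _) = fun t => t * t ^+ k.+1); last by apply/funext => x; rewrite exprS.
apply: (is_derive_eq (is_derive_mul (is_derive_id t (1 : R)) IH)).
by rewrite -[k.+2%:R]natr1 exprS; ring.
Qed.

End gradients.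

(** * Second-order remainders and limits of sequences *)

Section taylor.
Context {R : realType}.

(** Two applications of the mean value theorem, hence the constant [M] instead of [M / 2]. *)
Lemma taylor_bound (E : normedModType R) (f f1 f2 : E -> R) x v (h M : R) :
  (forall t : R, `|t| <= `|h| -> is_derive (x + t *: v) v f (f1 (x + t *: v))) ->
  (forall t : R, `|t| <= `|h| -> is_derive (x + t *: v) v f1 (f2 (x + t *: v))) ->
  (forall t : R, `|t| <= `|h| -> `|f2 (x + t *: v)| <= M) ->
  `|f (x + h *: v) - f x - h * f1 x| <= M * `|h| * `|h|.
Proof.
move=> fd f1d f2M; have [t th ->] := MVT_dir fd.
have [|s st E1] := @MVT_dir R E f1 f2 x v t.
  by move=> s st; apply: f1d; exact: le_trans th.
rewrite -mulrBr E1 !normrM mulrC ler_wpM2r// mulrC ler_pM//.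
by apply: f2M; exact: le_trans th.
Qed.

Lemma cvgn_sum (I : Type) (r : seq I) (x : I -> nat -> R) (l : I -> R) :
  (forall i, x i @ \oo --> l i) -> (fun n => \sum_(i <- r) x i n) @ \oo --> \sum_(i <- r) l i.
Proof.
move=> xl; elim: r => [|i r IH].
  by rewrite big_nil (_ : (fun n => _) = fun=> 0); [exact: cvg_cst|apply/funext => n; rewrite big_nil].
rewrite big_cons (_ : (fun n => _) = fun n => x i n + \sum_(i <- r) x i n).
  exact: cvgD.
by apply/funext => n; rewrite big_cons.
Qed.

Lemma cvg_norm_le (x : nat -> R) (l M : R) : x @ \oo --> l -> (forall n, `|x n| <= M) -> `|l| <= M.
Proof.
move=> xl xM.
have nl : (fun n => `|x n|) @ \oo --> `|l| by exact: cvg_norm.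
rewrite -(cvg_lim (@Rhausdorff R) nl); apply: limr_le.
  by apply/cvg_ex; exists `|l|.
by near=> n; exact: xM.
Unshelve. all: by end_near. Qed.

End taylor.

(** * Picard iteration along rays *)

Section frobenius.
Context {R : realType} {N K : nat} (U : set 'rV[R]_N) (c : 'rV[R]_N).
Hypothesis oU : open U.
Hypothesis star : forall u (t : R), U u -> 0 <= t <= 1 -> U (c + t *: (u - c)).
Variables (Om : 'I_N -> 'rV[R]_N -> 'M[R]_K) (y0 : 'rV[R]_K).
Hypothesis Om_smooth : forall j b a, smooth U (fun z => Om j z b a).
Hypothesis Om_closed : forall z (i j : 'I_N) b a, U z ->
  'D_(delta_mx 0 i) (fun z => Om j z b a) z = 'D_(delta_mx 0 j) (fun z => Om i z b a) z.
Hypothesis Om_comm : forall z i j, U z -> Om i z *m Om j z = Om j z *m Om i z.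

Definition picard_form (Y : 'rV[R]_N -> 'rV[R]_K) a z : 'rV[R]_N := \row_j (Y z *m Om j z) 0 a.
Definition picard_step (Y : 'rV[R]_N -> 'rV[R]_K) z : 'rV[R]_K :=
  \row_a ray_primitive c (picard_form Y a) z.
Definition picard k := iter k picard_step (fun=> y0).
Definition connection (v z : 'rV[R]_N) : 'M[R]_K := \sum_j v 0 j *: Om j z.

Lemma dot_picard_form Y a (v z : 'rV[R]_N) : dot v (picard_form Y a z) = (Y z *m connection v z) 0 a.
Proof.
rewrite /connection mulmx_sumr summxE; apply: eq_bigr => j _.
by rewrite -scalemxAr !mxE.
Qed.

Let form_smooth Y a : smooth U Y -> smooth U (picard_form Y a).
Proof.
move=> YC; apply/(smooth_rV _ oU) => j.
apply: (smooth_eq oU (f := fun z => \sum_b Y z 0 b * Om j z b a)).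
  by move=> z _; rewrite !mxE.
apply: smooth_sum => // b; apply: smoothM => //.
exact: (smooth_rV _ oU).1 YC b.
Qed.

(** Exactness of [Y Om] requires [dY /\ Om + Y d Om = 0]. As [Om] is closed, the property to carry
    through the iteration is [dY /\ Om = 0], with [G] the partial derivatives of [Y]. *)
Let good (Y : 'rV[R]_N -> 'rV[R]_K) := smooth U Y /\
  exists G : 'I_N -> 'rV[R]_N -> 'rV[R]_K,
   (forall z (i : 'I_N) a, U z -> is_derive z (delta_mx 0 i) (fun y => Y y 0 a) (G i z 0 a)) /\
   (forall z i j, U z -> G i z *m Om j z = G j z *m Om i z).

Let step_derive Y a z v : good Y -> U z ->
  is_derive z v (fun z => picard_step Y z 0 a) (dot v (picard_form Y a z)).
Proof.
move=> [YC [G [Gd Gsym]]] Uz.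
rewrite (_ : (fun z => _) = ray_primitive c (picard_form Y a)); last first.
  by apply/funext => y; rewrite mxE.
apply: (poincare oU star (form_smooth a YC)) => //.
apply: (closed_of_partials oU (form_smooth a YC)) => {}z i j {}Uz.
have E (i' j' : 'I_N) : 'D_(delta_mx 0 i') (fun y => picard_form Y a y 0 j') z =
    (G i' z *m Om j' z) 0 a + \sum_b Y z 0 b * 'D_(delta_mx 0 i') (fun y => Om j' y b a) z.
  have H b := is_derive_mul (Gd z i' b Uz) (smooth_derivable (delta_mx 0 i') (Om_smooth j' b a) Uz).
  have [_ D] := is_derive_sum_fun (index_enum 'I_K) H.
  rewrite mxE -big_split -[RHS]D; congr ('D_ _ _ z); apply/funext => y.
  by rewrite !mxE.
rewrite !E Gsym//; congr (_ + _); apply: eq_bigr => b _.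
by rewrite Om_closed.
Qed.

Let good_step Y : good Y -> good (picard_step Y).
Proof.
move=> gY; have [YC _] := gY; split.
  apply/(smooth_rV _ oU) => a.
  apply: (smooth_of_gradient oU (form_smooth a YC)) => z v Uz.
  exact: step_derive.
(* The new partial derivatives are [Y Om_i], and [Y Om_i Om_j] is symmetric in [i] and [j] because
   the [Om_i] commute. *)
exists (fun i z => Y z *m Om i z); split=> [z i a Uz|z i j Uz].
  apply: (is_derive_eq (step_derive a (delta_mx 0 i) gY Uz)).
  rewrite /dot (bigD1 i)//= big1 ?addr0; first by rewrite !mxE !eqxx mul1r.
  by move=> j ji; rewrite mxE (negPf ji) andbF mul0r.
by rewrite -!mulmxA Om_comm.
Qed.

Let picard_good k : good (picard k).
Proof.
elim: k => [|k IH]; last exact: good_step.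
split; first exact: smooth_cst.
exists (fun _ _ => 0); split=> [z i a Uz|z i j Uz]; last by rewrite !mul0mx.
by rewrite mxE; exact: is_derive_cst.
Qed.

Let picard_derive k a z v : U z ->
  is_derive z v (fun z => picard k.+1 z 0 a) ((picard k z *m connection v z) 0 a).
Proof. by move=> Uz; rewrite -dot_picard_form; exact: step_derive. Qed.

Let picard_base k : picard k.+1 c = 0.
Proof. by apply/rowP => a; rewrite !mxE ray_primitive_base. Qed.

Let connection_smooth (v : 'rV[R]_N) b a : smooth U (fun z => connection v z b a).
Proof.
apply: (smooth_eq oU (f := fun z => \sum_j v 0 j * Om j z b a)).
  by move=> z _; rewrite summxE; apply: eq_bigr => j _; rewrite mxE.
by apply: smooth_sum => // j; apply: smoothM => //; exact: smooth_cst.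
Qed.

Let mulmx_le (y : 'rV[R]_K) (W : 'M[R]_K) (C M : R) a : 0 <= C ->
  (forall b, `|y 0 b| <= C) -> (forall b, `|W b a| <= M) -> `|(y *m W) 0 a| <= C * (K%:R * M).
Proof.
move=> C0 yC WM; rewrite mxE (le_trans (ler_norm_sum _ _ _))//.
apply: (@le_trans _ _ (\sum_(b < K) C * M)).
  by apply: ler_sum => b _; rewrite normrM ler_pM.
rewrite sumr_const card_ord -[X in X <= _]mulr_natr le_eqVlt; apply/orP; left; apply/eqP; ring.
Qed.

(* The rays are run through as [t ^+ 2] to have a symmetric compact interval of times. *)
Let ray_bound u0 : U u0 -> exists r B : R, [/\ 0 < r, 0 <= B & forall u (t : R),
  `|u - u0| < r -> 0 <= t <= 1 -> forall b a, `|connection (u - c) (c + t *: (u - c)) b a| <= B].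
Proof.
move=> Uu0.
pose G (p : 'rV[R]_N * R) := c + p.2 ^+ 2 *: (p.1 - c).
pose A := [set p | U (G p)].
have c1 j : smooth [set: 'rV[R]_N * R] (fun p => p.1 0 j).
  apply: smooth_linear => [p|p v h]; last by rewrite !mxE.
  apply: (@continuous_comp _ _ _ fst (fun z : 'rV[R]_N => z 0 j)); first exact: cvg_fst.
  exact: coord_continuous.
have c2 : smooth [set: 'rV[R]_N * R] (fun p => p.2).
  by apply: smooth_linear => [p|//]; exact: cvg_snd.
have GC : smooth [set: 'rV[R]_N * R] G.
  apply/(smooth_rV _ openT) => j.
  rewrite (_ : (fun p => _) = fun p : 'rV[R]_N * R => c 0 j + p.2 * p.2 * (p.1 0 j - c 0 j)); last first.
    by apply/funext => p; rewrite !mxE -expr2.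
  apply: smoothD; [exact: openT|exact: smooth_cst|].
  apply: smoothM; [exact: openT|by apply: smoothM; first exact: openT|].
  by apply: smoothB; [exact: openT|exact: c1|exact: smooth_cst].
have oA : open A by apply: open_comp oU => p _; exact: smooth_continuous GC (Logic.I : setT p).
pose W (u : 'rV[R]_N) (t : R) b a := \sum_j (u 0 j - c 0 j) * Om j (G (u, t)) b a.
have WC b a : smooth A (fun p => W p.1 p.2 b a).
  apply: smooth_sum => // j; apply: smoothM => //.
    by apply: smoothB => //; [exact: smooth_subset (c1 j)|exact: smooth_cst].
  apply: (smooth_comp_rV (f := fun z => Om j z b a) oA oU _ _ (Om_smooth j b a)).
    apply: (smooth_eq oA (f := G)); first by case.
    exact: smooth_subset GC.
  by case.
(* A single function dominating the squares of all entries, so that [tube] and the extreme value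
   theorem are applied once. *)
pose f u t := \sum_b \sum_a W u t b a * W u t b a.
have fC : smooth A (fun p => f p.1 p.2).
  by apply: smooth_sum => // b; apply: smooth_sum => // a; apply: smoothM.
have A0 (t : R) : `|t| <= 1 -> A (u0, t).
  move=> t1; apply: star => //; rewrite sqr_ge0/=.
  by rewrite -[X in X <= _]real_normK ?num_real// expr_le1.
have fc (t : R) : `|t| <= 1 -> {for (u0, t), continuous (fun p : 'rV[R]_N * R => f p.1 p.2)}.
  by move=> /A0; exact: smooth_continuous fC.
have [r r0 rP] := tube ltr01 fc.
have [r' r'0 r'P] := open_radius oU Uu0.
have [|tm _ tmP] := @EVT_max R (f u0) (- 1) 1 ltac:(lra).
  apply: continuous_in_subspaceT => t; rewrite inE/= in_itv/= -ler_norml => t1.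
  apply/(@continuous_nearP R) => e e0; have [q q0 qP] := continuous_slabP e0 (fc t t1).
  apply/(@nearP R R); exists q => // y yt; apply: qP => //.
  by rewrite subrr normr0.
have f0 u t : 0 <= f u t by apply: sumr_ge0 => b _; apply: sumr_ge0 => a _; exact: sqr_ge0.
(* To the maximum at [u0], 1 is added for the passage from [u0] to [u] by [tube], and 1 for the
   bound of a number by 1 plus its square. *)
exists (Num.min r r'), (f u0 tm + 2); split=> [||u t].
- by rewrite lt_min r0.
- by rewrite addr_ge0.
rewrite lt_min => /andP[ur _] /andP[t0 t1] b a.
pose s := Num.sqrt t.
have s1 : `|s| <= 1 by rewrite ger0_norm ?sqrtr_ge0// -sqrtr1 ler_wsqrtr.
have -> : connection (u - c) (c + t *: (u - c)) b a = W u s b a.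
  rewrite summxE; apply: eq_bigr => j _; rewrite !mxE /G /=; congr (_ * Om j _ b a).
  by rewrite sqr_sqrtr.
have H1 : f u s <= f u0 tm + 1.
  have := rP u ur s s1; have := tmP s; rewrite in_itv/= -ler_norml => /(_ s1).
  by rewrite ler_norml => ? /andP[_ ?]; lra.
have H2 : W u s b a * W u s b a <= f u s.
  rewrite /f (bigD1 b)//= (bigD1 a)//= -addrA lerDl addr_ge0//.
    by apply: sumr_ge0 => ? _; exact: sqr_ge0.
  by apply: sumr_ge0 => ? _; apply: sumr_ge0 => ? _; exact: sqr_ge0.
have H3 : `|W u s b a| <= 1 + W u s b a * W u s b a.
  have := sqr_ge0 (`|W u s b a| - 1); have := real_normK (num_real (W u s b a)).
  move: (`|W u s b a|) (W u s b a) => x y; nra.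
lra.
Qed.

Let C0 := \sum_a `|y0 0 a|.

(** Every iterate but the zeroth vanishes at [c], and the connection is bounded along all rays that
    end near [u0], so each integration along a ray contributes one more factor of the exponential
    series. The factor [K] counts the summands in an entry of a matrix product. *)
Let picard_bound u0 : U u0 -> exists r B : R, [/\ 0 < r, 0 <= B & forall u,
  `|u - u0| < r -> U u /\ forall k a, `|picard k u 0 a| <= C0 * exp_coeff B k].
Proof.
move=> Uu0; have [r [B [r0 B0 rP]]] := ray_bound Uu0; have [r' r'0 r'P] := open_radius oU Uu0.
exists (Num.min r r'), (K%:R * B); split=> [||u]; first by rewrite lt_min r0.
  by rewrite mulr_ge0.
rewrite lt_min => /andP[ur /r'P Uu]; split=> // k a.
have C00 : 0 <= C0 by apply: sumr_ge0.
pose D := K%:R * B.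
have D0 : 0 <= D by rewrite mulr_ge0.
suff H (t : R) : 0 <= t <= 1 -> forall a, `|picard k (c + t *: (u - c)) 0 a| <= C0 * (D ^+ k / k`!%:R) * t ^+ k.
  have := H 1; rewrite ler01 lexx => /(_ isT a).
  by rewrite scale1r [c + _]addrC subrK expr1n mulr1.
elim: k t {a} => [|k IH] t t01 a.
  rewrite expr0 fact0 divr1 !mulr1 /C0 (bigD1 a)//= lerDl.
  by apply: sumr_ge0.
pose w := u - c.
apply: (unit_derive_bound (f := fun t => picard k.+1 (c + t *: w) 0 a)
  (df := fun t => (picard k (c + t *: w) *m connection w (c + t *: w)) 0 a)
  (g := fun t => C0 * (D ^+ k.+1 / (k.+1)`!%:R) * t ^+ k.+1)
  (dg := fun t => C0 * (D ^+ k.+1 / (k.+1)`!%:R) * (k.+1%:R * t ^+ k))) => //.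
- move=> s s01; apply/(is_derive_line (fun z => picard k.+1 z 0 a)).
  by apply: picard_derive; exact: star.
- by move=> s s01; apply: is_derive_scalel; exact: is_derive_exprn.
- move=> s s01; have /andP[s0 s1] := s01.
  have P0 : 0 <= C0 * (D ^+ k / k`!%:R) * s ^+ k.
    by rewrite !mulr_ge0// ?divr_ge0// exprn_ge0.
  apply: (le_trans (mulmx_le P0 (IH s s01) (fun b => rP u s ur s01 b a))).
  rewrite -/D factS natrM exprS le_eqVlt; apply/orP; left; apply/eqP.
  have n1 : (k.+1%:R : R) != 0 by rewrite pnatr_eq0.
  have n2 : (k`!%:R : R) != 0 by rewrite pnatr_eq0 -lt0n fact_gt0.
  have F (x y p q d : R) : x != 0 -> y != 0 -> C0 * (p / y) * q * d = C0 * (d * p / (x * y)) * (x * q).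
    by move=> x0 y0'; field; rewrite x0 y0'.
  exact: F.
- by rewrite scale0r addr0 picard_base mxE normr0 expr0n mulr0.
Qed.

Definition flat_section z : 'rV[R]_K := \row_a limn (series (fun k => picard k z 0 a)).

Let S n z : 'rV[R]_K := \sum_(0 <= k < n) picard k z.

Let S_series z a : (fun n => S n z 0 a) = series (fun k => picard k z 0 a).
Proof. by apply/funext => n; rewrite /S summxE. Qed.

Let S_bound u0 : U u0 -> exists r C : R, [/\ 0 < r, 0 <= C & forall u,
  `|u - u0| < r -> [/\ U u, forall n a, `|S n u 0 a| <= C &
    forall a, (fun n => S n u 0 a) @ \oo --> flat_section u 0 a]].
Proof.
move=> Uu0; have [r [B [r0 B0 rP]]] := picard_bound Uu0.
have C00 : 0 <= C0 by apply: sumr_ge0.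
have cE := is_cvg_series_exp_coeff B.
exists r, (C0 * expR B); split=> // [|u ur]; first by rewrite mulr_ge0// expR_ge0.
have [Uu uP] := rP u ur.
have le_exp n : \sum_(0 <= k < n) C0 * exp_coeff B k <= C0 * expR B.
  rewrite -mulr_sumr ler_wpM2l//; apply: nondecreasing_cvgn_le cE n.
  by apply: nondecreasing_series => k _ _; exact: exp_coeff_ge0.
split=> // [n a|a].
  rewrite /S summxE (le_trans (ler_norm_sum _ _ _))//.
  by apply: le_trans (le_exp n); apply: ler_sum => k _; exact: uP.
rewrite S_series mxE; apply: normed_cvg.
apply: (@series_le_cvg R _ (fun k => C0 * exp_coeff B k)) => //.
- by move=> k; exact: normr_ge0.
- by move=> k; rewrite mulr_ge0// exp_coeff_ge0.
- by move=> k; exact: uP.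
- by apply: is_cvg_seriesZ.
Qed.

Lemma flat_section_base : flat_section c = y0.
Proof.
apply/rowP => a; rewrite mxE -S_series; apply: cvg_lim => //.
rewrite -(cvg_shiftn 1) (_ : (fun n => _) = fun=> y0 0 a); first exact: cvg_cst.
apply/funext => n; rewrite /S addn1 big_nat_recl// big1 ?addr0// => k _.
Qed.

Let S_derive n a z v : U z -> is_derive z v (fun z => S n.+1 z 0 a) ((S n z *m connection v z) 0 a).
Proof.
move=> Uz; elim: n => [|n IH].
  rewrite /S big_nil mul0mx mxE (_ : (fun z => _) = fun=> y0 0 a); first exact: is_derive_cst.
  by apply/funext => y; rewrite big_nat1.
have E m y : S m.+1 y 0 a = S m y 0 a + picard m y 0 a by rewrite /S big_nat_recr//= mxE.
rewrite (_ : (fun z => _) = fun z => S n.+1 z 0 a + picard n.+1 z 0 a); last by apply/funext => y; exact: E.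
apply: (is_derive_eq (is_derive_addf IH (picard_derive n a v Uz))).
by rewrite {2}/S big_nat_recr//= mulmxDl [RHS]mxE.
Qed.

Let S_derive2 n a z v : U z -> is_derive z v (fun z => (S n.+1 z *m connection v z) 0 a)
  ((S n z *m connection v z *m connection v z) 0 a
   + (S n.+1 z *m (\matrix_(b, a) 'D_v (fun z => connection v z b a) z)) 0 a).
Proof.
move=> Uz.
rewrite (_ : (fun z => _) = fun z => \sum_b S n.+1 z 0 b * connection v z b a); last first.
  by apply/funext => y; rewrite mxE.
have H b := is_derive_mul (S_derive n b v Uz) (smooth_derivable v (connection_smooth v b a) Uz).
refine (is_derive_eq (is_derive_sum_fun (index_enum 'I_K) H) _).
by rewrite !mxE -big_split; apply: eq_bigr => b _; rewrite !mxE.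
Qed.

(** Uniform convergence of derivatives is bypassed: the second-order Taylor estimate for the partial
    sums has a constant independent of [n], so it passes to the limit for each fixed [h]. *)
Lemma flat_section_derive a u0 v : U u0 ->
  is_derive u0 v (fun z => flat_section z 0 a) ((flat_section u0 *m connection v u0) 0 a).
Proof.
move=> Uu0; have [r [C [r0 C0' rP]]] := S_bound Uu0.
pose W z := connection v z.
pose DW z : 'M[R]_K := \matrix_(b, a) 'D_v (fun z => connection v z b a) z.
have WWc (p : 'I_K) : {for u0, continuous (fun z => (W z *m W z) p a)}.
  apply: (smooth_continuous (A := U)) => //.
  apply: (smooth_eq oU (f := fun z => \sum_b W z p b * W z b a)); first by move=> z _; rewrite mxE.
  by apply: smooth_sum => // b; apply: smoothM => //; exact: connection_smooth.
have DWc (p : 'I_K) : {for u0, continuous (fun z => DW z p a)}.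
  apply: (smooth_continuous (A := U)) => //.
  apply: (smooth_eq oU (f := fun z => 'D_v (fun z => connection v z p a) z)); first by move=> z _; rewrite mxE.
  exact: smooth_derive (connection_smooth v p a).
have /nearP[r1 r10 H1] := near_bounded WWc.
have /nearP[r2 r20 H2] := near_bounded DWc.
set M1 := (\sum_j _) in H1; set M2 := (\sum_j _) in H2.
pose M := C * (K%:R * M1) + C * (K%:R * M2).
have M10 : 0 <= M1 by apply: sumr_ge0 => j _; rewrite addr_ge0.
have M20 : 0 <= M2 by apply: sumr_ge0 => j _; rewrite addr_ge0.
have M0 : 0 <= M by rewrite addr_ge0 ?mulr_ge0.
(* Each differentiation lowers the index of a partial sum by one, so the second derivative of
   [S n.+2] is expressed by [S n] and [S n.+1]. *)
have tay (h : R) n : `|h| * `|v| < Num.min r (Num.min r1 r2) ->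
   `|S n.+2 (u0 + h *: v) 0 a - S n.+2 u0 0 a - h * (S n.+1 u0 *m W u0) 0 a| <= M * `|h| * `|h|.
  rewrite !lt_min => /and3P[hr hr1 hr2].
  have near_u0 (t q : R) : `|h| * `|v| < q -> `|t| <= `|h| -> `|u0 + t *: v - u0| < q.
    move=> hq th; rewrite [u0 + _]addrC addrK normrZ (le_lt_trans _ hq)//.
    by rewrite ler_wpM2r.
  have Ut (t : R) : `|t| <= `|h| -> U (u0 + t *: v).
    by move=> th; have [] := rP _ (near_u0 t r hr th).
  apply: (taylor_bound (f := fun z => S n.+2 z 0 a) (f1 := fun z => (S n.+1 z *m W z) 0 a)
    (f2 := fun z => (S n z *m W z *m W z) 0 a + (S n.+1 z *m DW z) 0 a)) => t th.
  - by apply: S_derive; exact: Ut.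
  - by apply: S_derive2; exact: Ut.
  have [_ Sb _] := rP _ (near_u0 t r hr th).
  rewrite (le_trans (ler_normD _ _))// lerD//.
    rewrite -mulmxA; apply: mulmx_le => //.
    by move=> b; apply: H1; exact: near_u0.
  by apply: mulmx_le => // b; apply: H2; exact: near_u0.
have cvgS u : `|u - u0| < r -> forall b, (fun n => S n u 0 b) @ \oo --> flat_section u 0 b.
  by move=> /rP[].
have cvgSn m u : `|u - u0| < r -> forall b, (fun n => S (n + m)%N u 0 b) @ \oo --> flat_section u 0 b.
  by move=> ur b; rewrite (cvg_shiftn m (fun n => S n u 0 b)); exact: cvgS.
have u0r : `|u0 - u0| < r by rewrite subrr normr0.
have lim_le (h : R) : `|h| * `|v| < Num.min r (Num.min r1 r2) ->
   `|flat_section (u0 + h *: v) 0 a - flat_section u0 0 a - h * (flat_section u0 *m W u0) 0 a|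
     <= M * `|h| * `|h|.
  move=> hv; have hr : `|u0 + h *: v - u0| < r.
    rewrite [u0 + _]addrC addrK normrZ (lt_le_trans hv)// ge_min lexx//.
  apply: cvg_norm_le (fun n => tay h n hv).
  apply: cvgB; first apply: cvgB.
  - by have := @cvgSn 2 _ hr a; under eq_fun do rewrite addn2.
  - by have := @cvgSn 2 _ u0r a; under eq_fun do rewrite addn2.
  apply: cvgM; first exact: cvg_cst.
  rewrite mxE (_ : (fun n => _) = fun n => \sum_b S n.+1 u0 0 b * W u0 b a); last first.
    by apply/funext => n; rewrite mxE.
  apply: cvgn_sum => b; apply: cvgM; last exact: cvg_cst.
  by have := @cvgSn 1 _ u0r b; under eq_fun do rewrite addn1.
apply/is_derive_epsP => e e0.
pose q := Num.min r (Num.min r1 r2).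
have q0 : 0 < q by rewrite !lt_min r0 r10.
have V0 : 0 < `|v| + 1 by rewrite ltr_wpDl.
have MM0 : 0 < M + 1 by rewrite ltr_wpDl.
exists (Num.min (q / (`|v| + 1)) (e / (M + 1))) => [|h]; first by rewrite lt_min !divr_gt0.
rewrite lt_min !ltr_pdivlMr// => /andP[hq he].
apply: le_trans (lim_le h _) _.
  by apply: le_lt_trans hq; rewrite ler_wpM2l// lerDl.
rewrite ler_wpM2r// mulrC (le_trans _ (ltW he))// ler_wpM2l// lerDl//.
Qed.

(** The derivatives are [flat_section] times the smooth connection, so smoothness bootstraps from
    continuity, and continuity comes from a locally bounded gradient. *)
Lemma flat_section_smooth : smooth U flat_section.
Proof.
apply/(smooth_rV _ oU) => a n; elim: n a => [|n IH] a.
  split=> // z Uz; have [r [C [r0 C0' rP]]] := S_bound Uz.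
  have fc (j : 'I_N) (b : 'I_K) : {for z, continuous (fun y => Om j y b a)}.
    exact: smooth_continuous (Om_smooth j b a) Uz.
  have /nearP[r1 r10 H1] := near_bounded (f := fun (p : 'I_N * 'I_K) y => Om p.1 y p.2 a) (fun p => fc p.1 p.2).
  set M := (\sum_j _) in H1.
  apply: (@continuous_of_gradient R N _ (picard_form flat_section a) z (C * (K%:R * M))).
  apply/nearP; exists (Num.min r r1) => [|y]; first by rewrite lt_min r0.
  rewrite lt_min => /andP[yr yr1]; have [Uy Sb Sc] := rP y yr; split=> [v|j].
    by rewrite dot_picard_form; exact: flat_section_derive.
  rewrite mxE; apply: mulmx_le => // b; last exact: (H1 y yr1 (j, b)).
  exact: cvg_norm_le (Sc b) (fun n => Sb n b).
split=> [z Uz|v]; first exact: Cn_continuous (IH a) Uz.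
split=> [z Uz|]; first by have [] := flat_section_derive a v Uz.
apply: (Cn_eq oU (f := fun z => \sum_b flat_section z 0 b * connection v z b a)).
  by move=> z Uz; have [_ ->] := flat_section_derive a v Uz; rewrite mxE.
by apply: Cn_sum => // b; apply: Cn_mul => //; exact: connection_smooth.
Qed.

End frobenius.

(** * Hamiltonians for the second operator *)

Section second_hamiltonian.
Context {R : realType} {N L : nat}.
Variables (eta : 'M[R]_N) (mu : 'M[R]_L) (D : set 'rV[R]_N) (psi : 'I_L -> 'rV[R]_N -> R).
Hypotheses (eta_sym : eta^T = eta) (mu_sym : mu^T = mu) (D_open : open D).
Hypothesis psi_smooth : forall n, smooth D (psi n).
Hypothesis eq_mu : forall u, D u -> forall i j k l : 'I_N,
      \sum_(a < L) \sum_(b < L) mu a b *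
        (partial2 i k (psi a) u * partial2 j l (psi b) u
         - partial2 i l (psi a) u * partial2 j k (psi b) u) = 0.
Hypothesis eq_eta : forall u, D u -> forall (a b : 'I_L) (k l : 'I_N),
      \sum_(i < N) \sum_(j < N) eta i j *
        (partial2 i k (psi a) u * partial2 j l (psi b) u
         - partial2 i l (psi a) u * partial2 j k (psi b) u) = 0.
Variables (U : set 'rV[R]_N) (c : 'rV[R]_N).
Hypotheses (oU : open U) (UD : U `<=` D).
Hypothesis star : forall u (t : R), U u -> 0 <= t <= 1 -> U (c + t *: (u - c)).

Let B (j : 'I_N) z : 'M[R]_(N, L) := \matrix_(s, n) \sum_l (- eta l s) * hess psi n z j l.
Let C (j : 'I_N) z : 'M[R]_(L, N) := \matrix_(n, s) \sum_m mu m n * hess psi m z j s.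
(** On rows [(p, g)] the block [C] gives [dp] in terms of [g] and the block [B] gives [dg] in terms
    of [p]: one linear system with [N + L] unknowns. *)
Let Om j z : 'M[R]_(N + L) := block_mx 0 (B j z) (C j z) 0.

(** [Q] relates two functions, so that smoothness and closedness, which compares two indices, are
    both checked block by block. *)
Let Om_entry (Q : ('rV[R]_N -> R) -> ('rV[R]_N -> R) -> Prop) i j :
  Q (fun=> 0) (fun=> 0) ->
  (forall s n, Q (fun z => B i z s n) (fun z => B j z s n)) ->
  (forall n s, Q (fun z => C i z n s) (fun z => C j z n s)) ->
  forall b a, Q (fun z => Om i z b a) (fun z => Om j z b a).
Proof.
move=> Q0 QB QC b a; rewrite -[b]splitK -[a]splitK.
have F k b' a' (f : 'rV[R]_N -> R) : (forall z, Om k z b' a' = f z) -> (fun z => Om k z b' a') = f.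
  by move=> H; apply/funext.
case: (fintype.split b) => b'; case: (fintype.split a) => a' /=.
- by rewrite !(F _ _ _ (fun=> 0))// => z; rewrite block_mxEul mxE.
- by rewrite (F i _ _ (fun z => B i z b' a')) ?(F j _ _ (fun z => B j z b' a'))// => z; rewrite block_mxEur.
- by rewrite (F i _ _ (fun z => C i z b' a')) ?(F j _ _ (fun z => C j z b' a'))// => z; rewrite block_mxEdl.
- by rewrite !(F _ _ _ (fun=> 0))// => z; rewrite block_mxEdr mxE.
Qed.

Let hC m i j : smooth U (fun z => hess psi m z i j).
Proof.
apply: (smooth_eq oU (f := partial i (partial j (psi m)))); first by move=> z _; rewrite hessE.
apply: smooth_subset UD _.
exact: smooth_derive (smooth_derive (delta_mx 0 j) (psi_smooth m)).
Qed.

Let lin_smooth (I : finType) (k : I -> R) (f : I -> 'rV[R]_N -> R) : (forall i, smooth U (f i)) ->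
  smooth U (fun z => \sum_i k i * f i z).
Proof. by move=> fC; apply: smooth_sum => // i; apply: smoothM => //; exact: smooth_cst. Qed.

Let Om_smooth j b a : smooth U (fun z => Om j z b a).
Proof.
apply: (Om_entry (Q := fun f _ => smooth U f) (j := j)).
- exact: smooth_cst.
- move=> s n; apply: (smooth_eq oU _ (lin_smooth (fun l => - eta l s) (fun l => hC n j l))).
  by move=> z _; rewrite mxE.
- move=> n s; apply: (smooth_eq oU _ (lin_smooth (fun m => mu m n) (fun m => hC m j s))).
  by move=> z _; rewrite mxE.
Qed.

Let hess_closed m z i j k : U z ->
  'D_(delta_mx 0 i) (fun z => hess psi m z j k) z = 'D_(delta_mx 0 j) (fun z => hess psi m z i k) z.
Proof.
move=> Uz.
have E p : (fun z => hess psi m z p k) = partial p (partial k (psi m)).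
  by apply/funext => y; rewrite hessE.
rewrite !E.
exact: (smooth_derive_commute (delta_mx 0 j) (delta_mx 0 i) D_open
  (smooth_derive (delta_mx 0 k) (psi_smooth m)) (UD Uz)).
Qed.

Let lin_derive (I : finType) (k : I -> R) (f : I -> 'rV[R]_N -> R) z v : (forall i, smooth U (f i)) -> U z ->
  'D_v (fun z => \sum_i k i * f i z) z = \sum_i k i * 'D_v (f i) z.
Proof.
move=> fC Uz.
have H i := is_derive_scalel (k i) (smooth_derivable v (fC i) Uz).
by have [_ ->] := is_derive_sum_fun (index_enum I) H.
Qed.

Let Om_closed z (i j : 'I_N) b a : U z ->
  'D_(delta_mx 0 i) (fun z => Om j z b a) z = 'D_(delta_mx 0 j) (fun z => Om i z b a) z.
Proof.
move=> Uz.
apply: (Om_entry (Q := fun f g => 'D_(delta_mx 0 i) f z = 'D_(delta_mx 0 j) g z)).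
- by rewrite !derive_cst.
- move=> s n.
  have E k : (fun z => B k z s n) = fun z => \sum_l (- eta l s) * hess psi n z k l.
    by apply/funext => y; rewrite mxE.
  rewrite !E (lin_derive _ _ (fun l => hC n j l) Uz) (lin_derive _ _ (fun l => hC n i l) Uz).
  by apply: eq_bigr => l _; rewrite hess_closed.
- move=> n s.
  have E k : (fun z => C k z n s) = fun z => \sum_m mu m n * hess psi m z k s.
    by apply/funext => y; rewrite mxE.
  rewrite !E (lin_derive _ _ (fun m => hC m j s) Uz) (lin_derive _ _ (fun m => hC m i s) Uz).
  by apply: eq_bigr => m _; rewrite hess_closed.
Qed.

(** One diagonal block of [Om /\ Om = 0]. It comes from the equation contracted with [mu], which
    exchanges indices between the two Hessians, and from the symmetry of [mu]. *)
Let BC_sym z i j : U z -> B i z *m C j z = B j z *m C i z.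
Proof.
move=> Uz; apply/matrixP => s s'.
have E p q : (B p z *m C q z) s s' = \sum_l (- eta l s) *
    \sum_m \sum_n mu m n * (hess psi m z q s' * hess psi n z p l).
  rewrite mxE; under eq_bigr do rewrite !mxE mulr_suml.
  rewrite exchange_big; apply: eq_bigr => l _; rewrite exchange_big mulr_sumr.
  by apply: eq_bigr => n _; rewrite !mulr_sumr; apply: eq_bigr => m _; ring.
rewrite !E; apply: eq_bigr => l _; congr (_ * _).
rewrite (hess_swap eq_mu j i s' l (UD Uz)).
rewrite -!/(msum mu _) (msum_swap _ mu_sym).
by apply: eq_msum => m n; rewrite mulrC.
Qed.

Let mixed_entry (k : 'I_L -> R) (A : 'I_L -> 'M[R]_N) (H : 'M[R]_N) i j : H^T = H ->
  \sum_s (\sum_m k m * A m i s) * (\sum_l (- eta l s) * H j l) =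
  - \sum_m k m * (A m *m eta *m H) i j.
Proof.
move=> Hs; rewrite -sumrN; under eq_bigr do rewrite mulr_suml.
rewrite exchange_big; apply: eq_bigr => m _.
rewrite -mulmxA mxE -mulrN -sumrN mulr_sumr; apply: eq_bigr => s _.
rewrite mxE -mulrN -sumrN !mulr_sumr; apply: eq_bigr => l _.
by rewrite (sym_entry l s eta_sym) (sym_entry j l Hs); ring.
Qed.

Let mixed_sym (A H : 'M[R]_N) : A^T = A -> H^T = H -> A *m eta *m H = H *m eta *m A ->
  (A *m eta *m H)^T = A *m eta *m H.
Proof. by move=> As Hs E; rewrite !trmx_mul eta_sym As Hs mulmxA E. Qed.

Let row_form (v : 'rV[R]_N) (H : 'M[R]_N) s :
  \sum_j v 0 j * (\sum_l (- eta l s) * H j l) = - (v *m (H *m eta)) 0 s.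
Proof.
rewrite mxE -sumrN; apply: eq_bigr => j _; rewrite mxE -mulrN -sumrN; congr (_ * _).
by apply: eq_bigr => l _; ring.
Qed.

(** The other diagonal block. It comes from the equation contracted with [eta], which makes
    [psi_m'' eta psi_n''] a symmetric matrix. *)
Let CB_sym z i j : U z -> C i z *m B j z = C j z *m B i z.
Proof.
move=> Uz; apply/matrixP => n n'.
have E k l : (C k z *m B l z) n n' = - \sum_m mu m n * (hess psi m z *m eta *m hess psi n' z) k l.
  rewrite mxE.
  apply: (etrans _ (mixed_entry (fun m => mu m n) (fun m => hess psi m z) k l
    (hess_sym D_open psi_smooth n' (UD Uz)))).
  by apply: eq_bigr => s _; exact (congr2 *%R (mxE _ _ _ _) (mxE _ _ _ _)).
rewrite !E; congr (- _); apply: eq_bigr => m _; congr (_ * _).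
exact (sym_entry i j (mixed_sym (hess_sym D_open psi_smooth m (UD Uz))
  (hess_sym D_open psi_smooth n' (UD Uz))
  (hess_commute eta_sym D_open psi_smooth eq_eta m n' (UD Uz)))).
Qed.

Let Om_comm z i j : U z -> Om i z *m Om j z = Om j z *m Om i z.
Proof.
move=> Uz; rewrite /Om !mulmx_block !mul0mx !mulmx0 !add0r !addr0.
by rewrite (BC_sym i j Uz) (CB_sym i j Uz).
Qed.

Variable ka : 'rV[R]_L.

Let Y := flat_section c Om (row_mx 0 ka).
Let p z : 'rV[R]_N := lsubmx (Y z).
Let g z : 'rV[R]_L := rsubmx (Y z).

Let Y_smooth : smooth U Y.
Proof. exact: (flat_section_smooth oU star _ Om_smooth Om_closed Om_comm). Qed.

Let Y_derive a z v : U z -> is_derive z v (fun z => Y z 0 a) ((Y z *m connection Om v z) 0 a).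
Proof. exact: (flat_section_derive oU star _ Om_smooth Om_closed Om_comm). Qed.

Let connectionE v z : connection Om v z =
  block_mx 0 (\sum_j v 0 j *: B j z) (\sum_j v 0 j *: C j z) 0.
Proof.
apply/matrixP => b a; rewrite summxE -[b]splitK -[a]splitK.
by case: (fintype.split b) => b'; case: (fintype.split a) => a' /=;
  rewrite ?block_mxEul ?block_mxEur ?block_mxEdl ?block_mxEdr ?summxE ?[RHS]mxE;
  (apply: big1 || apply: eq_bigr) => j _;
  rewrite mxE ?block_mxEul ?block_mxEur ?block_mxEdl ?block_mxEdr ?mxE ?mulr0.
Qed.

Let p_derive s z v : U z ->
  is_derive z v (fun z => p z 0 s) (msum mu (fun m n => g z 0 n * (v *m hess psi m z) 0 s)).
Proof.
move=> Uz.
rewrite (_ : (fun z => _) = fun z => Y z 0 (lshift L s)); last by apply/funext => y; rewrite mxE.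
apply: (is_derive_eq (Y_derive _ v Uz)).
rewrite -[Y z]hsubmxK connectionE mul_row_block row_mxEl mulmx0 add0r mxE /msum exchange_big.
apply: eq_bigr => n _; rewrite summxE mulr_sumr.
under [RHS]eq_bigr do rewrite [X in _ * (_ * X)]mxE !mulr_sumr.
rewrite exchange_big; apply: eq_bigr => j _; rewrite !mxE !mulr_sumr.
by apply: eq_bigr => m _; rewrite -/(g z); ring.
Qed.

Let g_derive n z v : U z ->
  is_derive z v (fun z => g z 0 n) (- dot (v *m affinor eta psi n z) (p z)).
Proof.
move=> Uz.
rewrite (_ : (fun z => _) = fun z => Y z 0 (rshift N n)); last by apply/funext => y; rewrite mxE.
apply: (is_derive_eq (Y_derive _ v Uz)).
rewrite -[Y z]hsubmxK connectionE mul_row_block row_mxEr mulmx0 addr0 mxE /dot -sumrN.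
apply: eq_bigr => s _.
have K : (\sum_j v 0 j *: B j z) s n = - (v *m affinor eta psi n z) 0 s.
  rewrite affinorE -row_form summxE; apply: eq_bigr => j _.
  by rewrite mxE; congr (_ * _); rewrite mxE.
by rewrite K mulrN mulrC.
Qed.

Let pC : smooth U p.
Proof.
apply/(smooth_rV _ oU) => s.
apply: (smooth_eq oU (f := fun z => Y z 0 (lshift L s))); first by move=> y _; rewrite [RHS]mxE.
exact: (smooth_rV _ oU).1 Y_smooth _.
Qed.

Let h := ray_primitive c p.

(** The Jacobian matrix of [p] is a combination of Hessians, hence symmetric; so [p] is closed and
    has the potential [h]. *)
Let h_derive z v : U z -> is_derive z v h (dot v (p z)).
Proof.
apply: (poincare oU star pC); apply: (closed_of_partials oU pC) => {}z i j Uz.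
have E i' j' : 'D_(delta_mx 0 i') (fun y => p y 0 j') z = msum mu (fun m n => g z 0 n * hess psi m z i' j').
  have [_ ->] := p_derive j' (delta_mx 0 i') Uz; apply: eq_msum => m n; congr (_ * _).
  by rewrite -rowE mxE.
rewrite !E; apply: eq_msum => m n.
by rewrite (sym_entry i j (hess_sym D_open psi_smooth m (UD Uz))).
Qed.

Let hsm : smooth U h.
Proof. exact: smooth_of_gradient oU pC h_derive. Qed.

Let grad_h z : U z -> grad h z = p z.
Proof.
move=> Uz; apply/rowP => s; rewrite mxE; have [_ E] := h_derive (delta_mx 0 s) Uz.
rewrite /partial E /dot (bigD1 s)//= big1 ?addr0; first by rewrite mxE !eqxx mul1r.
by move=> j js; rewrite mxE (negPf js) andbF mul0r.
Qed.

Let Y_base : g c = ka.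
Proof. by rewrite /g /Y flat_section_base row_mxKr. Qed.

(** [ka] is the value of [g] at the vacuum, the only constant that survives in the operator applied
    to [p(u)]. Requiring [mu ka] to be a basis vector leaves a single flow. *)
Lemma second_hamiltonian n0 : (forall m, \sum_n mu m n * ka 0 n = (m == n0)%:R) ->
  hamiltonian_system U c (op_comb 1 1 (nonlocal_op eta mu psi) (const_op eta)) (hydro_flow eta (psi n0)).
Proof.
move=> kaE; exists (local_functional c oU hsm) => u uF; apply/funext => x.
have [uC uU [A uA]] := uF; have uD y : D (u y) by exact: UD.
have d1 (f : 'rV[R]_N -> R) (df : 'rV[R]_N -> 'rV[R]_N -> R) y : smooth U f ->
    (forall z v, U z -> is_derive z v f (df z v)) ->
    is_derive y (1 : R) (fun y => f (u y)) (df (u y) (derive1 u y)).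
  move=> fC fd.
  have H := is_derive_comp_rV (1 : R) openT oU uC (Logic.I : setT y) (uU y) fC.
  apply: (is_derive_eq H); rewrite -derive1E.
  have -> : derive1 u y = \sum_i derive1 u y 0 i *: delta_mx 0 i by rewrite {1}(row_sum_delta (derive1 u y)).
  have [_ E] := smooth_derive_lincomb (fun i => delta_mx 0 i) (fun i => derive1 u y 0 i) oU fC (uU y).
  have [_ E2] := fd (u y) (\sum_i derive1 u y 0 i *: delta_mx 0 i) (uU y).
  rewrite -E2 E; rewrite -(row_sum_delta (derive1 u y)); apply: eq_bigr => i _.
  by rewrite mxE.
pose xi y := p (u y).
have xiE : vder (local_functional c oU hsm) u = xi.
  by apply/funext => y; exact: grad_h.
have xic j : continuous (fun y => xi y 0 j).
  by rewrite -xiE; exact: vder_continuous.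
have gd n y : is_derive y (1 : R) (fun y => g (u y) 0 n) (- moment eta psi n u xi y).
  have gC : smooth U (fun z => g z 0 n).
    apply: (smooth_eq oU (f := fun z => Y z 0 (rshift N n))); first by move=> z _; rewrite [RHS]mxE.
    exact: (smooth_rV _ oU).1 Y_smooth _.
  exact: (d1 _ _ y gC (fun z v => g_derive n v)).
have pd s y : is_derive y (1 : R) (fun y => xi y 0 s)
    (msum mu (fun m n => g (u y) 0 n * (derive1 u y *m hess psi m (u y)) 0 s)).
  exact: (d1 _ _ y ((smooth_rV _ oU).1 pC s) (fun z v => p_derive s v)).
(* Minus [g n] along the field is a primitive of the moment, with the value [- ka 0 n] at both
   ends. *)
have momE n : dinv (moment eta psi n u xi) x = - g (u x) 0 n + ka 0 n.
  have nd y : is_derive y (1 : R) (fun y => - g (u y) 0 n) (moment eta psi n u xi y).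
    by have := is_deriveN (gd n y); rewrite opprK.
  have mc : continuous (moment eta psi n u xi).
    have u0 := @const_family R N U c 0 u uF.
    have [JC _ _] := vderP (local_functional c oU hsm) u0.
    have [mc _] := moment_compact eta D_open psi_smooth UD u0
      (JC : slab_smooth setT (fun=> vder (local_functional c oU hsm) u)) n (Logic.I : setT 0).
    by rewrite -xiE.
  have ne y : A <= `|y| -> - g (u y) 0 n = - ka 0 n by move=> /uA ->; rewrite Y_base.
  by apply: (etrans (dinv_derive x nd mc ne)); rewrite opprK.
rewrite xiE (op_comb_pencil mu eta_sym D_open psi_smooth UD 1 1 x uF xic) /pencil !scale1r.
have -> : derive1 xi x *m eta = \sum_m \sum_n (mu m n * g (u x) 0 n) *: hflow eta psi m u x.
  have -> : derive1 xi x = \sum_m \sum_n (mu m n * g (u x) 0 n) *: (derive1 u x *m hess psi m (u x)).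
    rewrite derive1E; have [_ ->] : is_derive x (1 : R) xi
      (\sum_m \sum_n (mu m n * g (u x) 0 n) *: (derive1 u x *m hess psi m (u x))).
      apply/is_derive_rV => s; apply: (is_derive_eq (pd s x)).
      rewrite summxE; apply: eq_bigr => m _; rewrite summxE; apply: eq_bigr => n _.
      by rewrite [RHS]mxE mulrA.
    by [].
  rewrite mulmx_suml; apply: eq_bigr => m _; rewrite mulmx_suml; apply: eq_bigr => n _.
  by rewrite -scalemxAl -mulmxA -affinorE.
rewrite -big_split (hydro_flowE eta_sym D_open psi_smooth n0 (uD x)) -/(hflow eta psi n0 u x).
transitivity (\sum_m (m == n0)%:R *: hflow eta psi m u x).
  by rewrite (bigD1 n0)//= eqxx scale1r big1 ?addr0// => m /negPf ->; rewrite scale0r.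
apply: eq_bigr => m _; rewrite -big_split -kaE scaler_suml; apply: eq_bigr => n _.
by rewrite /= momE -scalerDl; congr (_ *: _); ring.
Qed.

End second_hamiltonian.

(** * The span of the two operators and the local Hamiltonians *)

Section pencils.
Context {R : realType} {N L : nat}.
Variables (eta : 'M[R]_N) (mu : 'M[R]_L) (D : set 'rV[R]_N) (psi : 'I_L -> 'rV[R]_N -> R).
Hypotheses (eta_sym : eta^T = eta) (mu_sym : mu^T = mu) (D_open : open D).
Hypothesis psi_smooth : forall n, smooth D (psi n).
Hypothesis eq_mu : forall u, D u -> forall i j k l : 'I_N,
      \sum_(a < L) \sum_(b < L) mu a b *
        (partial2 i k (psi a) u * partial2 j l (psi b) u
         - partial2 i l (psi a) u * partial2 j k (psi b) u) = 0.
Hypothesis eq_eta : forall u, D u -> forall (a b : 'I_L) (k l : 'I_N),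
      \sum_(i < N) \sum_(j < N) eta i j *
        (partial2 i k (psi a) u * partial2 j l (psi b) u
         - partial2 i l (psi a) u * partial2 j k (psi b) u) = 0.
Variables (U : set 'rV[R]_N) (c : 'rV[R]_N).
Hypotheses (oU : open U) (UD : U `<=` D).

Local Notation M1 := (nonlocal_op eta mu psi).
Local Notation M2 := (const_op eta).

Lemma op_comb_hamiltonian a b : hamiltonian U c (op_comb a b M1 M2).
Proof.
have H := pencil_hamiltonian eta_sym mu_sym D_open psi_smooth a b eq_mu eq_eta c oU UD.
refine (hamiltonian_ext _ H).
move=> u J uF x; apply: esym.
by apply: (op_comb_pencil mu eta_sym D_open psi_smooth UD a b x uF) => j; exact: vder_continuous.
Qed.

(** The span of [M_1] and [M_2] is closed under [op_comb], so compatibility of any two of its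
    members reduces to [op_comb_hamiltonian]. *)
Lemma op_combE a b a' b' a'' b'' :
  op_comb a b (op_comb a' b' M1 M2) (op_comb a'' b'' M1 M2) =
  op_comb (a * a' + b * a'') (a * b' + b * b'') M1 M2.
Proof.
apply/funext => u; apply/funext => xi; apply/funext => x.
by rewrite /op_comb !scalerDr !scalerDl !scalerA addrACA.
Qed.

Lemma nonlocal_opE1 : M1 = op_comb 1 0 M1 M2.
Proof.
apply/funext => u; apply/funext => xi; apply/funext => x.
by rewrite /op_comb scale1r scale0r addr0.
Qed.

Lemma const_opE1 : M2 = op_comb 0 1 M1 M2.
Proof.
apply/funext => u; apply/funext => xi; apply/funext => x.
by rewrite /op_comb scale1r scale0r add0r.
Qed.

Lemma pencil_compatible a b a' b' :
  compatible U c (op_comb a b M1 M2) (op_comb a' b' M1 M2).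
Proof. by split=> [||k l]; rewrite ?op_combE; exact: op_comb_hamiltonian. Qed.

Lemma first_hamiltonian n : hamiltonian_system U c M2 (hydro_flow eta (psi n)).
Proof.
have hC : smooth U (psi n) by exact: smooth_subset UD (psi_smooth n).
exists (local_functional c oU hC) => u [uC uU _]; apply/funext => x.
have uD y : D (u y) by exact: UD.
rewrite (hydro_flowE eta_sym D_open psi_smooth n (uD x)) -/(hflow eta psi n u x).
rewrite -(hflowE eta D_open psi_smooth x n uC uD) const_opE// /potential.
rewrite derive1E.
have gC : smooth setT (fun y => grad (psi n) (u y)).
  exact: grad_smooth openT D_open uC (fun y _ => uD y) (psi_smooth n).
by have [_ ->] := is_derive_mulmxr eta (smooth_derivable (1 : R) gC (Logic.I : setT x)); rewrite derive1E.
Qed.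

End pencils.

Lemma convex_star (R : realType) (N : nat) (U : set 'rV[R]_N) c : convex_set U -> U c ->
  forall u (t : R), U u -> 0 <= t <= 1 -> U (c + t *: (u - c)).
Proof.
move=> Uconv Uc u t Uu /andP[t0 t1].
have := Uconv u c (Itv01 t0 t1); rewrite !inE => /(_ Uu Uc).
congr U; rewrite /conv/=.
by rewrite scalerBl scale1r scalerBr addrC addrAC [RHS]addrA.
Qed.

Theorem theorem12p1 (R : realType) (N L : nat)
    (eta : 'M[R]_N) (mu : 'M[R]_L)
    (eta_sym : eta^T = eta) (eta_nondeg : eta \in unitmx)
    (mu_sym : mu^T = mu) (mu_nondeg : mu \in unitmx)
    (D : set 'rV[R]_N) (D_open : open D)
    (psi : 'I_L -> 'rV[R]_N -> R) (psi_smooth : forall n, smooth D (psi n))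
    (eq_mu : forall u, D u -> forall i j k l : 'I_N,
      \sum_(a < L) \sum_(b < L) mu a b *
        (partial2 i k (psi a) u * partial2 j l (psi b) u
         - partial2 i l (psi a) u * partial2 j k (psi b) u) = 0)
    (eq_eta : forall u, D u -> forall (a b : 'I_L) (k l : 'I_N),
      \sum_(i < N) \sum_(j < N) eta i j *
        (partial2 i k (psi a) u * partial2 j l (psi b) u
         - partial2 i l (psi a) u * partial2 j k (psi b) u) = 0) :
  [/\ forall n m : 'I_L,
        commuting D (hydro_flow eta (psi n)) (hydro_flow eta (psi m)),
      forall (U : set 'rV[R]_N) (c : 'rV[R]_N),
        open U -> convex_set U -> U `<=` D -> U c ->
        forall n : 'I_L,
          bihamiltonian_system U c
            (const_op eta)
            (op_comb 1 1 (nonlocal_op eta mu psi) (const_op eta))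
            (hydro_flow eta (psi n)) &
      forall c : 'rV[R]_N, D c ->
        hamiltonian D c (nonlocal_op eta mu psi) /\
        compatible D c (nonlocal_op eta mu psi) (const_op eta)].
Proof.
split=> [n m|U c oU Uconv UD Uc n|c Dc].
- exact: (flows_commute eta_sym D_open psi_smooth eq_eta).
- split.
  + rewrite [X in compatible _ _ X _](const_opE1 eta mu psi).
    exact: (pencil_compatible eta_sym mu_sym D_open psi_smooth eq_mu eq_eta).
  + exact: (first_hamiltonian eta_sym D_open psi_smooth).
  (* The initial value is the column of the inverse of [mu] with index [n]; this uses the
     nondegeneracy of [mu]. *)
  + apply: (second_hamiltonian eta_sym mu_sym D_open psi_smooth eq_mu eq_eta oU UD
      (convex_star Uconv Uc) (ka := \row_k invmx mu k n)) => m.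
    have := congr1 (fun A : 'M[R]_L => A m n) (mulmxV mu_nondeg); rewrite !mxE => <-.
    by apply: eq_bigr => k _; rewrite mxE.
- split.
    rewrite (nonlocal_opE1 eta mu psi).
    exact: (op_comb_hamiltonian eta_sym mu_sym D_open psi_smooth eq_mu eq_eta).
  rewrite [X in compatible _ _ X _](nonlocal_opE1 eta mu psi).
  rewrite [X in compatible _ _ _ X](const_opE1 eta mu psi).
  exact: (pencil_compatible eta_sym mu_sym D_open psi_smooth eq_mu eq_eta).
Qed.
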